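(* Let $d\ge2$ be an integer. For every $h\in\mathbb R$, $\lambda_h$ is a simple eigenvalue of $L_h$ and there exists a unique function $\chi_h\ge0$ with unit $L^2(\nu)$-norm, continuous and positive on $[h,+\infty)$, vanishing on $(-\infty,h)$, such that $$L_h\chi_h=\lambda_h\chi_h .$$ In addition, for all $k\ge0$, $$\|\chi_h\|_{L^{q_k}(\nu)}\le (d/\lambda_h)^k,\qquad\text{where } q_k=1+d^{2k}.$$ Moreover, the map $h\mapsto\lambda_h$ is a decreasing homeomorphism of $\mathbb R$ onto $(0,d)$.
   Context: $\nu$ is the centered Gaussian law on $\mathbb R$ with variance $\sigma^2=\frac{d}{d^2-1}$, and $\langle\cdot,\cdot\rangle_\nu$ is the scalar product of $L^2(\nu)$. $L$ is the bounded self-adjoint operator on $L^2(\nu)$ given by $(Lg)(a)=d\,E^Y\big[g\big(\tfrac ad+\sqrt{1-d^{-2}}\,Y\big)\big]$ with $Y$ distributed according to $\nu$ (that is, $L=d\,Q_{t_1}$ where $Q_t$ is the Ornstein–Uhlenbeck semigroup $Q_tg(a)=E^Y[g(ae^{-t}+\sqrt{1-e^{-2t}}\,Y)]$ and $t_1=\log d$). For $h\in\mathbb R$, $\pi_h$ is multiplication by $1_{[h,\infty)}$, and $L_h=\pi_hL\pi_h$, a self-adjoint, non-negative, Hilbert–Schmidt operator on $L^2(\nu)$. Finally, $$\lambda_h=\|L_h\|_{L^2(\nu)\to L^2(\nu)}=\sup\{\langle g,L_hg\rangle_\nu:\ \|g\|_{L^2(\nu)}=1\}.$$ *)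

(* Defs.v *)
From HB Require Import structures.
From mathcomp Require Import all_boot all_order all_algebra.
From mathcomp Require Import all_classical all_reals all_analysis.
Set Implicit Arguments.
Unset Strict Implicit.
Unset Printing Implicit Defensive.
Import Order.TTheory GRing.Theory Num.Theory.
Import numFieldNormedType.Exports.
Local Open Scope classical_set_scope.
Local Open Scope ring_scope.

(* Elements of L^2(mu) are represented by functions f \in Lfun mu 2%:E, taken
   up to mu-almost everywhere equality; an operator on L^2(mu) is given by its
   action on representatives. *)
Section L2_operators.
Context {d : measure_display} {T : measurableType d} {R : realType}.
Variables (mu : {measure set T -> \bar R}) (A : (T -> R) -> (T -> R)).

Definition L2_opnorm : \bar R :=
  ereal_sup [set ('N[mu]_2%:E[EFin \o A g])%E
            | g in [set g : T -> R | g \in Lfun mu 2%:E /\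
                                     ('N[mu]_2%:E[EFin \o g])%E = 1%E]].

Definition L2_eigenspace (l : R) : set (T -> R) :=
  [set g | g \in Lfun mu 2%:E /\ A g = l \*o g %[ae mu]].

(* The eigenspace of l is one-dimensional; for a self-adjoint operator the
   algebraic and geometric multiplicities coincide. *)
Definition L2_simple_eigenvalue (l : R) : Prop :=
  exists f, [/\ L2_eigenspace l f, ~ (f = cst 0 %[ae mu]) &
    forall g, L2_eigenspace l g -> exists c : R, g = c \*o f %[ae mu]].

End L2_operators.

Definition homeomorphism_onto {T U : topologicalType} (f : T -> U)
    (B : set U) : Prop :=
  [/\ set_bij [set: T] B f, continuous f &
      exists2 g : U -> T, cancel f g & {within B, continuous g}].

Section model.
Context {R : realType}.
Variable d : nat.

(* The second argument of normal_prob is the standard deviation. *)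
Definition nu : probability (measurableTypeR R) R :=
  normal_prob 0 (Num.sqrt (d%:R / (d%:R ^+ 2 - 1))).

Definition Lop (g : R -> R) (a : R) : R :=
  d%:R * \int[nu]_y g (a / d%:R + Num.sqrt (1 - d%:R ^- 2) * y).

Definition pih (h : R) (g : R -> R) (a : R) : R :=
  \1_(`[h, +oo[%classic) a * g a.

Definition Lh (h : R) (g : R -> R) : R -> R := pih h (Lop (pih h g)).

(* For d >= 2, Lh h is bounded on L^2(nu), so fine loses nothing. *)
Definition lambda (h : R) : R := fine (L2_opnorm nu (Lh h)).

End model.

Arguments nu {R} d.

(* Main.v *)
Require Import Defs.
From HB Require Import structures.
From mathcomp Require Import all_boot all_order all_algebra.
From mathcomp Require Import all_classical all_reals all_analysis.
From mathcomp Require Import measurable_realfun.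
From mathcomp Require Import ring lra.
Set Implicit Arguments.
Unset Strict Implicit.
Unset Printing Implicit Defensive.
Import Order.TTheory GRing.Theory Num.Theory.
Import numFieldNormedType.Exports.
Local Open Scope classical_set_scope.
Local Open Scope ring_scope.

(** With respect to nu, the operator L has the symmetric positive kernel d m(x,y),
where m is the Mehler kernel of correlation 1/d; hence L_h has the restriction
of this kernel to the square of [h, +oo[. A Gaussian computation
(mehler_diag_pdf) shows that these kernels are Hilbert-Schmidt.

Existence of the eigenfunction (top_eigenfunction) holds for every symmetric
nonnegative Hilbert-Schmidt kernel k whose operator A has norm l > 0. The normalized
squared norms of A^n k(x,.) decrease with n. They cannot tend to 0 for all x,
because an almost maximizing vector of A is almost maximizing for all the powers
of A. For x with a positive limit, the normalized A^(2n) k(x,.) form a Cauchy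
sequence, whose limit is an eigenvector u of A^2, and l u + A u is the
eigenvector of A. Simplicity (eigenvalue_simple) is the Perron-Frobenius
argument: the kernel is positive on the half line, so that a real eigenvector
orthogonal to the positive one cannot change sign. The eigenfunction is
d / lambda_h times its own Gaussian average on [h, +oo[, and so it is continuous
there.

The bound of the norms iterates Nelson's inequality ||Q f||_q <= ||f||_p, valid
for the correlation r if r^2 (q - 1) <= p - 1 (hypercontractive). Here r = 1/d,
and q_k - 1 = d^(2k) is multiplied by d^2 at each iteration. The inequality
follows by duality from
E[U(xi)^a V(eta)^b] <= E[U]^a E[V]^b, with a = 1/p and b = 1 - 1/q,
for Gaussian variables xi and eta of correlation r (correlated_product). In the
variables x + e xi and y + e eta, the second order term in e of the left hand
side is nonpositive, because u^a v^b is concave in the correlated directions; a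
Taylor expansion therefore proves the inequality up to an error of order e^3
(one_step). A step of size sqrt 2 e is made of two independent steps of size e,
so that the error only doubles (step_bound_double). Starting from the size
2^(-n/2), n doublings lead to the size 1 with an error of order
2^n 2^(-3n/2), which tends to 0. This requires smooth functions with values in a
compact subset of ]0, +oo[; mollification and truncation remove these
assumptions.

The ground state of a half line is a test function for all the larger ones, and
its image is positive on the strip between them, whence the strict monotonicity
of lambda (tnorm_decr). Conversely the ground state of the larger half line,
restricted to the smaller one, only loses what it carries on the strip; as its
square is at most a constant times the diagonal of the kernel, the variation of
lambda is locally bounded by a multiple of the length of the strip
(tnorm_increment). The
Hilbert-Schmidt norm tends to 0 as h tends to +oo, and the indicator of
[h, +oo[ shows that lambda_h tends to d at -oo. *)

(** * Square integrable functions *)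

Section square_integrable.
Context {d : measure_display} {T : measurableType d} {R : realType}.
Variable mu : {measure set T -> \bar R}.
Implicit Types f g h : T -> R.

Definition l1 f := mu.-integrable [set: T] (EFin \o f).
Definition l2 f :=
  measurable_fun [set: T] f /\ l1 (fun x => f x ^+ 2).
Definition ip f g := \int[mu]_x (f x * g x).

Lemma l1_measurable f : l1 f -> measurable_fun [set: T] f.
Proof. by move=> /(measurable_int mu)/measurable_EFinP. Qed.

Lemma l1_le f g : measurable_fun [set: T] f -> l1 g ->
  (forall x, `|f x| <= g x) -> l1 f.
Proof.
move=> mf ig fg; apply: le_integrable ig => //; first exact/measurable_EFinP.
by move=> x _ /=; rewrite lee_fin (le_trans (fg x))// ler_norm.
Qed.

Lemma l1D f g : l1 f -> l1 g -> l1 (fun x => f x + g x).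
Proof. by move=> i1 i2; exact: (integrableD measurableT i1 i2). Qed.

Lemma l1B f g : l1 f -> l1 g -> l1 (fun x => f x - g x).
Proof. by move=> i1 i2; exact: (integrableB measurableT i1 i2). Qed.

Lemma l1Z c f : l1 f -> l1 (fun x => c * f x).
Proof. by move=> i1; exact: (integrableZl measurableT c i1). Qed.

Lemma l1_norm f : l1 f -> l1 (fun x => `|f x|).
Proof.
move=> i1; apply: (@l1_le _ (fun x => `|f x|)).
- by apply: measurableT_comp => //; exact: l1_measurable.
- exact: integrable_norm.
- by move=> x; rewrite normr_id.
Qed.

Lemma l1_finP f : measurable_fun [set: T] f -> (forall x, 0 <= f x) ->
  ((\int[mu]_x (f x)%:E) < +oo)%E -> l1 f.
Proof.
move=> mf f0 fy; apply/integrableP; split; first exact/measurable_EFinP.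
by under eq_integral do rewrite /= ger0_norm//.
Qed.

Lemma RintD f g : l1 f -> l1 g ->
  \int[mu]_x (f x + g x) = \int[mu]_x f x + \int[mu]_x g x.
Proof. by move=> i1 i2; exact: RintegralD. Qed.

Lemma RintB f g : l1 f -> l1 g ->
  \int[mu]_x (f x - g x) = \int[mu]_x f x - \int[mu]_x g x.
Proof. by move=> i1 i2; exact: RintegralB. Qed.

Lemma RintZ c f : l1 f -> \int[mu]_x (c * f x) = c * \int[mu]_x f x.
Proof. by move=> i1; exact: RintegralZl. Qed.

Lemma le_Rint f g : l1 f -> l1 g -> (forall x, f x <= g x) ->
  \int[mu]_x f x <= \int[mu]_x g x.
Proof. by move=> i1 i2 fg; apply: le_Rintegral => // x _; exact: fg. Qed.

Lemma Rint_ge0 f : (forall x, 0 <= f x) -> 0 <= \int[mu]_x f x.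
Proof. by move=> f0; apply: Rintegral_ge0 => x _; exact: f0. Qed.

Lemma eq_Rint f g : (forall x, f x = g x) -> \int[mu]_x f x = \int[mu]_x g x.
Proof. by move=> fg; apply: eq_Rintegral => x _; exact: fg. Qed.

Lemma le_norm_Rint f : l1 f -> `|\int[mu]_x f x| <= \int[mu]_x `|f x|.
Proof. by move=> i1; exact: le_normr_Rintegral. Qed.

Lemma EFin_Rint f : l1 f -> (\int[mu]_x (f x)%:E = (\int[mu]_x f x)%:E)%E.
Proof. by move=> i1; rewrite /Rintegral fineK//; exact: integrable_fin_num. Qed.

Lemma ae_eq_Rint f g : measurable_fun [set: T] f -> measurable_fun [set: T] g ->
  f = g %[ae mu] -> \int[mu]_x f x = \int[mu]_x g x.
Proof.
move=> mf mg fg; congr fine; apply: ae_eq_integral => //.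
- exact/measurable_EFinP.
- exact/measurable_EFinP.
- by apply: filterS fg => x /= h xT; congr EFin; exact: h.
Qed.

Lemma Rint_eq0_ae f : l1 f -> (forall x, 0 <= f x) -> \int[mu]_x f x = 0 ->
  f = cst 0 %[ae mu].
Proof.
move=> i1 f0 if0.
have mf : measurable_fun [set: T] (EFin \o f).
  by apply/measurable_EFinP; exact: l1_measurable.
have : (\int[mu]_x `|(f x)%:E| = 0)%E.
  under eq_integral do rewrite gee0_abs ?lee_fin//.
  by rewrite EFin_Rint// if0.
move=> /(ae_eq_integral_abs mu measurableT mf).
by apply: filterS => x /= h xT; have [] := h xT.
Qed.

Lemma dct_Rint (f_ : nat -> T -> R) f g :
  (forall n, measurable_fun [set: T] (f_ n)) -> l1 g ->
  (forall n x, `|f_ n x| <= g x) -> (forall x, f_ ^~ x @ \oo --> f x) ->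
  l1 f /\ (\int[mu]_x f_ n x @[n --> \oo] --> \int[mu]_x f x).
Proof.
move=> mf_ ig fg ff.
have mf : measurable_fun [set: T] f.
  by apply: (@measurable_fun_cvg _ _ _ _ f_) => // x _; exact: ff.
have ifn n : l1 (f_ n) by exact: l1_le ig _.
have [|||//||i1 _ cv] := @dominated_convergence _ T R mu setT measurableT
  (fun n => EFin \o f_ n) (EFin \o f) (EFin \o g).
- by move=> n; exact/measurable_EFinP.
- exact/measurable_EFinP.
- apply: aeW => x _; apply: cvg_EFin; first exact: nearW.
  exact: ff.
- by apply: aeW => x n _; rewrite lee_fin.
split=> //.
have : (\int[mu]_x (EFin \o f_ n) x)%E @[n --> \oo] --> (\int[mu]_x f x)%:E.
  by rewrite -EFin_Rint.
by move/fine_cvgP => [_].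
Qed.

Lemma fatou_Rint (f_ : nat -> T -> R) f B :
  (forall n, l1 (f_ n)) -> (forall n x, 0 <= f_ n x) ->
  (forall x, f_ ^~ x @ \oo --> f x) -> (forall n, \int[mu]_x f_ n x <= B) ->
  l1 f /\ \int[mu]_x f x <= B.
Proof.
move=> lf_ f0 ff fB.
have mf : measurable_fun [set: T] f.
  apply: (@measurable_fun_cvg _ _ _ _ f_) => [n|x _]; last exact: ff.
  exact: l1_measurable (lf_ n).
have f_ge0 x : 0 <= f x.
  by apply: (cvgr_to_ge (ff x)); apply: nearW => n; exact: f0.
have h : (\int[mu]_x (f x)%:E <= B%:E)%E.
  have := @fatou _ T R mu setT measurableT (fun n x => (f_ n x)%:E).
  have liminfE x : limn_einf (fun n => (f_ n x)%:E) = (f x)%:E.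
    have cvx : (fun n => (f_ n x)%:E) @ \oo --> (f x)%:E.
      by apply: cvg_EFin; [exact: nearW|exact: ff].
    by have [] := cvg_limn_einf_sup cvx.
  under eq_integral => x _ do rewrite liminfE.
  move=> F; apply: le_trans (F _ _) _.
  - by move=> n; apply/measurable_EFinP; exact: l1_measurable (lf_ n).
  - by move=> n x _; rewrite lee_fin.
  - rewrite limn_einf_lim; apply: lime_le; first exact: is_cvg_einfs.
    apply: nearW => n; apply: (@le_trans _ _ (\int[mu]_x (f_ n x)%:E)%E).
      by apply: ereal_inf_lbound; exists n => /=.
    by rewrite EFin_Rint// lee_fin.
have lf : l1 f by apply: l1_finP => //; exact: le_lt_trans h (ltry _).
by split => //; rewrite -lee_fin -EFin_Rint.
Qed.

Lemma l2_measurable f : l2 f -> measurable_fun [set: T] f.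
Proof. by case. Qed.

Lemma l2_l1M f g : l2 f -> l2 g -> l1 (fun x => f x * g x).
Proof.
move=> [mf f2] [mg g2].
apply: (@l1_le _ (fun x => f x ^+ 2 + g x ^+ 2)).
- exact: measurable_funM.
- exact: l1D.
- move=> x; rewrite normrM -(real_normK (num_real (f x))).
  rewrite -(real_normK (num_real (g x))).
  by have := normr_ge0 (f x); have := normr_ge0 (g x); nra.
Qed.

Lemma l2_le f g : measurable_fun [set: T] f -> l2 g ->
  (forall x, `|f x| <= g x) -> l2 f.
Proof.
move=> mf [mg g2] fg; split=> //; apply: (@l1_le _ (fun x => g x ^+ 2)) => //.
- exact: measurable_funX.
- by move=> x; rewrite normrX lerXn2r// ?nnegrE ?(le_trans _ (fg x)).
Qed.

Lemma l2D f g : l2 f -> l2 g -> l2 (fun x => f x + g x).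
Proof.
move=> l2f l2g; have [mf f2] := l2f; have [mg g2] := l2g; split.
  exact: measurable_funD.
rewrite (_ : (fun x => _) =
  (fun x => (f x ^+ 2 + g x ^+ 2) + 2 * (f x * g x))); last first.
  by apply/funext => x; ring.
by apply: l1D; [exact: l1D|apply: l1Z; exact: l2_l1M].
Qed.

Lemma l2Z c f : l2 f -> l2 (fun x => c * f x).
Proof.
move=> [mf f2]; split; first exact: measurable_funM.
rewrite (_ : (fun x => _) = (fun x => c ^+ 2 * f x ^+ 2)); first exact: l1Z.
by apply/funext => x; ring.
Qed.

Lemma l2B f g : l2 f -> l2 g -> l2 (fun x => f x - g x).
Proof.
move=> l2f l2g; rewrite (_ : (fun x => _) = (fun x => f x + -1 * g x)).
  by apply: l2D => //; exact: l2Z.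
by apply/funext => x; ring.
Qed.

Lemma l2_norm f : l2 f -> l2 (fun x => `|f x|).
Proof.
move=> [mf f2]; split; first exact: measurableT_comp.
rewrite (_ : (fun x => _) = (fun x => f x ^+ 2))//.
by apply/funext => x; rewrite real_normK// num_real.
Qed.

Lemma ipE f : ip f f = \int[mu]_x (f x ^+ 2).
Proof. by apply: eq_Rint => x; rewrite expr2. Qed.

Lemma ip_ge0 f : 0 <= ip f f.
Proof. by rewrite ipE; apply: Rint_ge0 => x; exact: sqr_ge0. Qed.

Lemma ipC f g : ip f g = ip g f.
Proof. by apply: eq_Rint => x; rewrite mulrC. Qed.

Lemma ipDl f g h : l2 f -> l2 g -> l2 h ->
  ip (fun x => f x + g x) h = ip f h + ip g h.
Proof.
move=> lf lg lh; rewrite /ip -RintD; [|exact: l2_l1M|exact: l2_l1M].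
by apply: eq_Rint => x; rewrite mulrDl.
Qed.

Lemma ipZl c f h : l2 f -> l2 h -> ip (fun x => c * f x) h = c * ip f h.
Proof.
move=> lf lh; rewrite /ip -RintZ; last exact: l2_l1M.
by apply: eq_Rint => x; rewrite mulrA.
Qed.

Lemma ipBl f g h : l2 f -> l2 g -> l2 h ->
  ip (fun x => f x - g x) h = ip f h - ip g h.
Proof.
move=> lf lg lh; rewrite /ip -RintB; [|exact: l2_l1M|exact: l2_l1M].
by apply: eq_Rint => x; rewrite mulrBl.
Qed.

Lemma ipBB f g : l2 f -> l2 g ->
  ip (fun x => f x - g x) (fun x => f x - g x) = ip f f - 2 * ip f g + ip g g.
Proof.
move=> lf lg; have lfg := l2B lf lg.
by rewrite ipBl// ![ip _ (fun x => _ - _)]ipC !ipBl// (ipC g f); ring.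
Qed.

Lemma ipBr f g h : l2 f -> l2 g -> l2 h ->
  ip h (fun x => f x - g x) = ip h f - ip h g.
Proof. by move=> lf lg lh; rewrite ipC (ipBl lf lg lh) (ipC f) (ipC g). Qed.

Lemma ipZZ t f : l2 f -> ip (fun x => t * f x) (fun x => t * f x) = t ^+ 2 * ip f f.
Proof.
by move=> lf; rewrite (ipZl t lf (l2Z t lf)) (ipC f) (ipZl t lf lf) mulrA -expr2.
Qed.

Lemma le_ip f g f' g' : l2 f -> l2 g -> l2 f' -> l2 g' ->
  (forall x, f x * g x <= f' x * g' x) -> ip f g <= ip f' g'.
Proof. by move=> *; apply: le_Rint => //; exact: l2_l1M. Qed.

(** The usual discriminant argument, with a separate choice of c when g has norm
0. *)
Lemma cauchy_schwarz f g : l2 f -> l2 g -> ip f g ^+ 2 <= ip f f * ip g g.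
Proof.
move=> lf lg.
have H c : 0 <= ip f f - 2 * (c * ip f g) + c ^+ 2 * ip g g.
  have lc := l2Z c lg.
  have := ip_ge0 (fun x => f x - c * g x); rewrite ipBB//.
  rewrite (ipC f (fun x => c * g x)) (ipZl c lg lf) (ipZl c lg lc).
  rewrite (ipC g (fun x => c * g x)) (ipZl c lg lg) (ipC g f).
  by rewrite expr2 !mulrA.
have := ip_ge0 g; rewrite le_eqVlt => /predU1P[g0|g0].
  rewrite -g0 mulr0; have [/eqP->|fg0] := boolP (ip f g == 0).
    by rewrite expr0n.
  have := H ((ip f f + 1) / (2 * ip f g)); rewrite -g0 mulr0 addr0.
  rewrite (_ : 2 * (_ / _ * _) = ip f f + 1); first by lra.
  by field.
have := H (ip f g / ip g g).
rewrite (_ : _ - _ + _ = (ip f f * ip g g - ip f g ^+ 2) / ip g g); last first.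
  by field; rewrite gt_eqF.
by rewrite pmulr_lge0 ?invr_gt0// subr_ge0.
Qed.

Lemma ae_eq_ip f f' g : l2 f -> l2 f' -> l2 g -> f = f' %[ae mu] ->
  ip f g = ip f' g.
Proof.
move=> [mf _] [mf' _] [mg _] ff'; apply: ae_eq_Rint.
- exact: measurable_funM.
- exact: measurable_funM.
- by apply: filterS ff' => x /= h xT; rewrite h.
Qed.

Lemma ip_norm f g : l2 f -> l2 g ->
  `|ip f g| <= ip (fun x => `|f x|) (fun x => `|g x|).
Proof.
move=> lf lg; apply: (le_trans (le_norm_Rint (l2_l1M lf lg))).
by apply: le_Rint => [||x]; [exact: l1_norm (l2_l1M lf lg)
  |apply: l2_l1M; exact: l2_norm|rewrite normrM].
Qed.

Lemma l2P f : f \in Lfun mu 2%:E <-> l2 f.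
Proof.
split=> [lf|[mf f2]].
  split; last exact: (Lfun2_integrable_sqr lf).
  by have /andP[] := lf; rewrite inE.
apply/andP; split; first by rewrite inE.
rewrite inE /= /finite_norm.
rewrite unlock poweR_lty//.
have /integrableP[_] := f2.
under eq_integral do rewrite /= ger0_norm ?sqr_ge0//.
under [X in (X < _)%E -> _]eq_integral do
  rewrite -(real_normK (num_real (f _))) -(powR_mulrn 2%N)//.
by [].
Qed.

Lemma Lnorm2E f : l2 f ->
  ('N[mu]_2%:E[EFin \o f])%E = (Num.sqrt (ip f f))%:E.
Proof.
move=> [mf f2]; rewrite unlock.
under eq_integral do rewrite /= powR_mulrn// real_normK ?num_real//.
by rewrite EFin_Rint// poweR_EFin powR12_sqrt -ipE// ip_ge0.
Qed.

Lemma Lnorm2_eq1 f : l2 f -> ('N[mu]_2%:E[EFin \o f])%E = 1%E <-> ip f f = 1.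
Proof.
move=> lf; rewrite Lnorm2E//; split=> [[] s1|->]; last by rewrite sqrtr1.
by rewrite -(sqr_sqrtr (ip_ge0 f)) s1 expr1n.
Qed.

Lemma Lnorm_nat f (q : nat) : (forall x, 0 <= f x) -> l1 (fun x => f x ^+ q) ->
  ('N[mu]_(q%:R%:E)[EFin \o f])%E = ((\int[mu]_x f x ^+ q) `^ q%:R^-1)%:E.
Proof.
move=> f0 lf; rewrite unlock.
under eq_integral => x _ do rewrite /= ger0_norm// powR_mulrn//.
by rewrite EFin_Rint// poweR_EFin.
Qed.

End square_integrable.
Arguments ipC {d T R mu}.

(** * Integrals depending on a parameter *)

Section parametric_integral.
Context {d1 d2 : measure_display} {T1 : measurableType d1}
  {T2 : measurableType d2} {R : realType}.
Variables (m1 : {sigma_finite_measure set T1 -> \bar R})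
  (m2 : {sigma_finite_measure set T2 -> \bar R}).

Lemma measurable_section (F : T1 -> T2 -> R) x :
  measurable_fun [set: T1 * T2] (fun z => F z.1 z.2) ->
  measurable_fun [set: T2] (F x).
Proof.
move=> mF; apply: (measurableT_comp mF (g := fun y => (x, y))).
by apply: measurable_fun_pair; [exact: measurable_cst|exact: measurable_id].
Qed.

Lemma measurable_Rint (F : T1 -> T2 -> R) :
  measurable_fun [set: T1 * T2] (fun z => F z.1 z.2) ->
  measurable_fun [set: T1] (fun x => \int[m2]_y F x y).
Proof.
move=> mF; rewrite /Rintegral.
apply: measurableT_comp => //.
under eq_fun do rewrite integralE.
have H g : measurable_fun [set: T1 * T2] g -> (forall z, 0 <= g z)%E ->
  measurable_fun [set: T1] (fubini_F m2 g) := @measurable_fun_fubini_tonelli_F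
  _ _ _ _ _ m2 g.
have mF' : measurable_fun [set: T1 * T2] (fun z => (F z.1 z.2)%:E).
  exact/measurable_EFinP.
apply: emeasurable_funB.
- apply: (eq_measurable_fun (fubini_F m2 (fun z => (F z.1 z.2)%:E)^\+%E)).
    by move=> x _; apply: eq_integral => y _; rewrite !funeposE.
  by apply: H => //; exact: measurable_funepos.
- apply: (eq_measurable_fun (fubini_F m2 (fun z => (F z.1 z.2)%:E)^\-%E)).
    by move=> x _; apply: eq_integral => y _; rewrite !funenegE.
  by apply: H => //; exact: measurable_funeneg.
Qed.

Lemma Rint_Fubini (F : T1 -> T2 -> R) :
  measurable_fun [set: T1 * T2] (fun z => F z.1 z.2) ->
  (forall x, l1 m2 (F x)) -> (forall y, l1 m1 (F ^~ y)) ->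
  l1 m1 (fun x => \int[m2]_y `|F x y|) ->
  \int[m1]_x \int[m2]_y F x y = \int[m2]_y \int[m1]_x F x y.
Proof.
move=> mF i2 i1 i12.
have mF' : measurable_fun [set: T1 * T2] (fun z => (F z.1 z.2)%:E).
  exact/measurable_EFinP.
have iF : ((m1 \x m2)%E).-integrable setT (fun z => (F z.1 z.2)%:E).
  apply/integrable12ltyP => //=.
  under eq_integral => x _.
    rewrite /= EFin_Rint; last exact: l1_norm.
    over.
  by rewrite EFin_Rint// ltry.
have /= := Fubini iF.
under eq_integral do rewrite EFin_Rint//.
under [X in _ = X -> _]eq_integral do rewrite EFin_Rint//.
by move=> /(congr1 fine).
Qed.

End parametric_integral.

Lemma cauchy_sequence_cvg (R : realType) (u : nat -> R) :
  (forall e, 0 < e -> exists M, forall n, (M <= n)%N -> `|u M - u n| < e) ->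
  cvgn u.
Proof.
move=> h; apply/cauchy_cvgP/cauchy_exP => e /h[M uM].
by exists (u M); exists M => // n /uM.
Qed.

(** * Symmetric nonnegative Hilbert-Schmidt kernels *)

Section kernel_operator.
Context {d : measure_display} {T : measurableType d} {R : realType}.
Variable mu : {sigma_finite_measure set T -> \bar R}.
Variable k : T -> T -> R.
Local Notation ip := (ip mu).
Local Notation l1 := (l1 mu).
Local Notation l2 := (l2 mu).

Definition kop (f : T -> R) (x : T) : R := ip (k x) f.

Hypothesis mk : measurable_fun [set: T * T] (fun z => k z.1 z.2).
Hypothesis k0 : forall x y, 0 <= k x y.
Hypothesis ksym : forall x y, k x y = k y x.
Hypothesis k2 : forall x, l1 (fun y => k x y ^+ 2).
Hypothesis kHS : l1 (fun x => ip (k x) (k x)).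

Lemma l2_ker x : l2 (k x).
Proof. by split; [exact: measurable_section mk|exact: k2]. Qed.
Hint Resolve l2_ker : core.

Lemma kop_sqr_le f x : l2 f -> kop f x ^+ 2 <= ip (k x) (k x) * ip f f.
Proof. by move=> lf; exact: cauchy_schwarz. Qed.

Lemma measurable_kop f : measurable_fun [set: T] f ->
  measurable_fun [set: T] (kop f).
Proof.
move=> mf; rewrite (_ : kop f = (fun x => \int[mu]_y (k x y * f y)))//.
apply: measurable_Rint.
by apply: measurable_funM; [exact: mk|exact: measurableT_comp].
Qed.

Lemma l2_kop f : l2 f -> l2 (kop f).
Proof.
move=> lf; split; first exact: measurable_kop (l2_measurable lf).
apply: (@l1_le _ _ _ _ _ (fun x => ip f f * ip (k x) (k x))).
- by apply: measurable_funX; exact: measurable_kop (l2_measurable lf).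
- exact: l1Z.
- by move=> x; rewrite ger0_norm ?sqr_ge0// mulrC kop_sqr_le.
Qed.

Lemma kopD f g x : l2 f -> l2 g ->
  kop (fun y => f y + g y) x = kop f x + kop g x.
Proof. by move=> lf lg; rewrite /kop ipC ipDl// !(ipC (k x)). Qed.

Lemma kopB f g x : l2 f -> l2 g ->
  kop (fun y => f y - g y) x = kop f x - kop g x.
Proof. by move=> lf lg; rewrite /kop ipC ipBl// !(ipC (k x)). Qed.

Lemma kopZ c f x : l2 f -> kop (fun y => c * f y) x = c * kop f x.
Proof. by move=> lf; rewrite /kop ipC ipZl// !(ipC (k x)). Qed.

Lemma ae_eq_kop f g : l2 f -> l2 g -> f = g %[ae mu] -> kop f = kop g.
Proof.
by move=> lf lg fg; apply/funext => x; rewrite /kop !(ipC (k x)) (ae_eq_ip lf lg).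
Qed.

Lemma kop_ge0 f x : (forall y, 0 <= f y) -> 0 <= kop f x.
Proof. by move=> f0; apply: Rint_ge0 => y; rewrite mulr_ge0. Qed.

Lemma kop_norm f x : l2 f -> `|kop f x| <= kop (fun y => `|f y|) x.
Proof.
move=> lf; apply: le_trans (ip_norm (l2_ker x) lf) _.
rewrite le_eqVlt; apply/orP; left; apply/eqP.
by apply: eq_Rint => y; rewrite ger0_norm.
Qed.

(** Fubini for the absolutely integrable function k(x,y) f(x) g(y). *)
Lemma kop_sym f g : l2 f -> l2 g -> ip (kop f) g = ip f (kop g).
Proof.
move=> lf lg.
transitivity (\int[mu]_x \int[mu]_y (k x y * f y * g x)).
  apply: eq_Rint => x; rewrite mulrC -RintZ; last exact: l2_l1M.
  by apply: eq_Rint => y; rewrite mulrC.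
rewrite Rint_Fubini.
- apply: eq_Rint => y; rewrite /kop /ip -RintZ; last exact: l2_l1M.
  by apply: eq_Rint => x; rewrite (ksym x y); ring.
- apply: measurable_funM.
    apply: measurable_funM; first exact: mk.
    by apply: measurableT_comp => //; exact: l2_measurable lf.
  by apply: measurableT_comp => //; exact: l2_measurable lg.
- move=> x; rewrite (_ : (fun y => _) = (fun y => g x * (k x y * f y))).
    by apply: l1Z; exact: l2_l1M.
  by apply/funext => y; rewrite mulrC.
- move=> y; rewrite (_ : (fun x => _) = (fun x => f y * (k y x * g x))).
    by apply: l1Z; exact: l2_l1M.
  by apply/funext => x /=; rewrite (ksym x y); ring.
- rewrite (_ : (fun x => _) = (fun x => `|g x| * kop (fun y => `|f y|) x)).
    by apply: l2_l1M; [exact: l2_norm|apply: l2_kop; exact: l2_norm].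
  apply/funext => x; rewrite /kop /ip -RintZ.
    by apply: eq_Rint => y; rewrite !normrM (ger0_norm (k0 x y)); ring.
  by apply: l2_l1M => //; exact: l2_norm.
Qed.

Local Notation A n f := (iter n kop f).

Lemma l2_iter n f : l2 f -> l2 (A n f).
Proof. by move=> lf; elim: n => //= n IH; exact: l2_kop. Qed.
Hint Resolve l2_iter : core.

Lemma ip_iterC n f g : l2 f -> l2 g -> ip (A n f) g = ip f (A n g).
Proof.
move=> lf lg; elim: n g lg => //= n IH g lg; rewrite kop_sym ?IH//.
- by rewrite -iterSr.
- exact: l2_kop.
- exact: l2_iter.
Qed.

Lemma ip_iterD m n f g : l2 f -> l2 g -> ip (A m f) (A n g) = ip f (A (m + n) g).
Proof. by move=> lf lg; rewrite ip_iterC ?iterD//; exact: l2_iter. Qed.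

Lemma kop_iter n f x : l2 f -> kop (A n f) x = ip (A n (k x)) f.
Proof. by move=> lf; rewrite ip_iterC. Qed.

Lemma iter_ge0 n f : (forall x, 0 <= f x) -> forall x, 0 <= A n f x.
Proof. by move=> f0; elim: n => //= n IH x; exact: kop_ge0. Qed.

Section operator_norm.
Variable l : R.
Hypothesis l_gt0 : 0 < l.
Hypothesis norm_ub : forall f, l2 f -> ip (kop f) (kop f) <= l ^+ 2 * ip f f.
Hypothesis norm_lub : forall t, t < l ^+ 2 ->
  exists f, [/\ l2 f, ip f f = 1 & t <= ip (kop f) (kop f)].

Definition moment n f := ip (A n f) (A n f) / l ^+ n.*2.

Lemma moment_ge0 n f : 0 <= moment n f.
Proof. by rewrite divr_ge0 ?ip_ge0// exprn_ge0// ltW. Qed.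

Lemma moment0 f : moment 0 f = ip f f.
Proof. by rewrite /moment/= expr0 divr1. Qed.

Lemma moment_nincr f : l2 f -> nonincreasing_seq (moment ^~ f).
Proof.
move=> lf; apply/nonincreasing_seqP => n; rewrite /moment.
rewrite ler_pdivrMr ?exprn_gt0// doubleS.
rewrite (_ : _ / _ * _ = l ^+ 2 * ip (A n f) (A n f)).
  exact/norm_ub/l2_iter.
rewrite [l ^+ _.+2]exprS [l ^+ _.+1]exprS; field.
by rewrite gt_eqF// exprn_gt0.
Qed.

Lemma moment_ip m n f : l2 f ->
  ip (A m.*2 f) (A n.*2 f) = moment (m + n) f * l ^+ m.*2 * l ^+ n.*2.
Proof.
move=> lf; rewrite /moment !ip_iterD// addnn doubleD -mulrA -exprD divfK//.
by rewrite gt_eqF// exprn_gt0.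
Qed.

(** By the Cauchy-Schwarz inequality, the squared norms of A^n f are log-convex in
n, so that their ratios increase: a near maximizer of the norm is a near maximizer
for all the powers of the operator. *)
Lemma iter_norm_ge f t n : l2 f -> ip f f = 1 -> 0 <= t ->
  t <= ip (kop f) (kop f) -> t ^+ n <= ip (A n f) (A n f).
Proof.
move=> lf f1 t0 tf.
have H m : t * ip (A m f) (A m f) <= ip (A m.+1 f) (A m.+1 f).
  elim: m => [|m IH]; first by rewrite /= f1 mulr1.
  have cs : ip (A m.+1 f) (A m.+1 f) ^+ 2 <=
      ip (A m f) (A m f) * ip (A m.+2 f) (A m.+2 f).
    rewrite [X in X ^+ 2](_ : _ = ip (A m f) (A m.+2 f)).
      by apply: cauchy_schwarz; exact: l2_iter.
    rewrite (ip_iterD m.+1 m.+1 lf lf) (ip_iterD m m.+2 lf lf) addSnnS.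
    reflexivity.
  have := ip_ge0 mu (A m f); rewrite le_eqVlt => /predU1P[m0|m0].
    have := norm_ub (l2_iter m lf); rewrite -m0 mulr0 => h.
    have -> : ip (A m.+1 f) (A m.+1 f) = 0.
      by apply/eqP; rewrite eq_le h ip_ge0.
    by rewrite mulr0 ip_ge0.
  rewrite -(ler_pM2l m0); apply: le_trans cs; rewrite mulrCA mulrA expr2.
  exact: (ler_wpM2r (ip_ge0 _ _) IH).
elim: n => [|n IH]; first by rewrite /= f1.
by rewrite exprS; apply: le_trans (H n); rewrite ler_wpM2l.
Qed.

(** If all the kernel functions k(x,.) had vanishing limit moments, dominated
convergence would make the powers of the operator small on near maximizers. *)
Lemma nonvanishing_moment : exists x, ~ (moment ^~ (k x) @ \oo --> 0).
Proof.
apply: contrapT => /forallNP h.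
have {}h x : moment ^~ (k x) @ \oo --> 0 by apply: contrapT => /h.
have l20 : 0 < l ^+ 2 by rewrite exprn_gt0.
(* By Bernoulli's inequality, the power n + 1 of t n is still at least 1/2. *)
pose t n : R := 1 - (n.+1.*2%:R)^-1.
have t1 n : t n < 1 by rewrite ltrBlDr ltrDl invr_gt0 ltr0n.
have t0 n : 0 <= t n by rewrite subr_ge0 invf_le1 ?ler1n ?ltr0n.
have tn n : 2^-1 <= t n ^+ n.+1.
  suff : forall m, 1 - m%:R / n.+1.*2%:R <= t n ^+ m.
    move=> /(_ n.+1); rewrite -muln2 natrM invfM mulrA divff ?mul1r.
      by apply: le_trans; lra.
    by rewrite pnatr_eq0.
  elim=> [|m IH]; first by rewrite mul0r subr0.
  rewrite exprS; apply: le_trans (ler_wpM2l (t0 n) IH).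
  rewrite /t -[in leLHS]natr1; set r := _^-1; have : 0 <= r by rewrite invr_ge0.
  have : 0 <= m%:R :> R by [].
  by nra.
have /choice[f fP] n : exists f, [/\ l2 f, ip f f = 1 &
    t n * l ^+ 2 <= ip (kop f) (kop f)].
  by apply: norm_lub; rewrite gtr_pMl.
(* By the Cauchy-Schwarz inequality for f n, the function g n is at most the moment
   n of k x, while its integral is at least l^2 / 2. *)
pose g n x := A n.+1 (f n) x ^+ 2 / l ^+ n.*2.
have lf n : l2 (f n) by have [] := fP n.
have mg n : measurable_fun [set: T] (g n).
  apply: measurable_funM => //; apply: measurable_funX.
  by apply: l2_measurable; exact: l2_iter.
have g0 n x : 0 <= g n x.
  by rewrite /g divr_ge0 ?sqr_ge0// exprn_ge0// ltW.
have gm n x : g n x <= moment n (k x).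
  rewrite /g /moment ler_pM2r ?invr_gt0 ?exprn_gt0// iterS kop_iter//.
  have [_ f1 _] := fP n.
  by rewrite -[leRHS]mulr1 -f1 cauchy_schwarz//; exact: l2_iter.
have gN n x : `|g n x| <= ip (k x) (k x).
  rewrite ger0_norm// (le_trans (gm n x))// -moment0.
  by apply: moment_nincr.
have gc x : g ^~ x @ \oo --> (0 : R).
  apply: (squeeze_cvgr _ (@cvg_cst _ 0 _ _ _) (h x)).
  by apply: nearW => n /=; rewrite g0 gm.
have [_] := dct_Rint mg kHS gN gc.
rewrite Rintegral_cst// mul0r => hl.
have : l ^+ 2 / 2 <= 0.
  apply: (cvgr_to_ge hl); apply: nearW => n.
  rewrite (_ : \int[mu]_x g n x = ip (A n.+1 (f n)) (A n.+1 (f n)) / l ^+ n.*2).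
    have [_ f1 fn] := fP n.
    have tl : 0 <= t n * l ^+ 2 by rewrite mulr_ge0// ltW.
    rewrite ler_pdivlMr; last exact: exprn_gt0.
    apply: le_trans (iter_norm_ge n.+1 (lf n) f1 tl fn).
    rewrite exprMn -exprM mul2n doubleS -[(n.*2).+2]addn2 exprD.
    have := tn n; set a := t n ^+ _; set b := l ^+ n.*2 => ha.
    have b0 : 0 < b by rewrite exprn_gt0.
    have -> : a * (b * l ^+ 2) = (l ^+ 2 * b) * a by ring.
    have -> : l ^+ 2 / 2 * b = (l ^+ 2 * b) * 2^-1 by ring.
    by rewrite ler_wpM2l// mulr_ge0// ltW.
  rewrite ipE /g; under eq_Rintegral do rewrite mulrC.
  rewrite RintZ; first by rewrite mulrC.
  by have [] := l2_iter n.+1 (lf n).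
by rewrite leNgt divr_gt0.
Qed.

(** The normalized powers applied to a kernel function g with nonvanishing
moments form a Cauchy sequence, because the squared distances between its terms
are combinations c_(2m) - 2 c_(m+n) + c_(2n) of the monotone, hence convergent,
moments of g. One more application of the kernel turns this into pointwise
convergence, and the limit is fixed by the square of the operator. *)
Lemma sqr_eigenfunction : exists u, [/\ l2 u, (forall x, 0 <= u x),
  0 < ip u u & forall x, kop (kop u) x = l ^+ 2 * u x].
Proof.
have [x0 nv] := nonvanishing_moment.
set g := k x0 in nv; have lg : l2 g by exact: l2_ker.
pose c n := moment n g.
have cdec : nonincreasing_seq c by exact: moment_nincr.
have clb : has_lbound (range c).
  by exists 0 => _ [n _ <-]; exact: moment_ge0.
have ccv := nonincreasing_cvgn cdec clb; set L := inf _ in ccv.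
have Lc n : L <= c n.
  have := nonincreasing_cvgn_ge cdec (cvgP _ ccv) n.
  by rewrite (cvg_lim _ ccv).
have L0 : 0 < L.
  rewrite lt_neqAle (cvgr_to_ge ccv) ?andbT; last first.
    by apply: nearW => n; exact: moment_ge0.
  by apply/eqP => L0; apply: nv; rewrite L0.
have ln0 n : l ^+ n != 0 by rewrite gt_eqF// exprn_gt0.
pose w n x := (l ^+ n.*2)^-1 * A n.*2 g x.
have lw n : l2 (w n) by apply: l2Z; exact: l2_iter.
have ipw m n : ip (w m) (w n) = c (m + n)%N.
  rewrite /w ipZl; [|exact: l2_iter|exact: lw].
  rewrite (ipC (A m.*2 g)) ipZl; [|exact: l2_iter|exact: l2_iter].
  by rewrite moment_ip// addnC -/(c _); field; rewrite !ln0.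
pose u_ n x := kop (w n) x.
have u_dist m n x : (u_ m x - u_ n x) ^+ 2 <=
    ip (k x) (k x) * (c m.*2 - 2 * c (m + n)%N + c n.*2).
  rewrite /u_ -kopB//; apply: le_trans (kop_sqr_le x (l2B (lw m) (lw n))) _.
  by rewrite ipBB// !ipw !addnn.
have ucauchy x : cvgn (u_ ^~ x).
  apply: cauchy_sequence_cvg => e e0.
  have N0 : 0 <= ip (k x) (k x) by exact: ip_ge0.
  pose e' := e ^+ 2 / (2 * (ip (k x) (k x) + 1)).
  have N1 : 0 < ip (k x) (k x) + 1 by rewrite ltr_wpDl.
  have e'0 : 0 < e' by rewrite divr_gt0 ?exprn_gt0// mulr_gt0.
  move/cvgrPdist_lt : (ccv) => /(_ _ e'0)[M _ /= MP].
  have MC m : (M <= m)%N -> c m < L + e'.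
    move=> Mm; have := MP _ Mm.
    by rewrite ltr_distl => /andP[+ _]; rewrite ltrBlDr.
  exists M => n Mn.
  rewrite -(ltr_pXn2r (_ : (0 < 2)%N)) ?nnegrE ?(ltW e0)//.
  rewrite real_normK ?num_real//; apply: le_lt_trans (u_dist M n x) _.
  have h1 := MC M.*2 (ltac:(by rewrite -addnn leq_addr)).
  have h2 := MC n.*2 (ltac:(by rewrite -addnn (leq_trans Mn)// leq_addr)).
  have h3 := Lc (M + n)%N.
  have -> : e ^+ 2 = (ip (k x) (k x) + 1) * (2 * e').
    by rewrite /e'; field; rewrite gt_eqF.
  apply: (@le_lt_trans _ _ (ip (k x) (k x) * (2 * e'))).
    by apply: ler_wpM2l => //; lra.
  rewrite ltr_pM2r; last exact: mulr_gt0.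
  by rewrite ltrDl.
pose u x := limn (u_ ^~ x).
have uu x : u_ ^~ x @ \oo --> u x by exact: ucauchy.
pose G x := Num.sqrt (c 0%N * ip (k x) (k x)).
have c00 : 0 <= c 0%N by exact: moment_ge0.
have u_G n x : `|u_ n x| <= G x.
  rewrite -sqrtr_sqr ler_wsqrtr// mulrC.
  apply: le_trans (kop_sqr_le x (lw n)) _.
  by rewrite ler_wpM2l ?ip_ge0// ipw cdec.
have mN : measurable_fun [set: T] (fun x => ip (k x) (k x)).
  exact: l1_measurable kHS.
have lG : l2 G.
  split.
    apply: measurableT_comp; last exact: measurable_funM.
    by apply: continuous_measurable_fun; exact: sqrt_continuous.
  rewrite (_ : (fun x => _) = (fun x => c 0%N * ip (k x) (k x))); first exact: l1Z.
  by apply/funext => x; rewrite sqr_sqrtr// mulr_ge0// ip_ge0.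
have lu_ n : l2 (u_ n) by exact: l2_kop.
have mu_ n : measurable_fun [set: T] (u_ n) by exact: l2_measurable.
have mu0 : measurable_fun [set: T] u.
  by apply: (@measurable_fun_cvg _ _ _ _ u_) => // x _; exact: uu.
have lu : l2 u.
  apply: (l2_le mu0 lG) => x.
  apply: (cvgr_to_le (cvg_norm (uu x))).
  by apply: nearW => n; exact: u_G.
have ip_u f : l2 f -> ip f (u_ n) @[n --> \oo] --> ip f u.
  move=> lf; have [] := @dct_Rint _ _ _ mu (fun n x => f x * u_ n x)
    (fun x => f x * u x) (fun x => `|f x| * G x).
  - by move=> n; apply: measurable_funM => //; exact: l2_measurable lf.
  - by apply: l2_l1M => //; exact: l2_norm.
  - by move=> n x; rewrite normrM ler_wpM2l.
  - by move=> x; apply: cvgM (uu x); exact: cvg_cst.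
  - by [].
have wS n : kop (kop (w n)) = (fun x => l ^+ 2 * w n.+1 x).
  have -> : kop (w n) = (fun y => (l ^+ n.*2)^-1 * A n.*2.+1 g y).
    by apply/funext => y; rewrite kopZ//; exact: l2_iter.
  apply/funext => x; rewrite kopZ; last exact: l2_iter.
  rewrite /w doubleS -[l ^+ (n.*2).+2](_ : l ^+ 2 * l ^+ n.*2 = _); last first.
    by rewrite -exprD.
  by rewrite -iterS; field; rewrite ln0 gt_eqF.
exists u; split=> //.
- move=> x; apply: (cvgr_to_ge (uu x)); apply: nearW => n.
  apply: kop_ge0 => y; rewrite /w mulr_ge0 ?invr_ge0 ?exprn_ge0 ?(ltW l_gt0)//.
  by apply: iter_ge0 => z; exact: k0.
- have lAg : l2 (kop g) by exact: l2_kop.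
  (* The pairing of u with A g shows that the limit is not zero. *)
  have : l ^+ 2 * L <= ip (kop g) u.
    apply: (cvgr_to_ge (ip_u _ lAg)); apply: nearW => n.
    rewrite /u_ kop_sym//; last exact: l2_kop.
    rewrite wS (ipC g) ipZl// ler_wpM2l ?exprn_ge0 ?(ltW l_gt0)//.
    rewrite (_ : ip _ g = c n.+1)//.
    have -> : g = w 0%N by apply/funext => x; rewrite /w/= expr0 invr1 mul1r.
    by rewrite ipw addn0.
  move=> h; rewrite lt_neqAle ip_ge0 andbT eq_sym; apply/eqP => u0.
  have := cauchy_schwarz lAg lu; rewrite u0 mulr0 => h0.
  have h1 : 0 < ip (kop g) u by apply: lt_le_trans h; rewrite mulr_gt0// exprn_gt0.
  by move: h0; rewrite leNgt exprn_gt0.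
- move=> x.
  have E f : l2 f -> kop (kop f) x = ip (kop (k x)) f.
    by move=> lf; rewrite kop_sym.
  have h1 : kop (kop (u_ n)) x @[n --> \oo] --> kop (kop u) x.
    rewrite E//; under eq_fun do rewrite E//.
    by apply: ip_u; exact: l2_kop.
  have h2 : kop (kop (u_ n)) x @[n --> \oo] --> l ^+ 2 * u x.
    rewrite (_ : (fun n => _) = (fun n => l ^+ 2 * u_ n.+1 x)).
      apply: cvgM; first exact: cvg_cst.
      by rewrite (cvg_shiftS (u_ ^~ x)).
    apply/funext => n; rewrite (_ : kop (u_ n) = kop (kop (w n)))// wS.
    by rewrite kopZ.
  by apply: cvg_unique h1 h2.
Qed.

(** If A^2 u = l^2 u, then l u + A u is fixed by A / l, and it is not zero because
it dominates l u. *)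
Lemma top_eigenfunction : exists chi, [/\ l2 chi, (forall x, 0 <= chi x),
  ip chi chi = 1 & forall x, kop chi x = l * chi x].
Proof.
have [u [lu u0 ipu Au]] := sqr_eigenfunction.
have lAu := l2_kop lu.
pose v x := l * u x + kop u x.
have lv : l2 v by apply: l2D => //; exact: l2Z.
have v0 x : l * u x <= v x by rewrite lerDl; exact: kop_ge0.
have v00 x : 0 <= v x by apply: le_trans (v0 x); rewrite mulr_ge0// ltW.
have Av x : kop v x = l * v x.
  rewrite kopD//; last exact: l2Z.
  by rewrite kopZ// Au /v; ring.
have ipv : 0 < ip v v.
  apply: lt_le_trans (le_ip (l2Z l lu) (l2Z l lu) lv lv _).
    rewrite ipZl//; last exact: l2Z.
    by rewrite ipC ipZl// !mulr_gt0.
  by move=> x; rewrite ler_pM// mulr_ge0// ltW.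
exists (fun x => (Num.sqrt (ip v v))^-1 * v x); split.
- exact: l2Z.
- by move=> x; rewrite mulr_ge0// invr_ge0 sqrtr_ge0.
- rewrite ipZl//; last exact: l2Z.
  rewrite ipC ipZl// mulrA -invfM -expr2 sqr_sqrtr ?ip_ge0//.
  by rewrite mulVf// gt_eqF.
- by move=> x; rewrite kopZ// Av; ring.
Qed.

End operator_norm.

Section simplicity.
Variables (E : set T) (l : R) (chi : T -> R).
Hypothesis k_gt0 : forall x y, E x -> E y -> 0 < k x y.
Hypothesis k_out : forall x y, ~ E x -> k x y = 0.
Hypothesis l_gt0 : 0 < l.
Hypothesis lchi : l2 chi.
Hypothesis chi_ge0 : forall x, 0 <= chi x.
Hypothesis chi1 : ip chi chi = 1.
Hypothesis Achi : forall x, kop chi x = l * chi x.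

Lemma kop_out f x : ~ E x -> kop f x = 0.
Proof.
move=> Ex; rewrite /kop /ip; under eq_Rintegral do rewrite k_out// mul0r.
by rewrite Rintegral_cst// mul0r.
Qed.

Lemma eigenfunction_out f x : kop f x = l * f x -> ~ E x -> f x = 0.
Proof.
move=> + Ex; rewrite kop_out// => /esym/eqP; rewrite mulf_eq0 gt_eqF//=.
by move/eqP.
Qed.

(** The integral of a nonnegative function against a positive kernel only
vanishes with the function. *)
Lemma kop_eq0_ae f x : l2 f -> (forall y, 0 <= f y) -> E x -> kop f x = 0 ->
  {ae mu, forall y, E y -> f y = 0}.
Proof.
move=> lf f0 Ex kf0.
have := Rint_eq0_ae (l2_l1M (l2_ker x) lf) (fun y => mulr_ge0 (k0 x y) (f0 y)) kf0.
apply: filterS => y /= /(_ I)/eqP + Ey.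
by rewrite mulf_eq0 gt_eqF ?k_gt0//= => /eqP.
Qed.

(** A nonnegative eigenfunction vanishing at a point of E vanishes almost
everywhere, the kernel being positive. *)
Lemma eigenfunction_gt0 f : l2 f -> (forall x, 0 <= f x) ->
  (forall x, kop f x = l * f x) ->
  (forall x, E x -> 0 < f x) \/ f = cst 0 %[ae mu].
Proof.
move=> lf f0 Af.
have [h|] := pselect (forall x, E x -> 0 < f x); first by left.
move=> /existsNP[x /not_implyP[Ex fx]]; right.
have fx0 : f x = 0 by apply/eqP; rewrite eq_le f0 leNgt andbT; apply/negP.
have := kop_eq0_ae lf f0 Ex (ltac:(by rewrite Af fx0 mulr0)).
apply: filterS => y fy _; have [/fy//|Ey] := pselect (E y).
exact: eigenfunction_out (Af y) Ey.
Qed.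

Lemma chi_gt0 x : E x -> 0 < chi x.
Proof.
have [h|c0] := eigenfunction_gt0 lchi chi_ge0 Achi; first exact: h.
have l20 : l2 (cst 0).
  split; first exact: measurable_cst.
  by rewrite (_ : (fun x => _) = (fun x => 0 * (chi x ^+ 2)));
    [apply: l1Z; have [] := lchi|apply/funext => y; rewrite expr0n mul0r].
have := ae_eq_ip lchi l20 lchi c0; rewrite chi1 /ip.
under eq_Rintegral do rewrite mul0r.
by rewrite Rintegral_cst// mul0r => /eqP; rewrite oner_eq0.
Qed.

(** An eigenfunction v orthogonal to chi vanishes: integrating against chi shows
that |v| is an eigenfunction too, hence so are |v| + v and |v| - v, which are
nonnegative with zero product. One of them then vanishes, so that v has a
constant sign, and is orthogonal to a positive function. *)
Lemma orthogonal_eigenfunction v : l2 v -> (forall x, kop v x = l * v x) ->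
  ip v chi = 0 -> v = cst 0 %[ae mu].
Proof.
move=> lv Av vchi.
pose a x := `|v x|; have la : l2 a by exact: l2_norm.
have a0 x : 0 <= a x by exact: normr_ge0.
have lAa := l2_kop la.
have lAal : l2 (fun x => kop a x - l * a x) by apply: l2B => //; exact: l2Z.
have Aa x : l * a x <= kop a x.
  by apply: le_trans (kop_norm x lv); rewrite Av normrM gtr0_norm.
have Aa0 x : 0 <= (kop a x - l * a x) * chi x.
  by rewrite mulr_ge0// subr_ge0.
have ip0 : ip (fun x => kop a x - l * a x) chi = 0.
  rewrite ipBl//; last exact: l2Z.
  rewrite kop_sym// ipZl// [kop chi](_ : _ = (fun x => l * chi x)).
    by rewrite ipC ipZl// (ipC chi) subrr.
  exact/funext.
have vout x : ~ E x -> v x = 0 by move=> Ex; exact: eigenfunction_out (Av x) Ex.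
have aE : kop a = (fun x => l * a x) %[ae mu].
  have := Rint_eq0_ae (l2_l1M lAal lchi) Aa0 ip0.
  apply: filterS => x /= /(_ I)/eqP + _.
  have [Ex|Ex] := pselect (E x).
    by rewrite mulf_eq0 (gt_eqF (chi_gt0 Ex)) orbF subr_eq0 => /eqP.
  by rewrite kop_out// /a vout// normr0 mulr0.
pose p x := l^-1 * kop a x; have lp : l2 p by exact: l2Z.
have pa : p = a %[ae mu].
  by apply: filterS aE => x h _; rewrite /p h// mulKf// gt_eqF.
have Ap x : kop p x = l * p x.
  by rewrite (ae_eq_kop lp la pa) /p mulVKf// gt_eqF.
have sP s : (s = 1) \/ (s = - 1) -> [/\ l2 (fun x => p x + s * v x),
    (forall x, 0 <= p x + s * v x) &
    forall x, kop (fun x => p x + s * v x) x = l * (p x + s * v x)].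
  move=> s1; have lsv := l2Z s lv.
  have ls := l2D lp lsv; split=> //.
    move=> x; rewrite -(pmulr_rge0 _ l_gt0).
    rewrite mulrDr -Ap mulrCA -Av -kopZ// -kopD//.
    have lsa := l2D la lsv.
    rewrite (ae_eq_kop ls lsa).
      apply: kop_ge0 => y; rewrite /a.
      by case: s1 => ->; rewrite ?mul1r ?mulN1r; have := ler_norm (v y);
        have := ler_norm (- v y); rewrite normrN; lra.
    by apply: filterS pa => y h _; rewrite h.
  by move=> x; rewrite kopD// (kopZ s x lv) Ap Av; ring.
have [lp1 p1 Ap1] := sP 1 (or_introl erefl).
have [lp2 p2 Ap2] := sP (-1) (or_intror erefl).
have absurd (s : R) : (s = 1) \/ (s = - 1) ->
    (fun x => p x + s * v x) = cst 0 %[ae mu] -> v = cst 0 %[ae mu].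
  move=> s1 ps.
  have vs : v = (fun x => - s * a x) %[ae mu].
    apply: filterS2 pa ps => x h1 h2 _; have := h2 I; rewrite h1// /cst.
    by case: s1 => ->; lra.
  have : ip a chi = 0.
    have := ae_eq_ip lv (l2Z (- s) la) lchi vs; rewrite vchi ipZl// => /esym/eqP.
    case: s1 => ->; first by rewrite mulN1r oppr_eq0 => /eqP.
    by rewrite opprK mul1r => /eqP.
  move=> /(Rint_eq0_ae (l2_l1M la lchi) (fun x => mulr_ge0 (a0 x) (chi_ge0 x))).
  apply: filterS => x /= /(_ I)/eqP + _.
  have [Ex|/vout//] := pselect (E x).
  by rewrite mulf_eq0 (gt_eqF (chi_gt0 Ex)) orbF normr_eq0 => /eqP.
have [q1|] := eigenfunction_gt0 lp1 p1 Ap1; last by apply: absurd; left.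
have [q2|] := eigenfunction_gt0 lp2 p2 Ap2; last by apply: absurd; right.
apply: filterS pa => x h _; have [Ex|/vout//] := pselect (E x).
have := mulr_gt0 (q1 _ Ex) (q2 _ Ex); rewrite h// /a.
have := real_normK (num_real (v x)).
by nra.
Qed.

(** The function l^-1 A f agrees with f almost everywhere, and satisfies the
eigenvalue equation at every point. *)
Lemma eigenvalue_simple f : l2 f -> kop f = (fun x => l * f x) %[ae mu] ->
  exists c, f = (fun x => c * chi x) %[ae mu].
Proof.
move=> lf Af.
pose f' x := l^-1 * kop f x; have lf' : l2 f' by apply: l2Z; exact: l2_kop.
have ff' : f = f' %[ae mu].
  by apply: filterS Af => x h _; rewrite /f' h// mulKf// gt_eqF.
pose c := ip f' chi; exists c.
have lc := l2Z c lchi.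
have : (fun x => f' x - c * chi x) = cst 0 %[ae mu].
  apply: orthogonal_eigenfunction.
  - exact: l2B.
  - move=> x; rewrite kopB// (kopZ c x lchi) Achi -(ae_eq_kop lf lf' ff') /f'.
    by field; rewrite gt_eqF.
  - by rewrite ipBl// (ipZl c lchi lchi) chi1 mulr1 subrr.
apply: filterS2 ff' => x h1 h2 _; rewrite h1//; apply/eqP.
by rewrite -subr_eq0; apply/eqP/h2.
Qed.

End simplicity.

End kernel_operator.

(** * The norm of a kernel operator *)

Section kernel_operator_norm.
Context {d : measure_display} {T : measurableType d} {R : realType}.
Variable mu : {sigma_finite_measure set T -> \bar R}.
Variable k : T -> T -> R.
Hypothesis mk : measurable_fun [set: T * T] (fun z => k z.1 z.2).
Hypothesis k2 : forall x, l1 mu (fun y => k x y ^+ 2).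
Hypothesis kHS : l1 mu (fun x => ip mu (k x) (k x)).
Local Notation kop := (kop mu k).
Local Notation ip := (ip mu).
Local Notation l2 := (l2 mu).

Lemma ip_kop_le f : l2 f -> ip (kop f) (kop f) <= (\int[mu]_x ip (k x) (k x)) * ip f f.
Proof.
move=> lf; have [_ lkf] := l2_kop mk k2 kHS lf.
rewrite mulrC -RintZ// ipE; apply: le_Rint => //; first exact: l1Z.
by move=> x; rewrite mulrC; exact: kop_sqr_le.
Qed.

Lemma L2_opnorm_fin_num f0 : l2 f0 -> ip f0 f0 = 1 ->
  L2_opnorm mu kop \is a fin_num.
Proof.
move=> lf0 f01; rewrite ge0_fin_numE.
  apply: (@le_lt_trans _ _ (Num.sqrt (\int[mu]_x ip (k x) (k x)))%:E); last exact: ltry.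
  apply: ge_ereal_sup => _ [g [/l2P lg /(Lnorm2_eq1 lg) g1] <-].
  rewrite (Lnorm2E (l2_kop mk k2 kHS lg)) lee_fin ler_sqrt.
    by have := ip_kop_le lg; rewrite g1 mulr1.
  by apply: Rint_ge0 => x; exact: ip_ge0.
apply: (@le_trans _ _ (Num.sqrt (ip (kop f0) (kop f0)))%:E).
  by rewrite lee_fin sqrtr_ge0.
apply: ereal_sup_ubound; exists f0; first by split; [exact/l2P|exact/Lnorm2_eq1].
by rewrite (Lnorm2E (l2_kop mk k2 kHS lf0)).
Qed.

Lemma opnorm_unit f : l2 f -> ip f f = 1 ->
  ip (kop f) (kop f) <= fine (L2_opnorm mu kop) ^+ 2.
Proof.
move=> lf f1; have fin := L2_opnorm_fin_num lf f1.
have : ((Num.sqrt (ip (kop f) (kop f)))%:E <= L2_opnorm mu kop)%E.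
  apply: ereal_sup_ubound; exists f; first by split; [exact/l2P|exact/Lnorm2_eq1].
  by rewrite (Lnorm2E (l2_kop mk k2 kHS lf)).
rewrite -(fineK fin) lee_fin => h.
by rewrite -[leLHS](sqr_sqrtr (ip_ge0 mu _)) lerXn2r// nnegrE ?sqrtr_ge0// (le_trans _ h)// sqrtr_ge0.
Qed.

(** The supremum defining the norm only involves unit vectors. *)
Lemma opnorm_ub f : l2 f ->
  ip (kop f) (kop f) <= fine (L2_opnorm mu kop) ^+ 2 * ip f f.
Proof.
move=> lf; have := ip_ge0 mu f; rewrite le_eqVlt => /orP[/eqP f0|f0].
  by have := ip_kop_le lf; rewrite -f0 !mulr0.
pose t := (Num.sqrt (ip f f))^-1.
have t2 : t ^+ 2 * ip f f = 1.
  by rewrite exprVn sqr_sqrtr ?ip_ge0// mulVf// gt_eqF.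
have lg : l2 (fun x => t * f x) by exact: l2Z.
have := opnorm_unit lg; rewrite (ipZZ t lf) => /(_ t2).
rewrite (_ : kop (fun x => t * f x) = (fun x => t * kop f x)); last first.
  by apply/funext => x; rewrite kopZ.
rewrite (ipZZ t (l2_kop mk k2 kHS lf)) => h.
by have := ler_wpM2r (ltW f0) h; rewrite mulrAC t2 mul1r.
Qed.

Lemma opnorm_ge0 f0 : l2 f0 -> ip f0 f0 = 1 -> 0 <= fine (L2_opnorm mu kop).
Proof.
move=> lf0 f01; apply: fine_ge0.
apply: (@le_trans _ _ ('N[mu]_2%:E[EFin \o kop f0])%E).
  exact: Lnorm_ge0.
apply: ereal_sup_ubound; exists f0 => //.
by split; [exact/l2P|exact/Lnorm2_eq1].
Qed.

Lemma opnorm_lub f0 t : l2 f0 -> ip f0 f0 = 1 -> t < fine (L2_opnorm mu kop) ^+ 2 ->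
  exists f, [/\ l2 f, ip f f = 1 & t <= ip (kop f) (kop f)].
Proof.
move=> lf0 f01 tl; have fin := L2_opnorm_fin_num lf0 f01.
have [t0|t0] := ltrP t 0.
  by exists f0; split => //; rewrite (le_trans (ltW t0))// ip_ge0.
have l0 := opnorm_ge0 lf0 f01.
have : ((Num.sqrt t)%:E < L2_opnorm mu kop)%E.
  rewrite -(fineK fin) lte_fin -(ltr_pXn2r (_ : (0 < 2)%N)) ?nnegrE ?sqrtr_ge0//.
  by rewrite sqr_sqrtr.
case/ereal_sup_gt => _ [f [/l2P lf /(Lnorm2_eq1 lf) f1] <-].
rewrite (Lnorm2E (l2_kop mk k2 kHS lf)) lte_fin => h.
exists f; split => //.
rewrite -(sqr_sqrtr t0) -(sqr_sqrtr (ip_ge0 mu (kop f))).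
by rewrite lerXn2r ?nnegrE ?sqrtr_ge0// ltW.
Qed.

Lemma eq_L2_opnorm A : (forall f, l2 f -> A f = kop f) ->
  L2_opnorm mu A = L2_opnorm mu kop.
Proof.
move=> AE; congr ereal_sup; apply/seteqP; split => _ [g [lg g1] <-]; exists g => //;
  by rewrite AE//; exact/l2P.
Qed.

End kernel_operator_norm.

(** * Densities and affine changes of variables *)

(** The integrals of a signed function are differences of integrals of
nonnegative ones, so that image measures and densities only have to be studied
on nonnegative functions. *)
Lemma weighted_integral_ext {d1 d2 d3 : measure_display}
  {T1 : measurableType d1} {T2 : measurableType d2} {T3 : measurableType d3}
  {R : realType} (mu1 : {measure set T1 -> \bar R})
  (mu2 : {measure set T2 -> \bar R}) (p1 : T1 -> T3) (w1 : T1 -> R)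
  (p2 : T2 -> T3) (w2 : T2 -> R) :
  (forall x, 0 <= w1 x) -> (forall x, 0 <= w2 x) ->
  (forall f : T3 -> R, measurable_fun [set: T3] f -> (forall x, 0 <= f x) ->
   (\int[mu1]_x (f (p1 x) * w1 x)%:E = \int[mu2]_x (f (p2 x) * w2 x)%:E)%E) ->
  forall f : T3 -> R, measurable_fun [set: T3] f ->
   (\int[mu1]_x (f (p1 x) * w1 x)%:E = \int[mu2]_x (f (p2 x) * w2 x)%:E)%E.
Proof.
move=> w10 w20 H f mf; rewrite [LHS]integralE [RHS]integralE.
have mp : measurable_fun [set: T3] (fun x => Num.max (f x) 0).
  exact: measurable_maxr.
have mn : measurable_fun [set: T3] (fun x => Num.max (- f x) 0).
  by apply: measurable_maxr => //; exact: measurableT_comp.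
have p0 x : 0 <= Num.max (f x) 0 by rewrite le_max lexx orbT.
have n0 x : 0 <= Num.max (- f x) 0 by rewrite le_max lexx orbT.
congr (_ - _)%E.
- transitivity (\int[mu1]_x (Num.max (f (p1 x)) 0 * w1 x)%:E)%E.
    apply: eq_integral => x _; rewrite funeposE -EFin_max maxr_pMl//.
    by rewrite mul0r.
  rewrite (H _ mp p0); apply: eq_integral => x _.
  by rewrite funeposE -EFin_max maxr_pMl// mul0r.
- transitivity (\int[mu1]_x (Num.max (- f (p1 x)) 0 * w1 x)%:E)%E.
    apply: eq_integral => x _; rewrite funenegE -EFin_max maxr_pMl//.
    by rewrite mul0r mulNr.
  rewrite (H _ mn n0); apply: eq_integral => x _.
  by rewrite funenegE -EFin_max maxr_pMl// mul0r mulNr.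
Qed.

Section density.
Context {d : measure_display} {T : measurableType d} {R : realType}.
Variables (mu nu : {measure set T -> \bar R}) (g : T -> R).
Hypothesis mg : measurable_fun [set: T] g.
Hypothesis g0 : forall x, 0 <= g x.
Hypothesis nuE : forall A, measurable A ->
  nu A = (\int[mu]_(x in A) (g x)%:E)%E.

Import HBNNSimple.

(** Linearity reduces the claim to indicators, where it is the hypothesis. *)
Let density_nnsfun (f : {nnsfun T >-> R}) :
  (\int[nu]_x (f x)%:E = \int[mu]_x (f x * g x)%:E)%E.
Proof.
under [LHS]eq_integral do rewrite fimfunE -fsumEFin//.
rewrite [LHS]ge0_integral_fsum//; last 2 first.
  - by move=> r; exact/measurable_EFinP/measurableT_comp.
  - by move=> n x _; rewrite EFinM nnfun_muleindic_ge0.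
under [RHS]eq_integral.
  move=> x xD; rewrite EFinM fimfunE -fsumEFin// muleC ge0_mule_fsumr; last first.
    by move=> r; rewrite EFinM nnfun_muleindic_ge0.
  over.
rewrite [RHS]ge0_integral_fsum//; last 2 first.
  - move=> r; apply: emeasurable_funM; first exact/measurable_EFinP.
    by apply/measurable_EFinP; do 2 apply/measurableT_comp => //.
  - move=> n x _; apply: mule_ge0; first by rewrite lee_fin.
    by rewrite EFinM nnfun_muleindic_ge0.
apply: eq_fsbigr => r _; rewrite integralZl_indic_nnsfun//= integral_indic// setIT.
have [r0|r0] := ltP r 0.
  rewrite preimage_nnfun0// measure0 mule0; apply/esym/integral0_eq => x _.
  by rewrite indic0 mulr0 mule0.
under eq_integral do rewrite EFinM muleCA.
rewrite ge0_integralZl//; last 2 first.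
  - apply: emeasurable_funM; first exact/measurable_EFinP.
    exact/measurable_EFinP/measurable_indic.
  - by move=> x _; rewrite mule_ge0 ?lee_fin.
congr (_ * _)%E; rewrite nuE// [LHS]integral_mkcond.
apply: eq_integral => x _; rewrite patchE indicE.
by case: ifPn => _; rewrite ?mule1 ?mule0.
Qed.

Lemma ge0_integral_density (f : T -> R) : measurable_fun [set: T] f ->
  (forall x, 0 <= f x) ->
  (\int[nu]_x (f x)%:E = \int[mu]_x (f x * g x)%:E)%E.
Proof.
move=> mf f0.
have mf' : measurable_fun [set: T] (EFin \o f) by exact/measurable_EFinP.
have f0' x : (0 <= (EFin \o f) x)%E by rewrite lee_fin.
pose f_ := nnsfun_approx measurableT mf'.
have cvf x : (f_ n x)%:E @[n --> \oo] --> (f x)%:E.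
  exact: (cvg_nnsfun_approx measurableT mf' (fun x _ => f0' x)).
transitivity (lim (\int[nu]_x (f_ n x)%:E @[n --> \oo])%E).
  rewrite -monotone_convergence//=.
  - by apply: eq_integral => x _; apply/esym/cvg_lim.
  - by move=> n; exact/measurable_EFinP/measurable_funTS.
  - by move=> n ? _; rewrite lee_fin.
  - by move=> ? _ ? ? mn; rewrite lee_fin; exact/lefP/nd_nnsfun_approx.
rewrite [RHS](_ : _ = lim (\int[mu]_x (f_ n x * g x)%:E @[n --> \oo])%E); last first.
  rewrite -monotone_convergence//=.
  - apply: eq_integral => x _; apply/esym/cvg_lim => //.
    under eq_fun do rewrite EFinM.
    by rewrite EFinM; apply: cvgeM => //; exact: cvg_cst.
  - move=> n; apply/measurable_EFinP; apply: measurable_funM => //.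
  - by move=> n ? _; rewrite lee_fin mulr_ge0.
  - move=> x _ m n mn; rewrite lee_fin ler_wpM2r//.
    exact/lefP/nd_nnsfun_approx.
by apply: congr_lim; apply/funext => n; exact: density_nnsfun.
Qed.

Lemma integral_density (f : T -> R) : measurable_fun [set: T] f ->
  (\int[nu]_x (f x)%:E = \int[mu]_x (f x * g x)%:E)%E.
Proof.
move=> mf.
have := @weighted_integral_ext _ _ _ _ _ _ _ nu mu id (cst 1) id g.
move=> /(_ (fun=> ler01) g0) H.
have := H _ f mf; under eq_integral do rewrite mulr1.
apply=> {f mf}f mf f0; under eq_integral do rewrite mulr1.
exact: ge0_integral_density.
Qed.

End density.

Section lebesgue_affine.
Context {R : realType}.
Local Notation leb := (@lebesgue_measure R).

(** The right hand side is a measure which agrees with the Lebesgue measure on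
intervals. *)
Lemma lebesgue_affine (c b : R) (A : set R) : 0 < c -> measurable A ->
  leb A = (c%:E * leb [set x | A (c * x + b)%R])%E.
Proof.
move=> c0 mA.
pose f : R -> measurableTypeR R := fun x => c * x + b.
have mf : measurable_fun setT f.
  by apply: measurable_funD => //; exact: measurable_funM.
pose m : {measure set (measurableTypeR R) -> \bar R} :=
  mscale (NngNum (ltW c0)) (pushforward leb f).
rewrite -[RHS]/(m mf A); apply: lebesgue_measure_unique => // _ [[x y]] _ <-.
have -> : m mf `]x, y]%classic = (c%:E * leb (f @^-1` `]x, y]))%E by [].
rewrite (_ : f @^-1` _ = `](x - b) / c, (y - b) / c]%classic); last first.
  apply/seteqP; split => z; rewrite /f /= !in_itv /= ltr_pdivrMr// ler_pdivlMr//;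
  by rewrite mulrC ltrBlDr lerBrDr.
rewrite !lebesgue_measure_itv /= !lte_fin ltr_pM2r ?invr_gt0// ltrD2r.
case: ifPn => _; last by rewrite mule0.
by rewrite -!EFinB -EFinM; congr EFin; field; rewrite gt_eqF.
Qed.

Lemma ge0_integral_affine (c b : R) (f : R -> R) : 0 < c ->
  measurable_fun [set: R] f -> (forall x, 0 <= f x) ->
  (\int[leb]_x (f x)%:E = \int[leb]_x (c * f (c * x + b))%:E)%E.
Proof.
move=> c0 mf f0.
pose g : R -> measurableTypeR R := fun x => c * x + b.
have mg : measurable_fun setT g.
  by apply: measurable_funD => //; exact: measurable_funM.
pose m : {measure set (measurableTypeR R) -> \bar R} :=
  mscale (NngNum (ltW c0)) (pushforward leb g).
have mfg : measurable_fun [set: R] (fun x => f (g x)).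
  by apply: (measurableT_comp mf).
rewrite (eq_measure_integral (m mg)).
  rewrite ge0_integral_mscale//; last 2 first.
  - exact/measurable_EFinP.
  - by move=> x _; rewrite lee_fin.
  rewrite ge0_integral_pushforward//; last 2 first.
  - exact/measurable_EFinP.
  - by move=> x _; rewrite lee_fin.
  rewrite preimage_setT/= -ge0_integralZl//.
  - apply/measurable_EFinP.
    exact: mfg.
  - by move=> x _; rewrite lee_fin.
  - by rewrite lee_fin ltW.
by move=> A mA _; exact: (lebesgue_affine b c0 mA).
Qed.

End lebesgue_affine.

(** * The Mehler kernel *)

Section mehler.
Context {R : realType}.
Variables (s r : R).
Hypothesis s_gt0 : 0 < s.
Hypothesis r_gt0 : 0 < r.
Hypothesis r_lt1 : r < 1.

Let nu : probability (measurableTypeR R) R := normal_prob 0 s.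
Local Notation leb := (@lebesgue_measure R).
Local Notation c := (Num.sqrt (1 - r ^+ 2)).

Let c2 : c ^+ 2 = 1 - r ^+ 2.
Proof. by rewrite sqr_sqrtr// subr_ge0 expr_le1 ?ltW. Qed.

Let c_gt0 : 0 < c.
Proof. by rewrite sqrtr_gt0 subr_gt0 expr_lt1// ltW. Qed.

Lemma normal_pdf0E x :
  normal_pdf 0 s x = normal_peak s * expR (- x ^+ 2 / (2 * s ^+ 2)).
Proof.
rewrite normal_pdfE ?gt_eqF// /normal_fun subr0.
by congr (_ * expR (_ / _)); rewrite mulr2n mulrDl mul1r.
Qed.

(** The density with respect to the law nu of r x plus an
independent Gaussian variable of standard deviation s sqrt(1 - r^2). *)
Definition mehler (x y : R) : R := c^-1 *
  expR (- (r ^+ 2 * (x ^+ 2 + y ^+ 2) - 2 * r * x * y)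
        / (2 * s ^+ 2 * (1 - r ^+ 2))).

Lemma mehlerC x y : mehler x y = mehler y x.
Proof. by rewrite /mehler (addrC (y ^+ 2)) [2 * r * y * x]mulrAC. Qed.

Lemma mehler_gt0 x y : 0 < mehler x y.
Proof. by rewrite mulr_gt0 ?invr_gt0// expR_gt0. Qed.

Lemma mehler_ge0 x y : 0 <= mehler x y.
Proof. exact/ltW/mehler_gt0. Qed.
Hint Resolve mehler_ge0 : core.

Lemma measurable_mehler :
  measurable_fun [set: R * R] (fun z => mehler z.1 z.2).
Proof.
apply: measurable_funM => //; apply: measurableT_comp => //.
apply: measurable_funM => //; apply: measurableT_comp => //.
apply: measurable_funB.
  apply: measurable_funM => //.
  by apply: measurable_funD; apply: measurable_funX.
by apply: measurable_funM => //; apply: measurable_funM.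
Qed.

Lemma measurable_mehler1 x : measurable_fun [set: R] (mehler x).
Proof. exact: (measurable_section x measurable_mehler). Qed.

(** Completing the square. *)
Lemma mehler_pdf (a y : R) :
  mehler a (c * y + r * a) * normal_pdf 0 s (c * y + r * a) * c =
  normal_pdf 0 s y.
Proof.
rewrite !normal_pdf0E /mehler.
have -> : forall A B C D : R, A^-1 * B * (C * D) * A = A^-1 * A * (C * (B * D)).
  by move=> *; ring.
rewrite mulVf ?gt_eqF// mul1r -expRD; congr (_ * expR _).
set z := c * y + r * a.
have E : r ^+ 2 * (a ^+ 2 + z ^+ 2) - 2 * r * a * z =
    (1 - r ^+ 2) * (y ^+ 2 - z ^+ 2).
  have : (z - r * a) ^+ 2 = (1 - r ^+ 2) * y ^+ 2 by rewrite addrK exprMn c2.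
  by move: z => z h; lra.
rewrite E; field.
by rewrite !gt_eqF// -c2 exprn_gt0.
Qed.

Lemma mehler_ub a y : mehler a y <= c^-1 * expR (a ^+ 2 / (2 * s ^+ 2)).
Proof.
rewrite ler_pM2l ?invr_gt0// ler_expR -c2 ler_pdivrMr; last first.
  by rewrite !mulr_gt0// exprn_gt0.
rewrite (_ : a ^+ 2 / _ * _ = a ^+ 2 * c ^+ 2); last by field; rewrite gt_eqF.
by rewrite c2; have := sqr_ge0 (r * y - a); nra.
Qed.

Lemma integral_normal (f : R -> R) : measurable_fun [set: R] f ->
  (\int[nu]_x (f x)%:E = \int[leb]_x (f x * normal_pdf 0 s x)%:E)%E.
Proof.
move=> mf; apply: (@integral_density _ _ _ leb nu (normal_pdf 0 s)) => //.
- exact: measurable_normal_pdf.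
- by move=> x; exact: normal_pdf_ge0.
Qed.

(** The substitution z = r a + c y turns the density of nu at y into the product
of the Mehler kernel and of the density of nu at z. *)
Lemma integral_mehler (f : R -> R) a : measurable_fun [set: R] f ->
  (\int[nu]_y (f (r * a + c * y))%:E = \int[nu]_y (f y * mehler a y)%:E)%E.
Proof.
move=> mf.
have := @weighted_integral_ext _ _ _ _ _ _ _ nu nu
  (fun y => r * a + c * y) (cst 1) id (mehler a).
move=> /(_ (fun=> ler01) (fun y => mehler_ge0 a y)) H.
have := H _ f mf; under eq_integral do rewrite mulr1.
apply=> {f mf}f mf f0; under eq_integral do rewrite mulr1.
have maff : measurable_fun [set: R] (fun y => r * a + c * y).
  by apply: measurable_funD => //; exact: measurable_funM.
have mm := measurable_mehler1 a.
rewrite integral_normal; last exact: measurableT_comp mf maff.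
rewrite integral_normal; last exact: measurable_funM.
rewrite [RHS](@ge0_integral_affine _ c (r * a))//.
- apply: eq_integral => y _; rewrite -(mehler_pdf a y) (addrC (r * a)).
  by congr EFin; ring.
- apply: measurable_funM; [exact: measurable_funM|exact: measurable_normal_pdf].
- by move=> x; rewrite !mulr_ge0// normal_pdf_ge0.
Qed.

(** The Ornstein-Uhlenbeck operator at time - log r. *)
Definition gop (f : R -> R) (a : R) := \int[nu]_y f (r * a + c * y).

Lemma gopE f a : measurable_fun [set: R] f -> gop f a = ip nu (mehler a) f.
Proof.
move=> mf; rewrite /gop /ip /Rintegral; congr fine.
by rewrite integral_mehler//; apply: eq_integral => y _; rewrite mulrC.
Qed.

Lemma l1_prob_cst (x : R) : l1 nu (fun=> x).
Proof. exact: finite_measure_integrable_cst. Qed.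

Lemma Rint_prob_cst (x : R) : \int[nu]_y x = x.
Proof.
rewrite Rintegral_cst// -[RHS]mulr1; congr (_ * _).
exact: (congr1 fine (@probability_setT _ _ _ nu)).
Qed.

Lemma l1_bounded (f : R -> R) M : measurable_fun [set: R] f -> (forall x, `|f x| <= M) ->
  l1 nu f.
Proof. by move=> mf fM; exact: l1_le (l1_prob_cst M) fM. Qed.

Lemma l1_mehlerM a f : l1 nu f -> l1 nu (fun y => mehler a y * f y).
Proof.
move=> lf.
apply: (@l1_le _ _ _ _ _ (fun y => c^-1 * expR (a ^+ 2 / (2 * s ^+ 2)) * `|f y|)).
- apply: measurable_funM; [exact: measurable_mehler1|exact: l1_measurable lf].
- by apply: l1Z; exact: l1_norm.
- by move=> y; rewrite normrM (ger0_norm (mehler_ge0 a y)) ler_wpM2r// mehler_ub.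
Qed.

Lemma l1_mehler a : l1 nu (mehler a).
Proof.
rewrite (_ : mehler a = (fun y => mehler a y * 1)).
  exact/l1_mehlerM/l1_prob_cst.
by apply/funext => y; rewrite mulr1.
Qed.

Lemma Rint_mehler a : \int[nu]_y mehler a y = 1.
Proof.
rewrite -[RHS]Rint_prob_cst /Rintegral; congr fine.
transitivity (\int[nu]_y (cst 1 y * mehler a y)%:E)%E.
  by apply: eq_integral => y _; rewrite mul1r.
by rewrite -integral_mehler.
Qed.

(** The Mehler kernel is symmetric and has integral 1 in its second variable,
hence also in its first one: the law nu is invariant. *)
Lemma integral_mehler2 (f : R -> R) : measurable_fun [set: R] f ->
  (forall x, 0 <= f x) ->
  (\int[nu]_a \int[nu]_y (mehler a y * f y)%:E = \int[nu]_y (f y)%:E)%E.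
Proof.
move=> mf f0.
have mF : measurable_fun [set: R * R] (fun z => (mehler z.1 z.2 * f z.2)%:E).
  apply/measurable_EFinP; apply: measurable_funM; first exact: measurable_mehler.
  exact: measurableT_comp.
have F0 z : (0 <= (mehler z.1 z.2 * f z.2)%:E)%E by rewrite lee_fin mulr_ge0.
rewrite (@fubini_tonelli _ _ _ _ _ nu nu
  (fun z => (mehler z.1 z.2 * f z.2)%:E) mF F0) /=.
apply: eq_integral => y _.
under eq_integral do rewrite mulrC mehlerC.
rewrite EFin_Rint; last by apply: l1Z; exact: l1_mehler.
by rewrite RintZ ?Rint_mehler ?mulr1//; exact: l1_mehler.
Qed.

Lemma l1_gop (f : R -> R) : l1 nu f -> l1 nu (gop f).
Proof.
move=> lf; have mf := l1_measurable lf.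
have mF : measurable_fun [set: R * R] (fun z => mehler z.1 z.2 * f z.2).
  by apply: measurable_funM; [exact: measurable_mehler|exact: measurableT_comp].
have mg : measurable_fun [set: R] (gop f).
  rewrite (_ : gop f = (fun a => \int[nu]_y (mehler a y * f y))).
    exact: (@measurable_Rint _ _ _ _ _ nu (fun a y => mehler a y * f y) mF).
  by apply/funext => a; rewrite gopE.
have h : l1 nu (fun a => \int[nu]_y (mehler a y * `|f y|)).
  apply: l1_finP.
  - apply: (@measurable_Rint _ _ _ _ _ nu (fun a y => mehler a y * `|f y|)).
    apply: measurable_funM; first exact: measurable_mehler.
    by apply: measurableT_comp => //; exact: measurableT_comp.
  - by move=> a; apply: Rint_ge0 => y; rewrite mulr_ge0.
  - under eq_integral => a _.
      rewrite -EFin_Rint; last by apply: l1_mehlerM; exact: l1_norm.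
      over.
    rewrite (integral_mehler2 (l1_measurable (l1_norm lf)))//.
    by rewrite EFin_Rint ?ltry//; exact: l1_norm.
apply: (@l1_le _ _ _ nu (gop f) _ mg h) => a; rewrite gopE//.
apply: le_trans (le_norm_Rint (l1_mehlerM a lf)) _.
rewrite le_eqVlt; apply/orP; left; apply/eqP; apply: eq_Rint => y.
by rewrite normrM ger0_norm.
Qed.

Lemma Rint_gop (f : R -> R) : l1 nu f -> \int[nu]_a gop f a = \int[nu]_y f y.
Proof.
move=> lf; have mf := l1_measurable lf.
transitivity (\int[nu]_a \int[nu]_y (mehler a y * f y)).
  by apply: eq_Rint => a; rewrite gopE.
rewrite (@Rint_Fubini _ _ _ _ _ nu nu (fun a y => mehler a y * f y)).
- apply: eq_Rint => y; under eq_Rintegral do rewrite mulrC mehlerC.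
  by rewrite RintZ ?Rint_mehler ?mulr1//; exact: l1_mehler.
- by apply: measurable_funM; [exact: measurable_mehler|exact: measurableT_comp].
- by move=> a; exact: l1_mehlerM.
- move=> y; rewrite (_ : (fun _ => _) = (fun x => f y * mehler y x)).
    by apply: l1Z; exact: l1_mehler.
  by apply/funext => x; rewrite mulrC mehlerC.
- have := l1_gop (l1_norm lf).
  rewrite (_ : gop _ = (fun a => \int[nu]_y `|mehler a y * f y|))//.
  apply/funext => a; rewrite gopE; last exact: l1_measurable (l1_norm lf).
  by apply: eq_Rint => y; rewrite normrM (ger0_norm (mehler_ge0 a y)).
Qed.

End mehler.

(** * Gaussian moments *)

Section gaussian_moments.
Context {R : realType}.
Local Notation leb := (@lebesgue_measure R).

Lemma l1_gauss (k : R) : 0 < k -> l1 leb (fun x => expR (- k * x ^+ 2)).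
Proof.
move=> k0; pose s := Num.sqrt (2 * k)^-1.
have s0 : 0 < s by rewrite sqrtr_gt0 invr_gt0 mulr_gt0.
have s2 : s ^+ 2 = (2 * k)^-1 by rewrite sqr_sqrtr// invr_ge0 mulr_ge0// ltW.
have p0 : 0 < normal_peak s by rewrite normal_peak_gt0// gt_eqF.
rewrite (_ : (fun x => _) = (fun x => (normal_peak s)^-1 * normal_pdf 0 s x)).
  by apply: l1Z; exact: integrable_normal_pdf.
apply/funext => x; rewrite normal_pdf0E// mulKf ?gt_eqF//; congr expR.
by rewrite s2; field; rewrite gt_eqF.
Qed.

Variable s : R.
Hypothesis s_gt0 : 0 < s.
Let nu : probability (measurableTypeR R) R := normal_prob 0 s.

Lemma l1_normal (f : R -> R) : measurable_fun [set: R] f ->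
  l1 leb (fun x => f x * normal_pdf 0 s x) -> l1 nu f.
Proof.
move=> mf lf; apply/integrableP; split; first exact/measurable_EFinP.
rewrite [ltLHS](_ : _ = \int[nu]_x (`|f x|)%:E)%E//.
rewrite integral_normal//; last exact: measurableT_comp.
have := EFin_Rint (l1_norm lf).
under eq_integral do rewrite normrM (ger0_norm (normal_pdf_ge0 _ _ _)).
by move=> ->; rewrite ltry.
Qed.

(** The remainders of the third order expansions are dominated by a polynomial of
degree 6. *)
Lemma l1_poly6 : l1 nu (fun x => (1 + x ^+ 2) ^+ 3).
Proof.
(* Half of the exponent of the Gaussian density is left for integrability; the
   other half absorbs the cube, m (1 + x^2) being at most exp (k x^2 / 3). *)
pose k := (4 * s ^+ 2)^-1; have k0 : 0 < k by rewrite invr_gt0 mulr_gt0// exprn_gt0.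
pose m := Num.min 1 (k / 3).
have m0 : 0 < m by rewrite lt_min ltr01/= divr_gt0.
have mp : measurable_fun [set: R] (fun x : R => (1 + x ^+ 2) ^+ 3).
  by apply: measurable_funX; apply: measurable_funD => //; exact: measurable_funX.
apply: (l1_normal mp).
apply: (@l1_le _ _ _ leb _
  (fun x => (normal_peak s / m ^+ 3) * expR (- k * x ^+ 2))).
- by apply: measurable_funM => //; exact: measurable_normal_pdf.
- by apply: l1Z; exact: l1_gauss.
move=> x; rewrite ger0_norm; last first.
  by rewrite mulr_ge0 ?normal_pdf_ge0// exprn_ge0// addr_ge0// sqr_ge0.
rewrite normal_pdf0E// mulrCA -mulrA ler_wpM2l ?normal_peak_ge0//.
rewrite ler_pdivlMl ?exprn_gt0//.
rewrite (_ : - x ^+ 2 / _ = - (k * x ^+ 2 / 3) *+ 3 + - k * x ^+ 2); last first.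
  by rewrite /k; field; rewrite gt_eqF.
rewrite expRD mulrA mulrA ler_piMl ?expR_ge0//.
set u := k * x ^+ 2 / 3.
have u0 : 0 <= u by rewrite divr_ge0// mulr_ge0 ?sqr_ge0// ltW.
have mu : m * (1 + x ^+ 2) <= expR u.
  apply: le_trans (expR_ge1Dx u); rewrite mulrDr mulr1 lerD//.
    by rewrite ge_min lexx.
  by rewrite /u mulrAC ler_wpM2r ?sqr_ge0// ge_min lexx orbT.
rewrite -mulr_natl expRM_natl expRN -!exprMn.
rewrite expr_le1// ?ler_pdivrMr ?expR_gt0 ?mul1r//.
by rewrite !mulr_ge0 ?invr_ge0 ?expR_ge0 ?addr_ge0 ?sqr_ge0// ltW.
Qed.

Lemma l1_poly (f : R -> R) C : measurable_fun [set: R] f ->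
  (forall x, `|f x| <= C * (1 + x ^+ 2) ^+ 3) -> l1 nu f.
Proof. by move=> mf fC; apply: (@l1_le _ _ _ nu _ _ mf _ fC); exact: l1Z l1_poly6. Qed.

Lemma l1_sqr : l1 nu (fun x => x ^+ 2).
Proof.
apply: (@l1_poly _ 1) => [|x]; first exact: measurable_funX.
rewrite mul1r ger0_norm ?sqr_ge0//; have := sqr_ge0 x; set y := x ^+ 2 => y0.
by rewrite !exprS expr0 mulr1; nra.
Qed.

Lemma l1_id : l1 nu id.
Proof.
apply: (@l1_le _ _ _ nu _ (fun x => 1 + x ^+ 2)) => //.
  by apply: l1D; [exact: l1_prob_cst|exact: l1_sqr].
move=> x; have := sqr_ge0 (`|x| - 1).
by rewrite -(real_normK (num_real x)) => h; nra.
Qed.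

(** The mean m satisfies m = r m + sqrt(1 - r^2) m for every r in ]0, 1[. *)
Lemma Rint_id : \int[nu]_x x = 0.
Proof.
have r0 : 0 < 2^-1 :> R by rewrite invr_gt0.
have r1 : 2^-1 < 1 :> R by lra.
have := Rint_gop s_gt0 r0 r1 l1_id; rewrite -/nu.
set m := \int[nu]_x x; pose c : R := Num.sqrt (1 - 2^-1 ^+ 2).
rewrite (@eq_Rint _ _ _ nu _ (fun a => 2^-1 * a + c * m)); last first.
  move=> a; rewrite /gop -/nu RintD.
  - by rewrite Rint_prob_cst RintZ//; exact: l1_id.
  - exact: l1_prob_cst.
  - exact: l1Z l1_id.
rewrite RintD; [|exact: l1Z l1_id|exact: l1_prob_cst].
rewrite (RintZ 2^-1 l1_id) Rint_prob_cst -/m => h.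
have c1 : 2^-1 < c.
  rewrite -(ltr_pXn2r (_ : (0 < 2)%N)) ?nnegrE ?sqrtr_ge0//.
  by rewrite sqr_sqrtr; lra.
have /eqP : (c - 2^-1) * m = 0 by lra.
by rewrite mulf_eq0 gt_eqF ?subr_gt0//= => /eqP.
Qed.

End gaussian_moments.

(** * Second order expansion of a product of powers *)

Section taylor.
Context {R : realType}.
Implicit Types a s t u v x : R.

Lemma derive_ge0_le (f df : R -> R) a b : a <= b ->
  (forall x, a <= x <= b -> is_derive x 1 f (df x)) ->
  (forall x, a <= x <= b -> 0 <= df x) -> f a <= f b.
Proof.
move=> ab fd df0.
have [| |c + E] := @MVT_segment R f df a b ab.
- by move=> x; rewrite in_itv/= => /andP[/ltW ? /ltW ?]; apply: fd; apply/andP.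
- apply: derivable_within_continuous => x; rewrite in_itv/= => /fd h.
  exact: ex_derive.
- rewrite in_itv/= => /df0 c0.
  by rewrite -subr_ge0 E mulr_ge0// subr_ge0.
Qed.

Lemma expR_le_quad u : u <= 0 -> expR u <= 1 + u + u ^+ 2 / 2.
Proof.
move=> u0.
pose f : R -> R := fun x => expR x - 1 - x - 2^-1 * (x * x).
suff : f u <= f 0 by rewrite /f expR0 !mulr0 => h; rewrite expr2; lra.
apply: (@derive_ge0_le f (fun x => expR x - 1 - x)) => // x.
  move=> _; rewrite /f; apply: is_derive_eq.
  transitivity (expR x - 0 - 1 - 2^-1 * (x * 1 + x * 1)); first by [].
  by field.
by move=> _; have := expR_ge1Dx x; lra.
Qed.

Lemma expR_le_cube u : 0 <= u -> u <= 1 / 2 ->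
  expR u <= 1 + u + u ^+ 2 / 2 + u ^+ 3.
Proof.
move=> u0 u1.
pose f : R -> R := fun x => 1 + x + 2^-1 * (x * x) + x * x * x - expR x.
suff : f 0 <= f u by rewrite /f expR0 !mulr0 => h; rewrite expr2 3!exprS expr0; lra.
apply: (@derive_ge0_le f (fun x => 1 + x + 3 * (x * x) - expR x)) => // x.
  move=> _; rewrite /f; apply: is_derive_eq.
  transitivity (0 + 1 + 2^-1 * (x * 1 + x * 1) +
    ((x * x) * 1 + x * (x * 1 + x * 1)) - expR x); first by [].
  by field.
move=> /andP[x0 xu].
have x1 : x <= 1 / 2 by lra.
have h := expR_ge1Dx (- x); rewrite expRN in h.
have : expR x <= 1 + x + 2 * (x * x); last by nra.
have : (1 - x) * expR x <= 1.
  by rewrite -ler_pdivlMr ?expR_gt0// div1r.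
have := expR_gt0 x.
by nra.
Qed.

Lemma expR_taylor u : u <= 1 / 2 -> expR u <= 1 + u + u ^+ 2 / 2 + `|u| ^+ 3.
Proof.
move=> u1; have [u0|u0] := leP 0 u.
  by rewrite ger0_norm// expR_le_cube.
apply: le_trans (expR_le_quad (ltW u0)) _.
by rewrite lerDl exprn_ge0.
Qed.

(** The difference of both sides has derivative x^3 / (1 + x), of the sign of x,
and vanishes at 0. *)
Lemma ln_taylor s : -1 < s -> ln (1 + s) <= s - s ^+ 2 / 2 + s ^+ 3 / 3.
Proof.
move=> s1.
pose f : R -> R := fun x => x - 2^-1 * (x * x) + 3^-1 * (x * x * x) - ln (1 + x).
have fd x : -1 < x -> is_derive x 1 f (x ^+ 3 / (1 + x)).
  move=> x1.
  have x0 : 0 < 1 + x by lra.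
  have := is_derive1_ln x0 => dl.
  have dc : is_derive x 1 (@ln R \o (fun y : R => 1 + y)) (1 + x)^-1.
    rewrite -[(1 + x)^-1]mulr1; apply: (@is_derive1_comp R (@ln R)) => //.
    have h : is_derive x 1 (cst (1 : R) + id) (0 + 1 : R) by exact: is_deriveD.
    by rewrite add0r in h.
  have -> : f = (fun x => x - 2^-1 * (x * x) + 3^-1 * (x * x * x)
      - (@ln R \o (fun y : R => 1 + y)) x) by [].
  apply: is_derive_eq.
  transitivity (1 - 2^-1 * (x * 1 + x * 1) +
    3^-1 * ((x * x) * 1 + x * (x * 1 + x * 1)) - (1 + x)^-1); first by [].
  by field; rewrite gt_eqF.
suff : f 0 <= f s by rewrite /f addr0 ln1 !mulr0 expr2 3!exprS expr0; lra.
move: f fd => f fd; have [s0|s0] := leP 0 s.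
  apply: (@derive_ge0_le f (fun x => x ^+ 3 / (1 + x)) 0 s s0) => x /andP[x0 xs].
    by apply: fd; lra.
  by rewrite divr_ge0// ?exprn_ge0//; lra.
rewrite -lerN2.
apply: (@derive_ge0_le (fun x => - f x) (fun x => - (x ^+ 3 / (1 + x))) s 0 (ltW s0)).
- by move=> x /andP[sx x0]; apply: is_deriveN; apply: fd; lra.
- move=> x /andP[sx x0]; rewrite -mulNr divr_ge0//; last by lra.
  by rewrite exprS oppr_ge0 mulr_le0_ge0// ?sqr_ge0.
Qed.

(** The concave power is below its tangent at 1; this is Young's inequality. *)
Lemma powR_tangent a s : 0 < a < 1 -> -1 < s -> (1 + s) `^ a <= 1 + a * s.
Proof.
move=> /andP[a0 a1] s1.
have := @conjugate_powR R ((1 + s) `^ a) 1 a^-1 (1 - a)^-1.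
rewrite !invrK powR1 -powRrM mulfV ?gt_eqF// powRr1; last by lra.
rewrite invr_gt0 invr_gt0 subr_gt0 => /(_ (powR_ge0 _ _) ler01 a0 a1).
by move=> /(_ (ltac:(lra))); lra.
Qed.

(** As a one-sided bound, the second order expansion holds on the whole domain: far
from s = 0, the cubic term makes it weaker than the bound by the tangent. *)
Lemma powR_taylor a s : 0 < a < 1 -> -1 < s ->
  (1 + s) `^ a <= 1 + a * s - a * (1 - a) / 2 * s ^+ 2 + 10 * `|s| ^+ 3.
Proof.
move=> a01 s1; have /andP[a0 a1] := a01.
set w := `|s|; have w0 : 0 <= w by exact: normr_ge0.
have s2 : s ^+ 2 = w ^+ 2 by rewrite real_normK// num_real.
have sw : s <= w by exact: ler_norm.
have swn : - w <= s by rewrite /w; have := ler_norm (- s); rewrite normrN; lra.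
have aa : 0 <= a * (1 - a) <= 1 by apply/andP; split; nra.
have [w1|w1] := leP w (1 / 4); last first.
  apply: le_trans (powR_tangent a01 s1) _; rewrite s2 -addrA lerDl.
  rewrite (exprS w 2) addrC subr_ge0 mulrA ler_wpM2r ?sqr_ge0//.
  by move/andP: aa => [_ ?]; lra.
rewrite /powR gt_eqF; last by lra.
set v := a * (s - s ^+ 2 / 2 + s ^+ 3 / 3).
have s3 : - (w ^+ 3) <= s ^+ 3 <= w ^+ 3.
  by rewrite -ler_norml normrX.
have w2 : w ^+ 2 <= w / 4 by rewrite expr2 mulrC ler_wpM2l; lra.
have w3 : w ^+ 3 <= w ^+ 2 / 4 by rewrite exprSr ler_wpM2l ?sqr_ge0//; lra.
have w30 : 0 <= w ^+ 3 by rewrite exprn_ge0.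
have w20 : 0 <= w ^+ 2 by rewrite exprn_ge0.
(* r is the difference of v with its linear part *)
set r := a * (- s ^+ 2 / 2 + s ^+ 3 / 3).
have vr : v = a * s + r by rewrite /v /r; ring.
have r2 : `|r| <= w ^+ 2 * (2 / 3).
  rewrite normrM (gtr0_norm a0); apply: (@le_trans _ _ (1 * (w ^+ 2 * (2 / 3)))).
    apply: ler_pM => //; [exact: ltW|exact: ltW|].
    by rewrite s2 ler_norml; move/andP: s3 => [? ?]; apply/andP; split; lra.
  by rewrite mul1r.
have as1 : `|a * s| <= w.
  by rewrite normrM (gtr0_norm a0) ler_piMl// ltW.
have v1 : `|v| <= 2 * w.
  by rewrite vr; apply: le_trans (ler_normD _ _) _; lra.
have v3 : `|v| ^+ 3 <= 8 * w ^+ 3 / 1.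
  rewrite divr1 (_ : 8 * w ^+ 3 = (2 * w) ^+ 3); last by ring.
  by rewrite lerXn2r ?nnegrE// mulr_ge0.
have lnv : a * ln (1 + s) <= v by rewrite ler_pM2l// ln_taylor.
apply: (@le_trans _ _ (expR v)); first by rewrite ler_expR.
apply: (le_trans (expR_taylor _)).
  by have := ler_norm v; lra.
have v2 : v ^+ 2 <= a ^+ 2 * w ^+ 2 + 2 * w ^+ 3.
  have -> : v ^+ 2 = a ^+ 2 * w ^+ 2 + r * (2 * (a * s) + r).
    by rewrite vr -s2; ring.
  rewrite lerD2l (le_trans (ler_norm _))// normrM.
  apply: (@le_trans _ _ ((w ^+ 2 * (2 / 3)) * (3 * w))).
    apply: ler_pM => //; apply: le_trans (ler_normD _ _) _.
    by rewrite normrM ger0_norm//; lra.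
  by rewrite (_ : _ * _ = 2 * w ^+ 3)//; field.
have ra : r <= - a * w ^+ 2 / 2 + w ^+ 3 / 3.
  have -> : r = - a * w ^+ 2 / 2 + a * s ^+ 3 / 3 by rewrite /r s2; field.
  rewrite lerD2l ler_pM2r ?invr_gt0//.
  apply: (@le_trans _ _ (a * w ^+ 3)); last by rewrite ler_piMl// ltW.
  by rewrite ler_pM2l//; move/andP: s3 => [].
rewrite s2.
have -> : a * (1 - a) / 2 * w ^+ 2 = a * w ^+ 2 / 2 - a ^+ 2 * w ^+ 2 / 2.
  by field.
lra.
Qed.

(** The remainder of the product of two one-sided expansions. *)
Lemma powR2_taylor a b K : 0 < a < 1 -> 0 < b < 1 -> 1 <= K ->
  exists2 C, 0 <= C & forall s t, -1 < s -> -1 < t -> `|s| <= K -> `|t| <= K ->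
  (1 + s) `^ a * (1 + t) `^ b <=
    1 + a * s + b * t + (a * b * (s * t) - a * (1 - a) / 2 * s ^+ 2
      - b * (1 - b) / 2 * t ^+ 2) + C * (`|s| ^+ 3 + `|t| ^+ 3).
Proof.
move=> a01 b01 K1; exists (1 + K + 10 * (1 + K) + 100 * K ^+ 3).
  by rewrite !addr_ge0 ?mulr_ge0 ?exprn_ge0//; lra.
move=> s t s1 t1 sK tK.
have := powR_taylor a01 s1; have := powR_taylor b01 t1.
have /andP[a0 a1] := a01; have /andP[b0 b1] := b01.
have s2 : s ^+ 2 = `|s| ^+ 2 by rewrite real_normK// num_real.
have t2 : t ^+ 2 = `|t| ^+ 2 by rewrite real_normK// num_real.
have := ler_norm s; have := ler_norm t; have := ler_norm (- s).
have := ler_norm (- t); rewrite !normrN s2 t2.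
have := normr_ge0 s; have := normr_ge0 t; move: sK tK.
set w := `|s|; set z := `|t|.
set A := a * (1 - a) / 2; set B := b * (1 - b) / 2.
have A0 : 0 <= A by rewrite divr_ge0// mulr_ge0//; lra.
have B0 : 0 <= B by rewrite divr_ge0// mulr_ge0//; lra.
have A1 : A <= 1 / 2 by rewrite /A; nra.
have B1 : B <= 1 / 2 by rewrite /B; nra.
move=> wK zK z0 w0 tz sw tz' sw' h2 h1.
have w20 : 0 <= w ^+ 2 by exact: sqr_ge0.
have z20 : 0 <= z ^+ 2 by exact: sqr_ge0.
have w30 : 0 <= w ^+ 3 by rewrite exprn_ge0.
have z30 : 0 <= z ^+ 3 by rewrite exprn_ge0.
apply: (@le_trans _ _ ((1 + a * s - A * w ^+ 2 + 10 * w ^+ 3) *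
    (1 + b * t - B * z ^+ 2 + 10 * z ^+ 3))).
  by apply: ler_pM; rewrite ?powR_ge0.
have as1 : a * s <= w by nra.
have as2 : - w <= a * s by nra.
have bt1 : b * t <= z by nra.
have bt2 : - z <= b * t by nra.
have wz2 : w * z ^+ 2 <= w ^+ 3 + z ^+ 3.
  have [h|h] := leP w z.
    by apply: (@le_trans _ _ (z ^+ 3)); [rewrite (exprS z 2) ler_wpM2r|rewrite lerDr].
  apply: (@le_trans _ _ (w ^+ 3)); [rewrite (exprS w 2) ler_wpM2l//|by rewrite lerDl].
  by rewrite lerXn2r ?nnegrE// ltW.
have zw2 : z * w ^+ 2 <= w ^+ 3 + z ^+ 3.
  have [h|h] := leP z w.
    by apply: (@le_trans _ _ (w ^+ 3)); [rewrite (exprS w 2) ler_wpM2r|rewrite lerDl].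
  apply: (@le_trans _ _ (z ^+ 3)); [rewrite (exprS z 2) ler_wpM2l//|by rewrite lerDr].
  by rewrite lerXn2r ?nnegrE// ltW.
have T1 : - (a * s * (B * z ^+ 2)) <= (w ^+ 3 + z ^+ 3) / 2.
  have : - (a * s) * (B * z ^+ 2) <= w * (1 / 2 * z ^+ 2).
    apply: (@le_trans _ _ (w * (B * z ^+ 2))).
      by rewrite ler_wpM2r ?mulr_ge0//; lra.
    by rewrite ler_wpM2l// ler_wpM2r.
  by lra.
have T2 : - (b * t * (A * w ^+ 2)) <= (w ^+ 3 + z ^+ 3) / 2.
  have : - (b * t) * (A * w ^+ 2) <= z * (1 / 2 * w ^+ 2).
    apply: (@le_trans _ _ (z * (A * w ^+ 2))).
      by rewrite ler_wpM2r ?mulr_ge0//; lra.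
    by rewrite ler_wpM2l// ler_wpM2r.
  by lra.
have S0 : 0 <= w ^+ 3 + z ^+ 3 by lra.
have T3 : (A * w ^+ 2) * (B * z ^+ 2) <= K * (w ^+ 3 + z ^+ 3).
  apply: (@le_trans _ _ (w ^+ 2 * z ^+ 2)).
    by apply: ler_pM; [exact: mulr_ge0|exact: mulr_ge0|rewrite ler_piMl//; lra..].
  rewrite expr2 -mulrA; apply: ler_pM => //.
  by rewrite mulr_ge0.
have T4 : 10 * w ^+ 3 * (1 + b * t - B * z ^+ 2) <= 10 * (1 + K) * w ^+ 3.
  rewrite mulrAC ler_wpM2r// ler_wpM2l//.
  have : 0 <= B * z ^+ 2 by rewrite mulr_ge0.
  by lra.
have T5 : 10 * z ^+ 3 * (1 + a * s - A * w ^+ 2) <= 10 * (1 + K) * z ^+ 3.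
  rewrite mulrAC ler_wpM2r// ler_wpM2l//.
  have : 0 <= A * w ^+ 2 by rewrite mulr_ge0.
  by lra.
have T6 : 100 * w ^+ 3 * z ^+ 3 <= 100 * K ^+ 3 * w ^+ 3.
  rewrite mulrAC ler_wpM2r// ler_wpM2l//.
  by rewrite lerXn2r ?nnegrE//; lra.
have -> : (1 + a * s - A * w ^+ 2 + 10 * w ^+ 3) *
    (1 + b * t - B * z ^+ 2 + 10 * z ^+ 3) =
  1 + a * s + b * t + (a * b * (s * t) - A * w ^+ 2 - B * z ^+ 2)
  + (- (a * s * (B * z ^+ 2)) + - (b * t * (A * w ^+ 2))
  + (A * w ^+ 2) * (B * z ^+ 2) + 10 * w ^+ 3 * (1 + b * t - B * z ^+ 2)
  + 10 * z ^+ 3 * (1 + a * s - A * w ^+ 2) + 100 * w ^+ 3 * z ^+ 3) by ring.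
rewrite lerD2l.
have K30 : 0 <= 100 * K ^+ 3 * z ^+ 3.
  by rewrite mulr_ge0// mulr_ge0// exprn_ge0// (le_trans z0).
lra.
Qed.

End taylor.

Lemma expn_powR {R : realType} (x a : R) n m : 0 <= x -> n%:R * a = m%:R ->
  (x ^+ n) `^ a = x ^+ m.
Proof. by move=> x0 na; rewrite -!powR_mulrn// -powRrM na. Qed.

Lemma powR_expn {R : realType} (x a : R) n m : 0 <= x -> n%:R * a = m%:R ->
  (x `^ a) ^+ n = x ^+ m.
Proof. by move=> x0 na; rewrite -!powR_mulrn ?powR_ge0// -powRrM mulrC na. Qed.

(** * Correlated averages over one small step *)

(** The quadratic form in the second order expansion, compared with the one of
the first order parts s0 and t0 of s and t. *)
Lemma quadratic_perturbation {R : realType} (A B c d X Y s t s0 t0 : R) :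
  0 <= A <= 1 -> 0 <= B <= 1 -> 0 <= c <= 1 -> 0 <= d -> 0 <= X -> 0 <= Y ->
  `|s| <= 2 * d * X -> `|t| <= 2 * d * Y -> `|s0| <= d * X -> `|t0| <= d * Y ->
  forall e, `|s - s0| <= e * d * X -> `|t - t0| <= e * d * Y -> 0 <= e ->
  c * (s * t) - A * s ^+ 2 - B * t ^+ 2 <=
  c * (s0 * t0) - A * s0 ^+ 2 - B * t0 ^+ 2 + 6 * e * d ^+ 2 * (X ^+ 2 + Y ^+ 2).
Proof.
move=> /andP[A0 A1] /andP[B0 B1] /andP[c0 c1] d0 X0 Y0 sX tY s0X t0Y e ss tt e0.
have dX0 : 0 <= d * X by exact: mulr_ge0.
have dY0 : 0 <= d * Y by exact: mulr_ge0.
have P1 : c * ((s - s0) * t) <= e * d * X * (2 * d * Y).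
  apply: le_trans (ler_norm _) _; rewrite normrM (ger0_norm c0) normrM.
  by rewrite -[leRHS]mul1r ler_pM// ?mulr_ge0// ler_pM.
have P2 : c * (s0 * (t - t0)) <= d * X * (e * d * Y).
  apply: le_trans (ler_norm _) _; rewrite normrM (ger0_norm c0) normrM.
  by rewrite -[leRHS]mul1r ler_pM// ?mulr_ge0// ler_pM.
have P3 : - (A * ((s - s0) * (s + s0))) <= e * d * X * (3 * d * X).
  apply: le_trans (ler_norm _) _; rewrite normrN normrM (ger0_norm A0) normrM.
  rewrite -[leRHS]mul1r ler_pM// ?mulr_ge0// ler_pM//.
  by apply: le_trans (ler_normD _ _) _; lra.
have P4 : - (B * ((t - t0) * (t + t0))) <= e * d * Y * (3 * d * Y).
  apply: le_trans (ler_norm _) _; rewrite normrN normrM (ger0_norm B0) normrM.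
  rewrite -[leRHS]mul1r ler_pM// ?mulr_ge0// ler_pM//.
  by apply: le_trans (ler_normD _ _) _; lra.
have XY : e * d ^+ 2 * (2 * (X * Y)) <= e * d ^+ 2 * (X ^+ 2 + Y ^+ 2).
  rewrite ler_wpM2l// ?mulr_ge0 ?sqr_ge0//.
  by have := sqr_ge0 (X - Y); rewrite sqrrB; lra.
have XY0 : 0 <= e * d ^+ 2 * (X ^+ 2 + Y ^+ 2).
  by rewrite !mulr_ge0 ?addr_ge0 ?sqr_ge0.
have -> : c * (s * t) - A * s ^+ 2 - B * t ^+ 2 =
  c * (s0 * t0) - A * s0 ^+ 2 - B * t0 ^+ 2 + (c * ((s - s0) * t)
  + c * (s0 * (t - t0)) + - (A * ((s - s0) * (s + s0)))
  + - (B * ((t - t0) * (t + t0)))) by ring.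
rewrite lerD2l; lra.
Qed.

Lemma half_variance_bounds {R : realType} (a : R) :
  0 < a < 1 -> 0 <= a * (1 - a) / 2 <= 1.
Proof. by move=> /andP[? ?]; apply/andP; split; nra. Qed.

Lemma unit_mul_bounds {R : realType} (a b : R) :
  0 < a < 1 -> 0 < b < 1 -> 0 <= a * b <= 1.
Proof. by move=> /andP[? ?] /andP[? ?]; apply/andP; split; nra. Qed.

Lemma norm_sub1 {R : realType} (w M : R) :
  0 < w -> w <= M -> 1 <= M -> `|w - 1| <= M.
Proof. by move=> *; rewrite ler_norml; apply/andP; split; lra. Qed.

Lemma norm_le1Dsqr {R : realType} (z : R) : `|z| <= 1 + z ^+ 2.
Proof.
by have := sqr_ge0 (`|z| - 1); rewrite -(real_normK (num_real z)) => h; nra.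
Qed.

Section correlated_pair.
Context {R : realType}.
Variables (s r : R).
Hypothesis s_gt0 : 0 < s.
Hypothesis r_gt0 : 0 < r.
Hypothesis r_lt1 : r < 1.

Let nu : probability (measurableTypeR R) R := normal_prob 0 s.
Local Notation c := (Num.sqrt (1 - r ^+ 2)).
Local Notation gop := (gop s r).

Lemma l1_shift (f : R -> R) a : l1 nu f -> l1 nu (fun z => f (r * a + c * z)).
Proof.
move=> lf; have mf := l1_measurable lf.
have mfa : measurable_fun [set: R] (fun z => f (r * a + c * z)).
  apply: (measurableT_comp mf (g := fun z : R => r * a + c * z)).
  by apply: measurable_funD => //; exact: measurable_funM.
apply/integrableP; split; first exact/measurable_EFinP.
rewrite [ltLHS](_ : _ = \int[nu]_z ((@Num.norm R R \o f) (r * a + c * z))%:E)%E//.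
rewrite integral_mehler//; last exact: measurableT_comp.
have := EFin_Rint (l1_mehlerM s_gt0 r_gt0 r_lt1 a (l1_norm lf)).
by under eq_integral do rewrite mulrC; move=> ->; rewrite ltry.
Qed.

(** The law nu is centered. *)
Lemma gop_id a : gop id a = r * a.
Proof.
rewrite /gop -/nu RintD.
- rewrite Rint_prob_cst (RintZ c (l1_id s_gt0)) Rint_id// mulr0 addr0//.
- exact: l1_prob_cst.
- by apply: l1Z; exact: l1_id.
Qed.

Lemma gop_ge0 (f : R -> R) a : (forall x, 0 <= f x) -> 0 <= gop f a.
Proof. by move=> f0; apply: Rint_ge0. Qed.

Lemma gop_bounds (f : R -> R) m M a : measurable_fun [set: R] f ->
  (forall x, m <= f x <= M) -> m <= gop f a <= M.
Proof.
move=> mf fmM.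
have lf : l1 nu f.
  apply: (@l1_bounded _ _ _ (`|m| + `|M|)) => // x.
  have /andP[h1 h2] := fmM x; rewrite ler_norml.
  have := ler_norm M; have := ler_norm (- m); rewrite normrN.
  have := normr_ge0 M; have := normr_ge0 m.
  by move=> *; apply/andP; split; lra.
have la := l1_shift a lf.
rewrite -{1}(Rint_prob_cst s m) -(Rint_prob_cst s M) /gop -/nu.
by apply/andP; split; apply: le_Rint => //; try exact: l1_prob_cst;
  move=> z; have /andP[] := fmM (r * a + c * z).
Qed.

(** A bound for the expectation of F(xi) H(eta), where eta and zeta are
independent and xi = r eta + c zeta. *)
Lemma pair_le (F H f1 f2 : R -> R) k MF MH :
  measurable_fun [set: R] F -> measurable_fun [set: R] H ->
  (forall x, `|F x| <= MF) -> (forall x, `|H x| <= MH) ->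
  l1 nu f1 -> l1 nu f2 ->
  (forall x y, F x * H y <= f1 x + f2 y + k * (x * y)) ->
  \int[nu]_y (H y * gop F y) <=
  \int[nu]_y f1 y + \int[nu]_y f2 y + k * (r * \int[nu]_y (y ^+ 2)).
Proof.
move=> mF mH FM HM l1f l2f FH.
have lF := l1_bounded s mF FM; have lH := l1_bounded s mH HM.
have l1sq := l1_sqr s_gt0.
have step y : H y * gop F y <= gop f1 y + f2 y + k * (r * y ^+ 2).
  rewrite /gop -/nu -RintZ; last exact: l1_shift.
  have lid := l1_shift y (l1_id s_gt0).
  have lfy := l1_shift y l1f.
  have lk : l1 nu (fun z => k * y * (r * y + c * z)) by exact: l1Z.
  have -> : k * (r * y ^+ 2) = \int[nu]_z (k * y * (r * y + c * z)).
    rewrite RintZ// (_ : \int[nu]_z _ = gop id y)// gop_id; ring.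
  rewrite -{1}(Rint_prob_cst s (f2 y)) -RintD//; last exact: l1_prob_cst.
  rewrite -RintD//; last by apply: l1D => //; exact: l1_prob_cst.
  apply: le_Rint.
  - by apply: l1Z; exact: l1_shift.
  - by apply: l1D => //; apply: l1D => //; exact: l1_prob_cst.
  - move=> z; rewrite mulrC; apply: le_trans (FH _ _) _.
    by rewrite le_eqVlt; apply/orP; left; apply/eqP; ring.
have lg1 := l1_gop s_gt0 r_gt0 r_lt1 l1f.
have lgF := l1_gop s_gt0 r_gt0 r_lt1 lF.
have lkr : l1 nu (fun y => k * (r * y ^+ 2)) by do 2 apply: l1Z.
have <- : \int[nu]_y (gop f1 y + f2 y + k * (r * y ^+ 2)) =
    \int[nu]_y f1 y + \int[nu]_y f2 y + k * (r * \int[nu]_y (y ^+ 2)).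
  rewrite RintD//; last exact: l1D.
  by rewrite RintD// Rint_gop// RintZ ?RintZ//; exact: l1Z.
apply: le_Rint => //; last by apply: l1D => //; exact: l1D.
apply: (@l1_bounded _ _ _ (MH * MF)).
  by apply: measurable_funM => //; exact: l1_measurable lgF.
move=> y; rewrite normrM; apply: ler_pM => //.
rewrite ler_norml; apply: gop_bounds => // x.
by rewrite -ler_norml.
Qed.

(** The heat semigroup, at a time proportional to e^2. *)
Definition heat (e : R) (U : R -> R) (x : R) := \int[nu]_z U (x + e * z).

(** This class is stable under averaging, with the same constants, so that the
error of one step is uniform. *)
Definition regular (m M K : R) (U : R -> R) :=
  [/\ measurable_fun [set: R] U, (forall x, m <= U x <= M) &
    exists D : R -> R, [/\ measurable_fun [set: R] D,
      (forall x, `|D x| <= K) &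
      forall x t, `|U (x + t) - U x - D x * t| <= K * t ^+ 2]].

Lemma measurable_affine_comp (f : R -> R) (a b : R) :
  measurable_fun [set: R] f -> measurable_fun [set: R] (fun z => f (a + b * z)).
Proof.
move=> mf; apply: (measurableT_comp mf (g := fun z : R => a + b * z)).
by apply: measurable_funD => //; exact: measurable_funM.
Qed.

Lemma l1_heat (U : R -> R) e x M : measurable_fun [set: R] U ->
  (forall x, `|U x| <= M) -> l1 nu (fun z => U (x + e * z)).
Proof.
by move=> mU UM; apply: (@l1_bounded _ _ _ M) => //; exact: measurable_affine_comp.
Qed.

Lemma measurable_heat (U : R -> R) e : measurable_fun [set: R] U ->
  measurable_fun [set: R] (heat e U).
Proof.
move=> mU; rewrite (_ : heat e U = (fun x => \int[nu]_z U (x + e * z)))//.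
apply: (@measurable_Rint _ _ _ _ _ nu).
apply: (measurableT_comp mU (g := fun z : R * R => z.1 + e * z.2)).
by apply: measurable_funD => //; exact: measurable_funM.
Qed.

Lemma range_norm (m M u : R) : 0 <= m -> m <= u <= M -> `|u| <= M.
Proof. by move=> m0 /andP[h1 h2]; rewrite ger0_norm// (le_trans m0). Qed.

Lemma heat_bounds (U : R -> R) e m M x : 0 <= m -> measurable_fun [set: R] U ->
  (forall x, m <= U x <= M) -> m <= heat e U x <= M.
Proof.
move=> m0 mU UmM.
have lU : l1 nu (fun z => U (x + e * z)).
  by apply: (@l1_heat _ _ _ M) => // z; exact: range_norm m0 _.
rewrite -{1}(Rint_prob_cst s m) -(Rint_prob_cst s M) /heat.
by apply/andP; split; apply: le_Rint => //; try exact: l1_prob_cst;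
  move=> z; have /andP[] := UmM (x + e * z).
Qed.

Lemma regular_heat m M K e U : 0 <= m ->
  regular m M K U -> regular m M K (heat e U).
Proof.
move=> m0 [mU UmM [D [mD DK UD]]]; split.
- exact: measurable_heat.
- by move=> x; exact: heat_bounds.
have U_M x : `|U x| <= M by exact: range_norm m0 _.
exists (heat e D); split.
- exact: measurable_heat.
- move=> x; apply: le_trans (le_norm_Rint (l1_heat e x mD DK)) _.
  rewrite -[leRHS](Rint_prob_cst s K); apply: le_Rint => //.
  + by apply: l1_norm; exact: l1_heat DK.
  + exact: l1_prob_cst.
- move=> x t; have l1' := l1_heat e (x + t) mU U_M.
  have l2' := l1_heat e x mU U_M; have l3' := l1_heat e x mD DK.
  rewrite /heat mulrC -RintZ// -RintB// -RintB//; last 2 first.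
  + exact: l1B.
  + exact: l1Z.
  have l4 := l1B (l1B l1' l2') (l1Z t l3').
  apply: le_trans (le_norm_Rint l4) _.
  rewrite -[leRHS](Rint_prob_cst s (K * t ^+ 2)); apply: le_Rint.
  + exact: l1_norm.
  + exact: l1_prob_cst.
  + by move=> z; have := UD (x + e * z) t; rewrite (addrAC x (e * z) t) (mulrC _ t).
Qed.

Lemma Rint_heatB (U : R -> R) e x M : measurable_fun [set: R] U ->
  (forall x, `|U x| <= M) -> \int[nu]_z (U (x + e * z) - heat e U x) = 0.
Proof.
move=> mU UM; rewrite RintB ?Rint_prob_cst ?subrr//; last exact: l1_prob_cst.
exact: (l1_heat e x mU UM).
Qed.

(** First order expansion of the fluctuation around the average. *)
Lemma regular_fluctuation m M K U : 0 < m -> 0 <= K -> regular m M K U ->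
  exists2 D : R -> R, (forall x, `|D x| <= K) &
  forall e x z, `|U (x + e * z) - heat e U x - e * D x * z| <=
    K * (1 + \int[nu]_z z ^+ 2) * e ^+ 2 * (1 + z ^+ 2).
Proof.
move=> m0 K0 [mU UmM [D [mD DK UD]]]; exists D => // e x z.
have U_M y : `|U y| <= M by exact: range_norm (ltW m0) _.
set v := \int[nu]_z z ^+ 2.
have v0 : 0 <= v by apply: Rint_ge0 => y; exact: sqr_ge0.
have lU := l1_heat e x mU U_M.
have lid := l1_id s_gt0; have lsq := l1_sqr s_gt0.
have H : `|heat e U x - U x| <= K * e ^+ 2 * v.
  have lc := l1_prob_cst s (U x).
  have le : l1 nu (fun y => D x * (e * y)) by do 2 apply: l1Z.
  have -> : heat e U x - U x =
      \int[nu]_y (U (x + e * y) - U x - D x * (e * y)).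
    rewrite RintB//; last exact: l1B.
    rewrite RintB// RintZ; last exact: l1Z.
    by rewrite (RintZ e lid) Rint_id// !mulr0 subr0 Rint_prob_cst.
  have l3 := l1B (l1B lU lc) le.
  apply: le_trans (le_norm_Rint l3) _.
  rewrite -RintZ//; apply: le_Rint; [exact: l1_norm|exact: l1Z|].
  by move=> y; rewrite -mulrA -exprMn; exact: UD.
have Uz := UD x (e * z).
have -> : U (x + e * z) - heat e U x - e * D x * z =
   (U (x + e * z) - U x - D x * (e * z)) - (heat e U x - U x) by ring.
apply: le_trans (ler_normB _ _) _.
apply: le_trans (lerD Uz H) _.
rewrite exprMn.
have Ke : 0 <= K * e ^+ 2 by rewrite mulr_ge0// sqr_ge0.
have -> : K * (e ^+ 2 * z ^+ 2) + K * e ^+ 2 * v = K * e ^+ 2 * (z ^+ 2 + v).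
  by ring.
have -> : K * (1 + v) * e ^+ 2 * (1 + z ^+ 2) =
  K * e ^+ 2 * ((1 + v) * (1 + z ^+ 2)) by ring.
by rewrite ler_wpM2l//; have := sqr_ge0 z; nra.
Qed.

Section one_step.
Variables (a b : R).
Hypothesis a01 : 0 < a < 1.
Hypothesis b01 : 0 < b < 1.
Hypothesis abr : r ^+ 2 * (a * b) <= (1 - a) * (1 - b).

(** The map (u, v) |-> u^a v^b is concave along the correlated directions: this
is where the exponents are related to the correlation. *)
Lemma correlated_concave p q :
  a * b * (r * (p * q)) - a * (1 - a) / 2 * p ^+ 2 - b * (1 - b) / 2 * q ^+ 2
  <= 0.
Proof.
have /andP[a0 a1] := a01; have /andP[b0 b1] := b01.
have A0 : 0 < a * (1 - a) by rewrite mulr_gt0// subr_gt0.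
have B0 : 0 < b * (1 - b) by rewrite mulr_gt0// subr_gt0.
rewrite -(pmulr_rle0 _ A0).
have h : (a * b * r) ^+ 2 <= (a * (1 - a)) * (b * (1 - b)).
  have -> : (a * b * r) ^+ 2 = (a * b) * (r ^+ 2 * (a * b)) by ring.
  have -> : a * (1 - a) * (b * (1 - b)) = (a * b) * ((1 - a) * (1 - b)) by ring.
  by rewrite ler_wpM2l// mulr_ge0// ltW.
have := sqr_ge0 (a * (1 - a) * p - a * b * r * q).
have : (a * b * r) ^+ 2 * q ^+ 2 <= (a * (1 - a)) * (b * (1 - b)) * q ^+ 2.
  by rewrite ler_wpM2r// sqr_ge0.
set A := a * (1 - a); set B := b * (1 - b); set k := a * b * r.
move=> h1 h2.
have -> : A * (a * b * (r * (p * q)) - A / 2 * p ^+ 2 - B / 2 * q ^+ 2) =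
  - ((A * p - k * q) ^+ 2 + (A * B * q ^+ 2 - k ^+ 2 * q ^+ 2)) / 2.
  by rewrite /k; field.
by rewrite pmulr_lle0 ?invr_gt0// oppr_le0 addr_ge0// subr_ge0.
Qed.

(** The relative fluctuations S and T of U and V at scale e are p z and q z up to
terms of order e^2. Expanding u^a v^b to the second order, the terms of first order
have mean 0, the quadratic form is nonpositive in the mean by correlated_concave,
and the remainder is cubic in e. *)
Lemma one_step m M K : 0 < m -> m <= M -> 0 <= K ->
  exists2 C, 0 <= C & forall e U V x y, 0 <= e <= 1 ->
    regular m M K U -> regular m M K V ->
    \int[nu]_z (V (y + e * z) `^ b * gop (fun t => U (x + e * t) `^ a) z) <=
    heat e U x `^ a * heat e V y `^ b + C * e ^+ 3.
Proof.
move=> m0 mM K0.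
have /andP[a0 a1] := a01; have /andP[b0 b1] := b01.
have K1 : 1 <= M / m by rewrite ler_pdivlMr// mul1r.
have A01 := half_variance_bounds a01; have B01 := half_variance_bounds b01.
have ab01 := unit_mul_bounds a01 b01.
have [C0 C00 taylor] := powR2_taylor a01 b01 K1.
set v := \int[nu]_z z ^+ 2.
have v0 : 0 <= v by apply: Rint_ge0 => t; exact: sqr_ge0.
(* Relative to the averages, d bounds the derivatives and, up to the factor
   e^2 (1 + z^2), the errors of the first order expansions. *)
pose d := K * (1 + v) / m.
have d0 : 0 <= d by rewrite divr_ge0 ?mulr_ge0 ?addr_ge0// ltW.
have KdM : K / m <= d by rewrite ler_pM2r ?invr_gt0// ler_peMr// lerDl.
pose L := 6 * d ^+ 2 + C0 * (8 * d ^+ 3).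
have L0 : 0 <= L.
  apply: addr_ge0; first by rewrite mulr_ge0// exprn_ge0.
  by rewrite mulr_ge0// mulr_ge0// exprn_ge0.
pose m6 := \int[nu]_z ((1 + z ^+ 2) ^+ 3).
have m60 : 0 <= m6.
  by apply: Rint_ge0 => z; rewrite exprn_ge0// addr_ge0// sqr_ge0.
exists (M `^ a * M `^ b * (2 * L * m6)).
  by rewrite !mulr_ge0 ?powR_ge0.
move=> e U V x y /andP[e0 e1] rU rV.
have [mU UmM _] := rU; have [mV VmM _] := rV.
have [D DK UD] := regular_fluctuation m0 K0 rU.
have [D' DK' VD] := regular_fluctuation m0 K0 rV.
set u := heat e U x; set w := heat e V y.
have /andP[mu uM] : m <= u <= M by apply: heat_bounds => //; exact: ltW.
have /andP[mw wM] : m <= w <= M by apply: heat_bounds => //; exact: ltW.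
have u0 : 0 < u by exact: lt_le_trans m0 mu.
have w0 : 0 < w by exact: lt_le_trans m0 mw.
pose S z := U (x + e * z) / u - 1.
pose T z := V (y + e * z) / w - 1.
pose p := e * D x / u; pose q := e * D' y / w.
(* the relative fluctuations S and T, to first order p z and q z *)
have fluct W k W' (DW : R -> R) x0 : 0 < k -> m <= k ->
    `|DW x0| <= K -> (forall z, m <= W z <= M) -> k <= M ->
    (forall z, `|W z - k - e * DW x0 * z| <=
       K * (1 + v) * e ^+ 2 * (1 + z ^+ 2)) ->
    (forall z, W' z = W z / k - 1) ->
    forall z, [/\ -1 < W' z, `|W' z| <= M / m, `|W' z| <= 2 * (e * d) * (1 + z ^+ 2),
      `|e * DW x0 / k * z| <= e * d * (1 + z ^+ 2) &
      `|W' z - e * DW x0 / k * z| <= e * (e * d) * (1 + z ^+ 2)].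
  move=> k0 mk DWK WmM kM WD W'E z; rewrite W'E.
  have /andP[mW WM] := WmM z.
  have Wk0 : 0 < W z / k by rewrite divr_gt0// (lt_le_trans m0).
  have Wk1 : W z / k <= M / m.
    rewrite ler_pM ?invr_ge0 ?(ltW k0) ?(le_trans (ltW m0))//.
    by rewrite lef_pV2 ?posrE.
  have z20 := sqr_ge0 z.
  have zz := norm_le1Dsqr z.
  have ed0 : 0 <= e * d by exact: mulr_ge0.
  have E1 : `|W z / k - 1 - e * DW x0 / k * z| <= e * (e * d) * (1 + z ^+ 2).
    have -> : W z / k - 1 - e * DW x0 / k * z = (W z - k - e * DW x0 * z) / k.
      by field; rewrite gt_eqF.
    rewrite normrM normfV (gtr0_norm k0) ler_pdivrMr//.
    apply: le_trans (WD z) _.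
    have -> : e * (e * d) * (1 + z ^+ 2) * k =
      K * (1 + v) * e ^+ 2 * (1 + z ^+ 2) * (k / m).
      by rewrite /d; field; rewrite gt_eqF.
    apply: ler_peMr; last by rewrite ler_pdivlMr// mul1r.
    by rewrite mulr_ge0 ?addr_ge0// mulr_ge0 ?exprn_ge0// mulr_ge0// addr_ge0.
  have E2 : `|e * DW x0 / k * z| <= e * d * (1 + z ^+ 2).
    have h : `|e * DW x0 / k| <= e * d.
      rewrite !normrM normfV (gtr0_norm k0) (ger0_norm e0) -[leLHS]mulrA.
      rewrite ler_wpM2l//; apply: le_trans KdM.
      by rewrite ler_pM ?invr_ge0 ?(ltW k0)// lef_pV2 ?posrE.
    by rewrite normrM ler_pM.
  split=> //.
  - by rewrite ltrBrDr addNr.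
  - exact: norm_sub1.
  - rewrite -[X in `|X|](subrK (e * DW x0 / k * z)).
    apply: le_trans (ler_normD _ _) _.
    have E3 : e * (e * d) * (1 + z ^+ 2) <= e * d * (1 + z ^+ 2).
      by rewrite -mulrA ler_piMl// mulr_ge0// addr_ge0.
    rewrite (_ : 2 * _ * _ = e * d * (1 + z ^+ 2) + e * d * (1 + z ^+ 2)).
      exact: lerD (le_trans E1 E3) E2.
    ring.
have HS := fluct (fun z => U (x + e * z)) u S D x u0 mu (DK x)
  (fun z => UmM _) uM (UD e x) (fun=> erefl).
have HT := fluct (fun z => V (y + e * z)) w T D' y w0 mw (DK' y)
  (fun z => VmM _) wM (VD e y) (fun=> erefl).
pose A := a * (1 - a) / 2; pose B := b * (1 - b) / 2.
(* The second order bound is the sum of f1 at the first variable, f2 at the second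
   one, and the cross term a b p q z t. *)
pose f1 z := 1 + a * S z - A * p ^+ 2 * z ^+ 2 + L * e ^+ 3 * (1 + z ^+ 2) ^+ 3.
pose f2 z := b * T z - B * q ^+ 2 * z ^+ 2 + L * e ^+ 3 * (1 + z ^+ 2) ^+ 3.
pose G := u `^ a * w `^ b.
have G0 : 0 <= G by rewrite mulr_ge0// powR_ge0.
have S0 : \int[nu]_z S z = 0.
  rewrite (@eq_Rint _ _ _ nu _ (fun z => u^-1 * (U (x + e * z) - u))).
    rewrite RintZ ?(@Rint_heatB U e x M) ?mulr0//.
      by move=> z; exact: range_norm (ltW m0) _.
    apply: l1B; last exact: l1_prob_cst.
    by apply: (@l1_heat U e x M) => // z; exact: range_norm (ltW m0) _.
  by move=> z; rewrite /S; field; rewrite gt_eqF.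
have T0 : \int[nu]_z T z = 0.
  rewrite (@eq_Rint _ _ _ nu _ (fun z => w^-1 * (V (y + e * z) - w))).
    rewrite RintZ ?(@Rint_heatB V e y M) ?mulr0//.
      by move=> z; exact: range_norm (ltW m0) _.
    apply: l1B; last exact: l1_prob_cst.
    by apply: (@l1_heat V e y M) => // z; exact: range_norm (ltW m0) _.
  by move=> z; rewrite /T; field; rewrite gt_eqF.
have lS : l1 nu S.
  apply: (@l1_bounded _ _ _ (M / m)).
    apply: measurable_funB => //; apply: measurable_funM => //.
    exact: measurable_affine_comp.
  by move=> z; have [] := HS z.
have lT : l1 nu T.
  apply: (@l1_bounded _ _ _ (M / m)).
    apply: measurable_funB => //; apply: measurable_funM => //.
    exact: measurable_affine_comp.
  by move=> z; have [] := HT z.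
have lsq : l1 nu (fun z => z ^+ 2) by exact: l1_sqr.
have l6 : l1 nu (fun z => (1 + z ^+ 2) ^+ 3) by exact: l1_poly6.
have lc k : l1 nu (fun=> k) by exact: l1_prob_cst.
have laS := l1Z a lS; have lbT := l1Z b lT.
have lAp := l1Z (A * p ^+ 2) lsq; have lBq := l1Z (B * q ^+ 2) lsq.
have lL6 := l1Z (L * e ^+ 3) l6.
have l11 := l1D (lc 1) laS; have l12 := l1B l11 lAp; have l1f1 := l1D l12 lL6.
have l21 := l1B lbT lBq; have l1f2 := l1D l21 lL6.
have If1 : \int[nu]_z f1 z = 1 - A * p ^+ 2 * v + L * e ^+ 3 * m6.
  rewrite /f1 (RintD l12 lL6) (RintB l11 lAp) (RintD (lc 1) laS).
  by rewrite Rint_prob_cst (RintZ a lS) (RintZ _ lsq) (RintZ _ l6) S0 mulr0 addr0.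
have If2 : \int[nu]_z f2 z = - (B * q ^+ 2 * v) + L * e ^+ 3 * m6.
  rewrite /f2 (RintD l21 lL6) (RintB lbT lBq).
  by rewrite (RintZ b lT) (RintZ _ lsq) (RintZ _ l6) T0 mulr0 add0r.
have powR_ub (W : R -> R) (k : R) : 0 < k -> (forall z, m <= W z <= M) ->
    forall z, `|W z `^ k| <= M `^ k.
  move=> k0 WmM z; have /andP[mW WM] := WmM z.
  rewrite ger0_norm ?powR_ge0// ge0_ler_powR ?(ltW k0)// nnegrE.
    by rewrite (le_trans (ltW m0)).
  by rewrite (le_trans (ltW m0)).
have mpow (W : R -> R) (k x0 : R) : measurable_fun [set: R] W ->
    measurable_fun [set: R] (fun z => W (x0 + e * z) `^ k).
  move=> mW.
  apply: (@measurableT_comp _ _ _ _ _ _ (fun t : R => t `^ k) _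
    (fun z : R => W (x0 + e * z))).
    exact: measurable_powR.
  exact: measurable_affine_comp.
have := @pair_le (fun z => U (x + e * z) `^ a) (fun z => V (y + e * z) `^ b)
  (fun z => G * f1 z) (fun z => G * f2 z) (G * (a * b * p * q)) (M `^ a) (M `^ b)
  (mpow _ _ _ mU) (mpow _ _ _ mV).
have FU z : `|U (x + e * z) `^ a| <= M `^ a.
  by apply: (powR_ub (fun z => U (x + e * z))).
have FV z : `|V (y + e * z) `^ b| <= M `^ b.
  by apply: (powR_ub (fun z => V (y + e * z))).
move=> /(_ FU FV (l1Z G l1f1) (l1Z G l1f2)) main.
apply: (le_trans (main _)) => {main}.
  move=> z t.
  have [S1 SM SX p1 Sp] := HS z; have [T1 TM TX q1 Tq] := HT t.
  have -> : U (x + e * z) `^ a = u `^ a * (1 + S z) `^ a.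
    rewrite -powRM ?(ltW u0)//; last by rewrite ltW// -ltrBlDl sub0r.
    by congr (_ `^ _); rewrite /S; field; rewrite gt_eqF.
  have -> : V (y + e * t) `^ b = w `^ b * (1 + T t) `^ b.
    rewrite -powRM ?(ltW w0)//; last by rewrite ltW// -ltrBlDl sub0r.
    by congr (_ `^ _); rewrite /T; field; rewrite gt_eqF.
  rewrite mulrACA -mulrDr -[G * _ * (z * t)]mulrA -mulrDr.
  rewrite ler_wpM2l// ?mulr_ge0 ?powR_ge0//.
  apply: le_trans (taylor _ _ S1 T1 SM TM) _.
  have z20 := sqr_ge0 z; have t20 := sqr_ge0 t.
  have X0 : 0 <= 1 + z ^+ 2 by rewrite addr_ge0.
  have Y0 : 0 <= 1 + t ^+ 2 by rewrite addr_ge0.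
  have X1 : 1 <= 1 + z ^+ 2 by rewrite lerDl.
  have Y1 : 1 <= 1 + t ^+ 2 by rewrite lerDl.
  have ed0 : 0 <= e * d by exact: mulr_ge0.
  have := quadratic_perturbation A01 B01 ab01 ed0 X0 Y0 SX TX p1 q1 Sp Tq e0.
  have S3 : C0 * `|S z| ^+ 3 <= C0 * (8 * d ^+ 3) * (e ^+ 3 * (1 + z ^+ 2) ^+ 3).
    rewrite -mulrA ler_wpM2l//.
    have -> : 8 * d ^+ 3 * (e ^+ 3 * (1 + z ^+ 2) ^+ 3) =
      (2 * (e * d) * (1 + z ^+ 2)) ^+ 3 by ring.
    by rewrite lerXn2r ?nnegrE// (le_trans _ SX).
  have T3 : C0 * `|T t| ^+ 3 <= C0 * (8 * d ^+ 3) * (e ^+ 3 * (1 + t ^+ 2) ^+ 3).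
    rewrite -mulrA ler_wpM2l//.
    have -> : 8 * d ^+ 3 * (e ^+ 3 * (1 + t ^+ 2) ^+ 3) =
      (2 * (e * d) * (1 + t ^+ 2)) ^+ 3 by ring.
    by rewrite lerXn2r ?nnegrE// (le_trans _ TX).
  have X23 : 6 * e * (e * d) ^+ 2 * ((1 + z ^+ 2) ^+ 2 + (1 + t ^+ 2) ^+ 2) <=
      6 * d ^+ 2 * (e ^+ 3 * (1 + z ^+ 2) ^+ 3) +
      6 * d ^+ 2 * (e ^+ 3 * (1 + t ^+ 2) ^+ 3).
    rewrite -mulrDr -mulrDr.
    have -> : 6 * e * (e * d) ^+ 2 * ((1 + z ^+ 2) ^+ 2 + (1 + t ^+ 2) ^+ 2) =
      6 * d ^+ 2 * (e ^+ 3 * ((1 + z ^+ 2) ^+ 2 + (1 + t ^+ 2) ^+ 2)) by ring.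
    apply: ler_wpM2l; first by apply: mulr_ge0 => //; exact: sqr_ge0.
    apply: ler_wpM2l; first exact: exprn_ge0.
    by rewrite lerD// [leRHS]exprS ler_peMl// sqr_ge0.
  rewrite /f1 /f2 -/A -/B => h.
  have -> : 1 + a * S z - A * p ^+ 2 * z ^+ 2 + L * e ^+ 3 * (1 + z ^+ 2) ^+ 3 +
      (b * T t - B * q ^+ 2 * t ^+ 2 + L * e ^+ 3 * (1 + t ^+ 2) ^+ 3) +
      a * b * p * q * (z * t) =
    1 + a * S z + b * T t + (a * b * (p * z * (q * t)) - A * (p * z) ^+ 2
      - B * (q * t) ^+ 2 +
     (6 * d ^+ 2 * (e ^+ 3 * (1 + z ^+ 2) ^+ 3) +
      6 * d ^+ 2 * (e ^+ 3 * (1 + t ^+ 2) ^+ 3))) +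
     (C0 * (8 * d ^+ 3) * (e ^+ 3 * (1 + z ^+ 2) ^+ 3) +
      C0 * (8 * d ^+ 3) * (e ^+ 3 * (1 + t ^+ 2) ^+ 3)) by rewrite /L; ring.
  apply: lerD; last by rewrite mulrDr; exact: lerD.
  by rewrite lerD2l; apply: (le_trans h); rewrite lerD2l.
rewrite (RintZ G l1f1) (RintZ G l1f2) If1 If2.
have -> : G * (1 - A * p ^+ 2 * v + L * e ^+ 3 * m6) +
    G * (- (B * q ^+ 2 * v) + L * e ^+ 3 * m6) + G * (a * b * p * q) * (r * v) =
  G + G * v * (a * b * (r * (p * q)) - A * p ^+ 2 - B * q ^+ 2) +
  G * (2 * L * m6 * e ^+ 3) by ring.
apply: lerD.
  rewrite -[leRHS]addr0 lerD2l; apply: mulr_ge0_le0; first exact: mulr_ge0.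
  exact: correlated_concave.
rewrite -[leRHS]mulrA ler_wpM2r// ?mulr_ge0 ?exprn_ge0//.
apply: ler_pM; rewrite ?powR_ge0// ge0_ler_powR ?nnegrE ?(ltW a0) ?(ltW b0)//.
- exact: ltW.
- by rewrite (le_trans (ltW m0)).
- exact: ltW.
- by rewrite (le_trans (ltW m0)).
Qed.

End one_step.

End correlated_pair.

(** * Doubling the size of the step *)

Section interpolation.
Context {R : realType}.
Variables (s r : R).
Hypothesis s_gt0 : 0 < s.
Hypothesis r_gt0 : 0 < r.
Hypothesis r_lt1 : r < 1.

Let nu : probability (measurableTypeR R) R := normal_prob 0 s.
Local Notation c := (Num.sqrt (1 - r ^+ 2)).
Local Notation gop := (gop s r).
Local Notation heat := (heat s).
Local Notation q := (Num.sqrt (2 : R)).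

Lemma Rint_Fubini_bounded (F : R -> R -> R) M :
  measurable_fun [set: R * R] (fun z => F z.1 z.2) ->
  (forall x y, `|F x y| <= M) ->
  \int[nu]_x \int[nu]_y F x y = \int[nu]_y \int[nu]_x F x y.
Proof.
move=> mF FM; have mFx x := measurable_section x mF.
have mFy y : measurable_fun [set: R] (F ^~ y).
  apply: (measurableT_comp mF (g := fun x => (x, y))).
  by apply: measurable_fun_pair; [exact: measurable_id|exact: measurable_cst].
have mN : measurable_fun [set: R * R] (fun z => `|F z.1 z.2|).
  exact: measurableT_comp.
apply: (@Rint_Fubini _ _ _ _ _ nu nu F mF).
- by move=> x; apply: (@l1_bounded _ _ _ M).
- by move=> y; apply: (@l1_bounded _ _ _ M).
apply: (@l1_bounded _ _ _ M).
  exact: (@measurable_Rint _ _ _ _ _ nu (fun x y => `|F x y|) mN).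
move=> x; rewrite ger0_norm; last exact: Rint_ge0.
rewrite -[leRHS](Rint_prob_cst s); apply: le_Rint => //; last exact: l1_prob_cst.
by apply: l1_norm; apply: (@l1_bounded _ _ _ M).
Qed.

(** Stability of the Gaussian law under sums of independent copies, which is its
invariance for the correlation 1 / sqrt 2. *)
Lemma heat_heat (U : R -> R) e x M : measurable_fun [set: R] U ->
  (forall x, `|U x| <= M) -> heat e (heat e U) x = heat (q * e) U x.
Proof.
move=> mU UM.
have q0 : 0 < q by rewrite sqrtr_gt0.
have q2 : q ^+ 2 = 2 by rewrite sqr_sqrtr.
have q1 : 1 < q.
  by rewrite -(ltr_pXn2r (_ : (0 < 2)%N)) ?nnegrE ?ltW// q2 expr1n; lra.
have r0 : 0 < q^-1 by rewrite invr_gt0.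
have r1 : q^-1 < 1 by rewrite invf_lt1.
have cq : Num.sqrt (1 - q^-1 ^+ 2) = q^-1.
  rewrite -[RHS]ger0_norm ?ltW// -sqrtr_sqr; congr Num.sqrt.
  by rewrite exprVn q2; field.
have lU := l1_heat s (q * e) x mU UM.
apply: etrans (Rint_gop s_gt0 r0 r1 lU).
apply: eq_Rint => y; rewrite /heat /gop; apply: eq_Rint => z.
by rewrite cq; congr U; field; rewrite gt_eqF.
Qed.

(** The mean of F(x + e xi) H(y + e eta), where xi and eta have correlation r. *)
Definition corr (F H : R -> R) (e x y : R) :=
  \int[nu]_z (H (y + e * z) * gop (fun t => F (x + e * t)) z).

Lemma gop_heat (F : R -> R) e x z :
  gop (fun t => F (x + e * t)) z = heat (e * c) F (x + e * r * z).
Proof. by apply: eq_Rint => t; congr F; ring. Qed.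

Lemma corrE (F H : R -> R) e x y : corr F H e x y =
  \int[nu]_z (H (y + e * z) * heat (e * c) F (x + e * r * z)).
Proof. by apply: eq_Rint => z; rewrite gop_heat. Qed.

Lemma heat_norm (U : R -> R) e x M : measurable_fun [set: R] U ->
  (forall x, `|U x| <= M) -> `|heat e U x| <= M.
Proof.
move=> mU UM; have lU := l1_heat s e x mU UM.
apply: le_trans (le_norm_Rint lU) _.
rewrite -[leRHS](Rint_prob_cst s); apply: le_Rint => //; last exact: l1_prob_cst.
exact: l1_norm.
Qed.

Section bounded_functions.
Variables (F H : R -> R) (MF MH : R).
Hypothesis mF : measurable_fun [set: R] F.
Hypothesis mH : measurable_fun [set: R] H.
Hypothesis FM : forall x, `|F x| <= MF.
Hypothesis HM : forall x, `|H x| <= MH.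

Let measurable_affine2 (f : R -> R) (a k1 k2 : R) : measurable_fun [set: R] f ->
  measurable_fun [set: R * R] (fun p => f (a + k1 * p.1 + k2 * p.2)).
Proof.
move=> mf; apply: (measurableT_comp mf
  (g := fun p : R * R => a + k1 * p.1 + k2 * p.2)).
apply: measurable_funD; last exact: measurable_funM.
by apply: measurable_funD => //; exact: measurable_funM.
Qed.

Lemma corr_norm e x y : `|corr F H e x y| <= MH * MF.
Proof.
have mh := measurable_heat s (e * c) mF.
have l : l1 nu (fun z => H (y + e * z) * heat (e * c) F (x + e * r * z)).
  apply: (@l1_bounded _ _ _ (MH * MF)).
    by apply: measurable_funM; exact: measurable_affine_comp.
  by move=> z; rewrite normrM ler_pM// heat_norm.
rewrite corrE; apply: le_trans (le_norm_Rint l) _.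
rewrite -[leRHS](Rint_prob_cst s); apply: le_Rint.
- exact: l1_norm.
- exact: l1_prob_cst.
- by move=> z; rewrite normrM ler_pM// heat_norm.
Qed.

Lemma measurable_corr e :
  measurable_fun [set: R * R] (fun p => corr F H e p.1 p.2).
Proof.
have mh := measurable_heat s (e * c) mF.
rewrite (_ : (fun p => _) = (fun p : R * R => \int[nu]_z
    (H (p.2 + e * z) * heat (e * c) F (p.1 + e * r * z)))); last first.
  by apply/funext => p; rewrite corrE.
apply: (@measurable_Rint _ _ _ _ _ nu (fun (p : R * R) z =>
  H (p.2 + e * z) * heat (e * c) F (p.1 + e * r * z))).
apply: measurable_funM.
- apply: (measurableT_comp mH (g := fun w : R * R * R => w.1.2 + e * w.2)).
  apply: measurable_funD; last exact: measurable_funM.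
  by apply: (measurableT_comp measurable_snd).
- apply: (measurableT_comp mh (g := fun w : R * R * R => w.1.1 + e * r * w.2)).
  apply: measurable_funD; last exact: measurable_funM.
  by apply: (measurableT_comp measurable_fst).
Qed.

(** A Gaussian increment of size sqrt 2 e is the sum of two independent ones of
size e, in both components of the correlated pair. *)
Lemma corr_double e x y : corr F H (q * e) x y =
  \int[nu]_u \int[nu]_v corr F H e (x + e * (r * u + c * v)) (y + e * u).
Proof.
pose P := heat (e * c) F.
have mP : measurable_fun [set: R] P by exact: measurable_heat.
have PM z : `|P z| <= MF by exact: heat_norm.
have mPP := measurable_heat s (e * c) mP.
have PPM z : `|heat (e * c) P z| <= MF by exact: heat_norm.
pose G u := H (y + u) * heat (e * c) P (x + r * u).
have mG : measurable_fun [set: R] G.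
  apply: measurable_funM; last exact: measurable_affine_comp.
  by rewrite (_ : (fun x => _) = (fun u => H (y + 1 * u)));
    [exact: measurable_affine_comp|apply/funext => u; rewrite mul1r].
have GM u : `|G u| <= MH * MF by rewrite normrM ler_pM.
rewrite corrE.
transitivity (heat (q * e) G 0).
  apply: eq_Rint => z; rewrite add0r /G; congr (H _ * _).
  by rewrite -[q * e * c]mulrA -(heat_heat (e * c) _ mF FM); congr (heat _ _ _); ring.
rewrite -(heat_heat e 0 mG GM).
apply: eq_Rint => u; rewrite add0r.
transitivity (\int[nu]_w \int[nu]_v
    (H (y + e * u + e * w) * P (x + e * (r * u + c * v) + e * r * w))).
  apply: eq_Rint => w; rewrite /G RintZ.
    congr (H _ * _); first by ring.
    by apply: eq_Rint => v; congr P; ring.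
  rewrite (_ : (fun v => _) = (fun v => P ((x + e * r * u + e * r * w) + (e * c) * v))).
    exact: (l1_heat s (e * c) _ mP PM).
  by apply/funext => v; congr P; ring.
rewrite (@Rint_Fubini_bounded (fun w v => H (y + e * u + e * w) *
  P (x + e * (r * u + c * v) + e * r * w)) (MH * MF)).
- by apply: eq_Rint => v; rewrite corrE.
- apply: measurable_funM.
    rewrite (_ : (fun p => _) = (fun p : R * R =>
      H ((y + e * u) + e * p.1 + 0 * p.2))); first exact: measurable_affine2.
    by apply/funext => p; rewrite mul0r addr0.
  rewrite (_ : (fun p => _) = (fun p : R * R =>
    P ((x + e * r * u) + (e * r) * p.1 + (e * c) * p.2))).
    exact: measurable_affine2.
  by apply/funext => p; congr P; ring.
- by move=> w v; rewrite normrM ler_pM.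
Qed.

End bounded_functions.

Section iteration.
Variables (a b m M K : R).
Hypothesis a01 : 0 < a < 1.
Hypothesis b01 : 0 < b < 1.
Hypothesis m_gt0 : 0 < m.

Local Notation regular := (regular m M K).
Local Notation pow U k := (fun x => U x `^ k).

Let regular_powR (U : R -> R) k : 0 < k -> regular U ->
  measurable_fun [set: R] (pow U k) /\ (forall x, `|U x `^ k| <= M `^ k).
Proof.
move=> k0 [mU UmM _]; split.
  apply: (@measurableT_comp _ _ _ _ _ _ (fun t : R => t `^ k) _ U).
    exact: measurable_powR.
  exact: mU.
move=> x; have /andP[mx xM] := UmM x.
rewrite ger0_norm ?powR_ge0// ge0_ler_powR ?(ltW k0)// nnegrE.
  by rewrite (le_trans (ltW m_gt0)).
by rewrite (le_trans (ltW m_gt0)) // (le_trans mx).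
Qed.

Definition step_bound e E := forall U V x y, regular U -> regular V ->
  corr (pow U a) (pow V b) e x y <= heat e U x `^ a * heat e V y `^ b + E.

(** The inequality is used twice: for each pair of values of the first increment,
and for the averages of U and V over the second one, which are regular with the
same constants. *)
Lemma step_bound_double e E : step_bound e E -> step_bound (q * e) (E + E).
Proof.
move=> h U V x y rU rV.
have /andP[a0 _] := a01; have /andP[b0 _] := b01.
have [mU UM] := regular_powR a0 rU; have [mV VM] := regular_powR b0 rV.
have rhU := regular_heat s e (ltW m_gt0) rU.
have rhV := regular_heat s e (ltW m_gt0) rV.
have [mhU hUM] := regular_powR a0 rhU; have [mhV hVM] := regular_powR b0 rhV.
have UMM z : `|U z| <= M by have [_ + _] := rU => /(_ z); exact: range_norm (ltW _).
have VMM z : `|V z| <= M by have [_ + _] := rV => /(_ z); exact: range_norm (ltW _).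
have [mU0 _ _] := rU; have [mV0 _ _] := rV.
rewrite (corr_double mU mV UM VM) -(heat_heat e x mU0 UMM) -(heat_heat e y mV0 VMM).
(* The averages of U and V satisfy the bound too; what remains is to integrate the
   bound for U and V at fixed values of the other increment. *)
apply: (@le_trans _ _ (corr (pow (heat e U) a) (pow (heat e V) b) e x y + E)); last first.
  by rewrite addrA lerD2r; exact: h.
have mcorr : measurable_fun [set: R * R] (fun p => corr (pow U a) (pow V b) e
    (x + e * (r * p.1 + c * p.2)) (y + e * p.1)).
  apply: (measurableT_comp (measurable_corr mU mV e)
    (g := fun p : R * R => (x + e * (r * p.1 + c * p.2), y + e * p.1))).
  apply: measurable_fun_pair => /=.
    apply: measurable_funD => //; apply: measurable_funM => //.
    by apply: measurable_funD; exact: measurable_funM.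
  by apply: measurable_funD => //; exact: measurable_funM.
have lcorr u : l1 nu (fun v => corr (pow U a) (pow V b) e
    (x + e * (r * u + c * v)) (y + e * u)).
  apply: (@l1_bounded _ _ _ (M `^ b * M `^ a)).
    exact: (measurable_section u (F := fun u v => corr (pow U a) (pow V b) e
      (x + e * (r * u + c * v)) (y + e * u)) mcorr).
  by move=> v; exact: corr_norm.
have lheat u : l1 nu (fun v => heat e U (x + e * (r * u + c * v)) `^ a).
  apply: (@l1_bounded _ _ _ (M `^ a)) => [|v]; last exact: hUM.
  rewrite (_ : (fun v => _) = (fun v => pow (heat e U) a ((x + e * (r * u)) + (e * c) * v))).
    exact: (measurable_affine_comp (x + e * (r * u)) (e * c) mhU).
  by apply/funext => v; congr (heat _ _ _ `^ _); ring.
have lcE k : l1 nu (fun=> k) by exact: l1_prob_cst.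
pose G u := heat e V (y + e * u) `^ b * gop (fun t => heat e U (x + e * t) `^ a) u.
have lG : l1 nu G.
  rewrite (_ : G = (fun u => (pow (heat e V) b) (y + e * u) *
     heat (e * c) (pow (heat e U) a) (x + e * r * u))); last first.
    by apply/funext => u; rewrite -gop_heat.
  apply: (@l1_bounded _ _ _ (M `^ b * M `^ a)) => [|u].
    apply: measurable_funM; first exact: (measurable_affine_comp y e mhV).
    exact: (measurable_affine_comp x (e * r) (measurable_heat s (e * c) mhU)).
  rewrite normrM; apply: ler_pM; [exact: normr_ge0|exact: normr_ge0|exact: hVM|].
  exact: (heat_norm (e * c) _ mhU hUM).
rewrite /corr -/G -(Rint_prob_cst s E) -(RintD lG (lcE E)).
apply: le_Rint => [||u].
- apply: (@l1_bounded _ _ _ (M `^ b * M `^ a)).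
    exact: (@measurable_Rint _ _ _ _ _ nu (fun u v => corr (pow U a) (pow V b) e
      (x + e * (r * u + c * v)) (y + e * u)) mcorr).
  move=> u; apply: le_trans (le_norm_Rint (lcorr u)) _.
  rewrite -[leRHS](Rint_prob_cst s); apply: le_Rint => //; first exact: l1_norm.
  by move=> v; exact: corr_norm.
- exact: l1D.
- have lh := l1Z (heat e V (y + e * u) `^ b) (lheat u).
  rewrite (_ : G u + E = \int[nu]_v (heat e V (y + e * u) `^ b *
      heat e U (x + e * (r * u + c * v)) `^ a + E)); last first.
    by rewrite (RintD lh (lcE E)) (RintZ _ (lheat u)) Rint_prob_cst.
  apply: le_Rint (lcorr u) (l1D lh (lcE E)) _ => v.
  by rewrite [_ `^ b * _]mulrC; exact: h.
Qed.

Lemma step_bound_iter e E n : step_bound e E ->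
  step_bound (q ^+ n * e) (2 ^+ n * E).
Proof.
move=> h; elim: n => [|n IH]; first by rewrite !expr0 !mul1r.
have := step_bound_double IH; rewrite mulrA -exprS (_ : _ + _ = 2 ^+ n.+1 * E)//.
by rewrite exprS; ring.
Qed.

End iteration.

(** n doublings of a step of size 2^(-n/2) multiply its error, of order
2^(-3n/2), by 2^n. *)
Lemma correlated_product a b m M K U V : 0 < a < 1 -> 0 < b < 1 ->
  r ^+ 2 * (a * b) <= (1 - a) * (1 - b) -> 0 < m -> 0 <= K ->
  regular m M K U -> regular m M K V ->
  \int[nu]_z (V z `^ b * gop (fun t => U t `^ a) z) <=
  (\int[nu]_z U z) `^ a * (\int[nu]_z V z) `^ b.
Proof.
move=> a01 b01 abr m0 K0 rU rV.
have mM : m <= M by have [_ + _] := rU => /(_ 0)/andP[]; exact: le_trans.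
have [C C0 H] := one_step s_gt0 r_gt0 r_lt1 a01 b01 abr m0 mM K0.
have q0 : 0 < q by rewrite sqrtr_gt0.
have q2 : q ^+ 2 = 2 by rewrite sqr_sqrtr.
have q1 : 1 < q.
  by rewrite -(ltr_pXn2r (_ : (0 < 2)%N)) ?nnegrE ?ltW// q2 expr1n; lra.
have bnd n : \int[nu]_z (V z `^ b * gop (fun t => U t `^ a) z) <=
    (\int[nu]_z U z) `^ a * (\int[nu]_z V z) `^ b + C * q^-1 ^+ n.
  have e01 : 0 <= q^-1 ^+ n <= 1.
    rewrite exprn_ge0 ?invr_ge0 ?(ltW q0)//= exprn_ile1// ?invr_ge0 ?(ltW q0)//.
    by rewrite invf_le1// ltW.
  have base : step_bound a b m M K (q^-1 ^+ n) (C * (q^-1 ^+ n) ^+ 3).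
    by move=> U' V' x y rU' rV'; exact: H.
  have := step_bound_iter a01 b01 m0 n base.
  rewrite -exprMn divff ?gt_eqF// expr1n.
  rewrite (_ : 2 ^+ n * (C * _) = C * q^-1 ^+ n); last first.
    have i2 : 2 ^+ n * (q^-1 ^+ n) ^+ 2 = 1 :> R.
      by rewrite -exprM mulnC exprM -exprMn exprVn q2 divff ?expr1n// gt_eqF.
    by rewrite mulrCA [_ ^+ 3]exprSr [2 ^+ n * _]mulrA i2 mul1r.
  move=> /(_ U V 0 0 rU rV); rewrite /corr /heat -/nu.
  have E (f : R -> R) : (fun t => f (0 + 1 * t)) = f.
    by apply/funext => t; rewrite add0r mul1r.
  rewrite (E (fun t => U t `^ a)) (E U) (E V).
  by under eq_Rintegral do rewrite add0r mul1r.
have cv : C * q^-1 ^+ n @[n --> \oo] --> C * 0.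
  apply: cvgM; first exact: cvg_cst.
  apply: cvg_expr; rewrite ger0_norm ?invr_ge0 ?(ltW q0)//.
  by rewrite invf_lt1.
rewrite mulr0 in cv.
rewrite -[leRHS]addr0; apply: (cvgr_to_ge (cvgD (cvg_cst _) cv)).
by apply: nearW => n; exact: bnd.
Qed.

End interpolation.

(** * Mollification by the Cauchy density *)

Section mollifier.
Context {R : realType}.
Local Notation leb := (@lebesgue_measure R).
Implicit Types (f g : R -> R) (a c v x t : R).

(** The Cauchy density is chosen because it dominates the remainder of its own
first order expansion for all increments, large or small. *)
Definition cauchy v : R := pi^-1 * (oneDsqr v)^-1.

Let pi0 : 0 < pi :> R. Proof. exact: pi_gt0. Qed.

Lemma cauchy_ge0 v : 0 <= cauchy v.
Proof. by rewrite mulr_ge0 ?invr_ge0 ?(ltW pi0) ?addr_ge0 ?sqr_ge0. Qed.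

Lemma continuous_cauchy : continuous cauchy.
Proof.
move=> v; apply: (@cvgM _ _ (nbhs v)); first exact: cvg_cst.
exact: (@continuous_oneDsqrV R v).
Qed.

Lemma measurable_cauchy : measurable_fun [set: R] cauchy.
Proof. exact: (continuous_measurable_fun continuous_cauchy). Qed.

(** Minus the derivative of the Cauchy density. *)
Definition dcauchy v : R := 2 * v * (oneDsqr v)^-1 * cauchy v.

Lemma measurable_dcauchy : measurable_fun [set: R] dcauchy.
Proof.
apply: measurable_funM; last exact: measurable_cauchy.
apply: measurable_funM; first exact: measurable_funM.
exact: (continuous_measurable_fun (@continuous_oneDsqrV R)).
Qed.

Lemma dcauchy_le v : `|dcauchy v| <= cauchy v.
Proof.
have a0 : 0 < oneDsqr v by rewrite ltr_pwDl ?sqr_ge0.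
rewrite normrM [X in _ * X]ger0_norm ?cauchy_ge0//.
rewrite ler_piMl ?cauchy_ge0// normrM [X in _ * X]ger0_norm ?invr_ge0 ?(ltW a0)//.
rewrite ler_pdivrMr// mul1r ler_norml /oneDsqr.
by have := sqr_ge0 (v - 1); have := sqr_ge0 (v + 1); move=> ? ?; apply/andP; split; nra.
Qed.

Let quadratic_bound v t : `|3 * v ^+ 2 - 1 + 2 * t * v| <=
  6 * ((1 + v ^+ 2) * (1 + (v + t) ^+ 2)).
Proof.
have := mulr_ge0 (sqr_ge0 v) (sqr_ge0 (v + t)).
have := sqr_ge0 (v + t - v); have := sqr_ge0 (v + t + v); rewrite ler_norml => ? ? ?.
by apply/andP; split; nra.
Qed.

Lemma cauchy_taylor v t :
  `|cauchy (v + t) - cauchy v + t * dcauchy v| <= 6 * t ^+ 2 * cauchy v.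
Proof.
have a0 : 0 < 1 + v ^+ 2 by rewrite ltr_pwDl ?sqr_ge0.
have b0 : 0 < 1 + (v + t) ^+ 2 by rewrite ltr_pwDl ?sqr_ge0.
have ab0 : 0 < (1 + v ^+ 2) * (1 + (v + t) ^+ 2) by exact: mulr_gt0.
(* The remainder is cauchy v times t^2 and a bounded fraction. *)
have -> : cauchy (v + t) - cauchy v + t * dcauchy v =
    t ^+ 2 * ((3 * v ^+ 2 - 1 + 2 * t * v) /
    ((1 + v ^+ 2) * (1 + (v + t) ^+ 2))) * cauchy v.
  by rewrite /dcauchy /cauchy /oneDsqr; move: (pi^-1) => p; field; rewrite !gt_eqF.
rewrite normrM [X in _ * X]ger0_norm ?cauchy_ge0//.
rewrite ler_wpM2r ?cauchy_ge0// normrM ger0_norm ?sqr_ge0// mulrC.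
rewrite ler_wpM2r ?sqr_ge0// normrM [X in _ * X]ger0_norm ?invr_ge0 ?(ltW ab0)//.
by rewrite ler_pdivrMr.
Qed.

Lemma integral_cauchy : (\int[leb]_v (cauchy v)%:E = 1)%E.
Proof.
rewrite (ge0_symfun_integralT cauchy_ge0 continuous_cauchy); last first.
  by move=> v; rewrite /= /cauchy /oneDsqr sqrrN.
rewrite -set_itvcy; under eq_integral do rewrite EFinM.
rewrite ge0_integralZl//=; last 2 first.
- apply/measurable_EFinP; apply: measurable_funTS.
  exact: (continuous_measurable_fun (@continuous_oneDsqrV R)).
- by rewrite lee_fin invr_ge0 ltW.
rewrite (@integral0y_oneDsqr R) -!EFinM; congr EFin.
by move: (pi : R) (gt_eqF pi0) => p p0; field; rewrite p0.
Qed.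

Lemma l1_cauchy_affine c x : 0 < c -> l1 leb (fun v => cauchy (c * v + x)).
Proof.
move=> c0; have m : measurable_fun [set: R] (fun v => cauchy (c * v + x)).
  rewrite (_ : (fun v => _) = (fun v => cauchy (x + c * v))).
    exact: (measurable_affine_comp x c measurable_cauchy).
  by apply/funext => v; rewrite addrC.
rewrite (_ : (fun v => _) = (fun v => c^-1 * (c * cauchy (c * v + x)))); last first.
  by apply/funext => v; rewrite mulKf ?gt_eqF.
apply: l1Z; apply: l1_finP => [|v|].
- exact: measurable_funM.
- by rewrite mulr_ge0 ?cauchy_ge0// ltW.
- rewrite -(ge0_integral_affine x c0 measurable_cauchy cauchy_ge0).
  by rewrite integral_cauchy ltry.
Qed.

Lemma l1_cauchy : l1 leb cauchy.
Proof.
rewrite (_ : cauchy = (fun v => cauchy (1 * v + 0))); first exact: l1_cauchy_affine.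
by apply/funext => v; rewrite mul1r addr0.
Qed.

Lemma Rint_cauchy : \int[leb]_v cauchy v = 1.
Proof. by rewrite /Rintegral integral_cauchy. Qed.

(** Convolution with the Cauchy density of scale 1 / c. The shift b moves its mass
to the right of x, the side from which the functions of interest are
continuous. *)
Definition mollify b c f x := \int[leb]_v (f (x + b + c^-1 * v) * cauchy v).

Section bounded_function.
Variables (f : R -> R) (M b c : R).
Hypothesis mf : measurable_fun [set: R] f.
Hypothesis f0M : forall x, 0 <= f x <= M.
Hypothesis c_gt0 : 0 < c.

Let M_ge0 : 0 <= M.
Proof. by have /andP[] := f0M 0; exact: le_trans. Qed.

Let f_ge0 x : 0 <= f x. Proof. by have /andP[] := f0M x. Qed.

Let fM x : `|f x| <= M.
Proof. exact: range_norm (f0M x). Qed.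

Let mollified x w := c * f (b + w) * cauchy (c * w - c * x).

Let measurable_mollified (psi : R -> R) : measurable_fun [set: R] psi ->
  measurable_fun [set: R * R]
    (fun z => c * f (b + z.2) * psi (c * z.2 - c * z.1)).
Proof.
move=> mpsi; apply: measurable_funM.
  apply: measurable_funM => //.
  apply: (measurableT_comp mf (g := fun z : R * R => b + z.2)).
  exact: measurable_funD.
apply: (measurableT_comp mpsi (g := fun z : R * R => c * z.2 - c * z.1)).
by apply: measurable_funB; exact: measurable_funM.
Qed.

Let Rint_cauchy_affine x : \int[leb]_w (c * cauchy (c * w - c * x)) = 1.
Proof.
rewrite -Rint_cauchy /Rintegral.
by rewrite (ge0_integral_affine (- (c * x)) c_gt0 measurable_cauchy cauchy_ge0).
Qed.

Lemma mollifyE x : mollify b c f x = \int[leb]_w mollified x w.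
Proof.
rewrite /mollify /Rintegral (@ge0_integral_affine _ c (- (c * x)))//.
- congr fine; apply: eq_integral => w _; congr EFin.
  rewrite /mollified mulrA; congr (_ * f _ * _).
  by field; rewrite gt_eqF.
- apply: measurable_funM; last exact: measurable_cauchy.
  exact: (measurable_affine_comp (x + b) c^-1 mf).
- by move=> v; rewrite mulr_ge0 ?cauchy_ge0.
Qed.

Let l1_dominated (F : R -> R) k x : measurable_fun [set: R] F ->
  (forall w, `|F w| <= k * (c * cauchy (c * w - c * x))) ->
  l1 leb F /\ `|\int[leb]_w F w| <= k.
Proof.
move=> mF Fk.
have lc : l1 leb (fun w => k * (c * cauchy (c * w - c * x))).
  by apply: l1Z; apply: l1Z; exact: l1_cauchy_affine.
have lF : l1 leb F by exact: (@l1_le _ _ _ leb _ _ mF lc Fk).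
split=> //; apply: le_trans (le_norm_Rint lF) _.
rewrite -[leRHS]mulr1 -(Rint_cauchy_affine x) -RintZ; last by apply: l1Z; exact: l1_cauchy_affine.
by apply: le_Rint => //; exact: l1_norm.
Qed.

Lemma l1_mollified x : l1 leb (mollified x).
Proof.
apply: (proj1 (@l1_dominated _ M x _ _)).
  exact: (measurable_section x (measurable_mollified measurable_cauchy)).
move=> w; rewrite mulrA [M * c]mulrC normrM (normrM c) (ger0_norm (ltW c_gt0)).
by rewrite (ger0_norm (cauchy_ge0 _)) ler_wpM2r ?cauchy_ge0// ler_wpM2l ?(ltW c_gt0).
Qed.

Lemma mollify_ge0 x : 0 <= mollify b c f x.
Proof. by apply: Rint_ge0 => v; rewrite mulr_ge0 ?cauchy_ge0. Qed.

Lemma mollify_le x : mollify b c f x <= M.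
Proof.
have := l1_mollified x; rewrite mollifyE => l.
apply: le_trans (ler_norm _) _; apply: (proj2 (@l1_dominated _ M x _ _)).
  exact: l1_measurable l.
move=> w; rewrite mulrA [M * c]mulrC normrM (normrM c) (ger0_norm (ltW c_gt0)).
by rewrite (ger0_norm (cauchy_ge0 _)) ler_wpM2r ?cauchy_ge0// ler_wpM2l ?(ltW c_gt0).
Qed.

(** In the form of a convolution, the increments of the mollified function only
involve those of the Cauchy density, so that cauchy_taylor applies whatever the
bounded function is. *)
Lemma regular_mollify m : regular m (M + m)
  (6 * c ^+ 2 * M + c * M) (fun x => mollify b c f x + m).
Proof.
have mm := measurable_mollified.
have c0 := ltW c_gt0.
split.
- apply: measurable_funD => //.
  rewrite (_ : mollify b c f = (fun x => \int[leb]_w mollified x w)); last first.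
    by apply/funext => x; exact: mollifyE.
  exact: (@measurable_Rint _ _ _ _ _ leb _ (mm _ measurable_cauchy)).
- by move=> x; rewrite lerDr mollify_ge0 lerD2r mollify_le.
pose D x w := c * (c * f (b + w) * dcauchy (c * w - c * x)).
have mD : measurable_fun [set: R * R] (fun z => D z.1 z.2).
  by apply: measurable_funM => //; exact: (mm _ measurable_dcauchy).
have mDx x : measurable_fun [set: R] (D x) by exact: measurable_section.
have DM x w : `|D x w| <= c * M * (c * cauchy (c * w - c * x)).
  rewrite /D !(normrM c) normrM (ger0_norm c0) (normrM c) (ger0_norm c0) -!mulrA.
  rewrite ler_wpM2l// [leRHS]mulrCA ler_wpM2l//.
  by apply: ler_pM => //; exact: dcauchy_le.
have lD x := l1_dominated (mDx x) (DM x).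
exists (fun x => \int[leb]_w D x w); split.
- exact: (@measurable_Rint _ _ _ _ _ leb D mD).
- move=> x; apply: le_trans (proj2 (lD x)) _.
  by rewrite lerDr !mulr_ge0// sqr_ge0.
- move=> x t; have [lDx _] := lD x.
  have lU := l1_mollified (x + t); have lV := l1_mollified x.
  rewrite (opprD _ m) addrACA subrr addr0 !mollifyE [_ * t]mulrC -(RintZ t lDx) -(RintB lU lV).
  have lDt := l1Z t lDx; rewrite -(RintB (l1B lU lV) lDt).
  have lR := l1B (l1B lU lV) lDt.
  apply: (le_trans (y := 6 * c ^+ 2 * M * t ^+ 2)); last first.
    by rewrite ler_wpM2r ?sqr_ge0// lerDl mulr_ge0.
  apply: (proj2 (@l1_dominated _ (6 * c ^+ 2 * M * t ^+ 2) x _ _)).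
    exact: l1_measurable lR.
  move=> w; set v := c * w - c * x.
  rewrite (_ : _ - _ = c * f (b + w) * (cauchy (v + - (c * t)) - cauchy v +
      - (c * t) * dcauchy v)); last first.
    rewrite /mollified /D -/v (_ : c * w - c * (x + t) = v + - (c * t)); first by ring.
    by rewrite /v; ring.
  rewrite normrM; have := cauchy_taylor v (- (c * t)); rewrite sqrrN exprMn => ct.
  apply: (le_trans (ler_pM _ _ _ ct) (y := c * M * (6 * (c ^+ 2 * t ^+ 2) * cauchy v))) => //.
    by rewrite normrM (ger0_norm c0) ler_wpM2l.
  by rewrite le_eqVlt; apply/orP; left; apply/eqP; ring.
Qed.

End bounded_function.

Lemma cvg_right_sequence x v :
  x + n.+1%:R^-1 + n.+1%:R ^- 2 * v @[n --> \oo] --> x^'+.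
Proof.
have h0 : n.+1%:R^-1 @[n --> \oo] --> (0 : R) by exact: cvg_harmonic.
have ux : x + n.+1%:R^-1 + n.+1%:R ^- 2 * v @[n --> \oo] --> x.
  rewrite -[X in _ --> X]addr0 -[X in _ --> _ + X](mul0r v) -[X in _ --> X + _]addr0.
  apply: cvgD; first by apply: cvgD => //; exact: cvg_cst.
  apply: cvgM; last exact: cvg_cst.
  rewrite -[X in _ --> X](mulr0 0) (_ : (fun n => _) = (fun n => n.+1%:R^-1 * n.+1%:R^-1)).
    exact: cvgM.
  by apply/funext => n; rewrite -exprVn expr2.
have h1 : n.+1%:R^-1 * `|v| @[n --> \oo] --> (0 : R).
  by rewrite -[X in _ --> X](mul0r `|v|); apply: cvgM => //; exact: cvg_cst.
have ev : \forall n \near \oo, n.+1%:R^-1 * `|v| < 1 by exact: (cvgr_lt _ h1).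
move=> P hP; have := ux _ hP; apply: filterS2 ev => n n1; apply.
rewrite -addrA ltrDl -exprVn expr2 -mulrA -{1}[n.+1%:R^-1]mulr1 -mulrDr.
rewrite mulr_gt0 ?invr_gt0//.
have : - (n.+1%:R^-1 * v) <= n.+1%:R^-1 * `|v|.
  by rewrite -mulrN ler_wpM2l ?invr_ge0// -normrN ler_norm.
by move: n1; set z := _ * _; set z' := _ * _; lra.
Qed.

(** Shifted by e and dilated by e^2, the kernel approaches the evaluation at a
point from the right of it. *)
Lemma mollify_cvg f M x : measurable_fun [set: R] f ->
  (forall x, 0 <= f x <= M) -> f @ x^'+ --> f x ->
  mollify n.+1%:R^-1 (n.+1%:R ^+ 2) f x @[n --> \oo] --> f x.
Proof.
move=> mf f0M fx.
pose F n v := f (x + n.+1%:R^-1 + (n.+1%:R ^+ 2)^-1 * v) * cauchy v.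
have [|||v|_] := @dct_Rint _ _ _ leb F (fun v => f x * cauchy v) (fun v => M * cauchy v).
- move=> n; apply: measurable_funM; last exact: measurable_cauchy.
  exact: (measurable_affine_comp (x + n.+1%:R^-1) (n.+1%:R ^+ 2)^-1 mf).
- by apply: l1Z; exact: l1_cauchy.
- move=> n v; rewrite normrM (ger0_norm (cauchy_ge0 v)) ler_wpM2r ?cauchy_ge0//.
  exact: range_norm (f0M _).
- apply: cvgM; last exact: cvg_cst.
  by move=> P hP; exact: (cvg_right_sequence v (fx P hP)).
rewrite RintZ; last exact: l1_cauchy.
by rewrite Rint_cauchy mulr1.
Qed.

End mollifier.

(** * Hypercontractivity *)

Lemma exponent_condition {R : realType} (t p q : R) : 0 < p -> 0 < q ->
  t * (q - 1) <= p - 1 -> t * (p^-1 * (1 - q^-1)) <= (1 - p^-1) * (1 - (1 - q^-1)).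
Proof.
move=> p0 q0 h; have pq := mulr_gt0 p0 q0.
rewrite -(ler_pM2r pq) (_ : _ * (p * q) = t * (q - 1)); last first.
  by field; rewrite !gt_eqF.
by rewrite (_ : _ * (p * q) = p - 1)//; field; rewrite !gt_eqF.
Qed.

Section hypercontractivity.
Context {R : realType}.
Variables (s r : R).
Hypothesis s_gt0 : 0 < s.
Hypothesis r_gt0 : 0 < r.
Hypothesis r_lt1 : r < 1.

Let nu : probability (measurableTypeR R) R := normal_prob 0 s.
Local Notation gop := (gop s r).
Implicit Types (f U V : R -> R).

Definition smooth U := exists m M K, [/\ 0 < m, 0 <= K & regular m M K U].

Lemma regularW (m m' M M' K K' : R) U : m' <= m -> M <= M' -> K <= K' ->
  regular m M K U -> regular m' M' K' U.
Proof.
move=> mm MM KK [mU UmM [D [mD DK UD]]]; split => //.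
  by move=> x; have /andP[h1 h2] := UmM x; rewrite (le_trans mm)//= (le_trans h2).
exists D; split => // [x|x t]; first exact: le_trans (DK x) KK.
by apply: le_trans (UD x t) _; rewrite ler_wpM2r// sqr_ge0.
Qed.

Lemma smooth_pair U V : smooth U -> smooth V -> exists m M K,
  [/\ 0 < m, 0 <= K, regular m M K U & regular m M K V].
Proof.
move=> [m1 [M1 [K1 [m10 K10 rU]]]] [m2 [M2 [K2 [m20 K20 rV]]]].
exists (Num.min m1 m2), (Num.max M1 M2), (Num.max K1 K2); split.
- by rewrite lt_min m10.
- by rewrite le_max K10.
- by apply: regularW rU; rewrite ?ge_min ?le_max lexx.
- by apply: regularW rV; rewrite ?ge_min ?le_max lexx orbT.
Qed.

(** For large t the bound comes from the bounds on U itself. *)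
Lemma regular_increment (m M K : R) U x t : 0 <= m -> 0 <= K -> regular m M K U ->
  `|U (x + t) - U x| <= (2 * K + M) * `|t|.
Proof.
move=> m0 K0 [_ UmM [D [_ DK UD]]].
have /andP[h1 h2] := UmM x; have /andP[h3 h4] := UmM (x + t).
have M0 : 0 <= M by rewrite (le_trans m0)// (le_trans h1).
have [t1|t1] := lerP `|t| 1.
- have -> : U (x + t) - U x = (U (x + t) - U x - D x * t) + D x * t by rewrite subrK.
  apply: le_trans (ler_normD _ _) _.
  apply: le_trans (lerD (UD x t) (_ : _ <= K * `|t|)) _.
    by rewrite normrM ler_wpM2r.
  rewrite -(@real_normK _ t) ?num_real//.
  have : `|t| ^+ 2 <= `|t| by rewrite expr2 ler_piMl.
  move: (`|t|) (normr_ge0 t) => w w0 ww.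
  have := mulr_ge0 M0 w0; have := ler_wpM2l K0 ww; nra.
- apply: (@le_trans _ _ M).
    by rewrite ler_norml; apply/andP; split; lra.
  have := mulr_ge0 K0 (normr_ge0 t); have := ler_wpM2l M0 (ltW t1).
  by rewrite mulr1 mulrDl -mulrA; lra.
Qed.

(** The product of the increments is quadratic in t by regular_increment. *)
Lemma smoothM U V : smooth U -> smooth V -> smooth (fun x => U x * V x).
Proof.
move=> sU sV; have [m [M [K [m0 K0 rU rV]]]] := smooth_pair sU sV.
have iU x t := regular_increment x t (ltW m0) K0 rU.
have iV x t := regular_increment x t (ltW m0) K0 rV.
have [mU UmM [D [mD DK UD]]] := rU; have [mV VmM [E [mE EK VE]]] := rV.
have mM : m <= M by have /andP[] := UmM 0; exact: le_trans.
have M0 : 0 <= M by rewrite (le_trans (ltW m0)).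
have UM x := range_norm (ltW m0) (UmM x); have VM x := range_norm (ltW m0) (VmM x).
exists (m ^+ 2), (M ^+ 2), (2 * (M * K) + (2 * K + M) ^+ 2); split.
- exact: exprn_gt0.
- by rewrite addr_ge0 ?sqr_ge0// mulr_ge0// mulr_ge0.
split.
- exact: measurable_funM.
- move=> x; have /andP[h1 h2] := UmM x; have /andP[h3 h4] := VmM x.
  by rewrite !expr2 !ler_pM// ?(ltW m0)// (le_trans (ltW m0)).
exists (fun x => V x * D x + U x * E x); split.
- by apply: measurable_funD; exact: measurable_funM.
- move=> x; apply: (@le_trans _ _ (M * K + M * K)); last first.
    by rewrite -mulr2n -[_ *+ 2]mulr_natl lerDl sqr_ge0.
  by apply: le_trans (ler_normD _ _) _; rewrite lerD// normrM ler_pM.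
- move=> x t.
  rewrite (_ : _ - _ = V x * (U (x + t) - U x - D x * t) +
    U x * (V (x + t) - V x - E x * t) + (U (x + t) - U x) * (V (x + t) - V x)); last by ring.
  apply: (@le_trans _ _ (M * (K * t ^+ 2) + M * (K * t ^+ 2) +
      ((2 * K + M) * `|t|) * ((2 * K + M) * `|t|))); last first.
    rewrite mulrACA -expr2 -expr2 real_normK ?num_real//.
    by rewrite le_eqVlt; apply/orP; left; apply/eqP; ring.
  apply: le_trans (ler_normD _ _) _; apply: lerD; last by rewrite normrM ler_pM.
  by apply: le_trans (ler_normD _ _) _; rewrite lerD// normrM ler_pM.
Qed.

Lemma smoothX U n : smooth U -> smooth (fun x => U x ^+ n.+1).
Proof.
move=> sU; elim: n => [|n IH]; first by under eq_fun do rewrite expr1.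
by under eq_fun do rewrite exprS; exact: smoothM.
Qed.

Lemma smooth_gop U : smooth U -> smooth (gop U).
Proof.
move=> [m [M [K [m0 K0 [mU UmM [D [mD DK UD]]]]]]].
have UM x := range_norm (ltW m0) (UmM x).
have lU : l1 nu U := l1_bounded s mU UM; have lD : l1 nu D := l1_bounded s mD DK.
have shift f a := l1_shift s_gt0 r_gt0 r_lt1 (f := f) a.
exists m, M, K; split => //; split.
- exact: (l1_measurable (l1_gop s_gt0 r_gt0 r_lt1 lU)).
- by move=> x; exact: gop_bounds.
exists (fun x => r * gop D x); split.
- apply: measurable_funM => //.
  exact: (l1_measurable (l1_gop s_gt0 r_gt0 r_lt1 lD)).
- move=> x; rewrite normrM ger0_norm ?(ltW r_gt0)//.
  apply: (@le_trans _ _ (r * K)); last by rewrite ler_piMl// ltW.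
  rewrite ler_wpM2l ?(ltW r_gt0)// ler_norml.
  by apply: gop_bounds => // y; rewrite -ler_norml.
- move=> x t; have l1 := shift U (x + t) lU; have l2 := shift U x lU.
  have l3 := l1Z (r * t) (shift D x lD).
  rewrite (_ : r * gop D x * t = r * t * gop D x); last by ring.
  rewrite /gop -(RintZ _ (shift D x lD)) -(RintB l1 l2) -(RintB (l1B l1 l2) l3).
  have l4 := l1B (l1B l1 l2) l3.
  apply: le_trans (le_norm_Rint l4) _.
  rewrite -[leRHS](Rint_prob_cst s (K * t ^+ 2)); apply: le_Rint.
  + exact: l1_norm.
  + exact: l1_prob_cst.
  + move=> z; rewrite mulrDr (addrAC (r * x)).
    rewrite [r * t * _]mulrC; apply: le_trans (UD _ (r * t)) _.
    rewrite ler_wpM2l// exprMn ler_piMl ?sqr_ge0//.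
    by rewrite expr_le1// ltW.
Qed.

Section exponents.
Variables p q : nat.
Hypothesis p_gt1 : (1 < p)%N.
Hypothesis q_gt1 : (1 < q)%N.
Hypothesis pqr : r ^+ 2 * (q%:R - 1) <= p%:R - 1.

(** With U = f^p and V = (Q f)^q, so that U^a = f and V^b = (Q f)^(q - 1), the
left hand side of correlated_product is the integral Z of (Q f)^q, and the
inequality reads Z <= W^(1/p) Z^(1 - 1/q). *)
Lemma hypercontractive_smooth f : smooth f ->
  (\int[nu]_x gop f x ^+ q) ^+ p <= (\int[nu]_x f x ^+ p) ^+ q.
Proof.
move=> sf; have sg := smooth_gop sf.
have [p1 ep] : exists p1, p = p1.+1 by exists p.-1; rewrite prednK// ltnW.
have [q1 eq] : exists q1, q = q1.+1 by exists q.-1; rewrite prednK// ltnW.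
have [m [M [K [m0 K0 rU rV]]]] := smooth_pair (smoothX p1 sf) (smoothX q1 sg).
have f0 x : 0 <= f x.
  have [m' [M' [K' [m'0 _ [_ /(_ x)/andP[+ _] _]]]]] := sf.
  by apply: le_trans; exact: ltW.
have g0 x : 0 <= gop f x by exact: gop_ge0.
have p0 : 0 < p%:R :> R by rewrite ltr0n ltnW.
have q0 : 0 < q%:R :> R by rewrite ltr0n ltnW.
have p1R : 1 < p%:R :> R by rewrite ltr1n.
have q1R : 1 < q%:R :> R by rewrite ltr1n.
have q1E : q1%:R = q%:R - 1 :> R by rewrite eq -addn1 natrD addrK.
set Z := \int[nu]_x (gop f x ^+ q); set W := \int[nu]_x (f x ^+ p).
have Wge0 : 0 <= W by apply: Rint_ge0 => x; exact: exprn_ge0.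
have Zgt0 : 0 < Z.
  have [mV VmM _] := rV; have m0' := ltW m0; apply: lt_le_trans m0 _; rewrite -(Rint_prob_cst s m) /Z eq.
  apply: le_Rint => //; first exact: l1_prob_cst.
    by apply: (@l1_bounded _ _ _ M) => // x; exact: range_norm m0' (VmM x).
  by move=> x; have /andP[] := VmM x.
have main : Z <= W `^ p%:R^-1 * Z `^ (1 - q%:R^-1).
  have a01 : 0 < (p%:R^-1 : R) < 1 by rewrite invr_gt0 p0 invf_lt1.
  have b01 : 0 < (1 - q%:R^-1 : R) < 1.
    by rewrite subr_gt0 invf_lt1// q1R/= ltrBlDr ltrDl invr_gt0.
  have abr := exponent_condition p0 q0 pqr.
  have := correlated_product s_gt0 r_gt0 r_lt1 a01 b01 abr m0 K0 rU rV.
  rewrite -ep -eq -/nu -/W -/Z; apply: le_trans.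
  rewrite /Z le_eqVlt; apply/orP; left; apply/eqP; apply: eq_Rint => z.
  rewrite (expn_powR (m := q1) (g0 z)); last by rewrite q1E; field; rewrite gt_eqF.
  rewrite [in LHS]eq exprSr; congr (_ * gop _ z); apply/funext => t.
  by rewrite (expn_powR (m := 1) (f0 t)) ?expr1// divff// gt_eqF.
have Wpq : (W `^ p%:R^-1) ^+ (p * q) = W ^+ q.
  by rewrite exprM (powR_expn (m := 1)) ?expr1// divff// gt_eqF.
have Zpq : (Z `^ (1 - q%:R^-1)) ^+ (p * q) = Z ^+ (p * q1).
  rewrite mulnC exprM (powR_expn (m := q1)) ?(ltW Zgt0)//.
    by rewrite -exprM mulnC.
  by rewrite q1E; field; rewrite gt_eqF.
have := lerXn2r (p * q) _ _ main.
rewrite !nnegrE mulr_ge0 ?powR_ge0// (ltW Zgt0) => /(_ isT isT).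
rewrite exprMn Wpq Zpq {1}eq mulnS exprD.
by rewrite ler_pM2r// exprn_gt0.
Qed.

Let cvg_RintX (F : nat -> R -> R) (G : R -> R) M n :
  (forall k, measurable_fun [set: R] (F k)) ->
  (forall k x, 0 <= F k x <= M) -> (forall x, F ^~ x @ \oo --> G x) ->
  (\int[nu]_x F k x ^+ n) @[k --> \oo] --> \int[nu]_x G x ^+ n.
Proof.
move=> mF F0M FG.
apply: (proj2 (@dct_Rint _ _ _ nu (fun k x => F k x ^+ n) (fun x => G x ^+ n)
  (fun=> M ^+ n) _ (l1_prob_cst s _) _ _)) => [k|k x|x].
- exact: (measurable_funX n (mF k)).
- have /andP[h1 h2] := F0M k x.
  by rewrite ger0_norm ?exprn_ge0// lerXn2r// nnegrE// (le_trans h1).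
- exact: (cvg_comp _ _ (FG x) (@exprn_continuous _ n (G x))).
Qed.

(** The mollified functions are bounded and converge everywhere, by right
continuity; all the integrals converge by dominated convergence. *)
Lemma hypercontractive_bounded f M : measurable_fun [set: R] f ->
  (forall x, 0 <= f x <= M) -> right_continuous f ->
  (\int[nu]_x gop f x ^+ q) ^+ p <= (\int[nu]_x f x ^+ p) ^+ q.
Proof.
move=> mf f0M fr.
have M0 : 0 <= M by have /andP[] := f0M 0; exact: le_trans.
(* Adding 1 / (n + 1) keeps the mollified functions away from 0. *)
pose F n x := mollify n.+1%:R^-1 (n.+1%:R ^+ 2) f x + n.+1%:R^-1.
have n0 n : 0 < n.+1%:R ^+ 2 :> R by exact: exprn_gt0.
have rF n := regular_mollify n.+1%:R^-1 mf f0M (n0 n) n.+1%:R^-1.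
have mF n : measurable_fun [set: R] (F n) by have [] := rF n.
have FM n x : 0 <= F n x <= M + 1.
  have [_ /(_ x)/andP[h1 h2] _] := rF n; rewrite (le_trans _ h1) ?invr_ge0//=.
  by apply: (le_trans h2); rewrite lerD2l invf_le1// ler1n.
have Ff x : F ^~ x @ \oo --> f x.
  rewrite -[X in _ --> X]addr0; apply: cvgD; first exact: mollify_cvg.
  exact: cvg_harmonic.
have gFM n x : 0 <= gop (F n) x <= M + 1 by exact: gop_bounds.
have mgF n : measurable_fun [set: R] (gop (F n)).
  apply: (l1_measurable (l1_gop s_gt0 r_gt0 r_lt1 _)).
  apply: (@l1_bounded _ _ _ (M + 1)) => // x; exact: range_norm (FM n x).
have gFf x : (gop (F n) x) @[n --> \oo] --> gop f x.
  apply: (proj2 (@dct_Rint _ _ _ nu (fun n y => F n (r * x + Num.sqrt (1 - r ^+ 2) * y))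
    (fun y => f (r * x + Num.sqrt (1 - r ^+ 2) * y)) (fun=> M + 1) _ (l1_prob_cst s _) _ _)).
  - by move=> n; exact: measurable_affine_comp.
  - by move=> n y; exact: range_norm (FM n _).
  - by move=> y; exact: Ff.
have c1 := cvg_RintX (n := q) mgF gFM gFf; have c2 := cvg_RintX (n := p) mF FM Ff.
have c1p := cvg_comp _ _ c1 (@exprn_continuous _ p _).
have c2q := cvg_comp _ _ c2 (@exprn_continuous _ q _).
apply: (ler_cvg_to c1p c2q); apply: nearW => n; apply: hypercontractive_smooth.
do 3 eexists; split; last exact: rF.
  by rewrite invr_gt0.
by rewrite addr_ge0// mulr_ge0// ?mulr_ge0// ltW// n0.
Qed.

(** Nelson's inequality ||Q f||_q <= ||f||_p, raised to the power p q; it follows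
from the case of min(f, n) by Fatou's lemma. *)
Lemma hypercontractive f : l1 nu f -> (forall x, 0 <= f x) ->
  right_continuous f -> l1 nu (fun x => f x ^+ p) ->
  l1 nu (fun x => gop f x ^+ q) /\
  (\int[nu]_x gop f x ^+ q) ^+ p <= (\int[nu]_x f x ^+ p) ^+ q.
Proof.
move=> lf f0 fr lfp; have mf := l1_measurable lf.
pose F (n : nat) x := Num.min (f x) n%:R.
have F0n n x : 0 <= F n x <= n%:R by rewrite le_min f0 ler0n/= ge_min lexx orbT.
have Ff n x : F n x <= f x by rewrite ge_min lexx.
have mF n : measurable_fun [set: R] (F n) by exact: measurable_minr.
have lF n : l1 nu (F n).
  by apply: (@l1_bounded _ _ _ n%:R) => // x; exact: range_norm (F0n n x).
have Fr n x : F n @ x^'+ --> F n x.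
  rewrite /F; under eq_fun do rewrite minr_absE.
  rewrite minr_absE; apply: cvgM; last exact: cvg_cst.
  apply: cvgB; first by apply: cvgD; [exact: fr|exact: cvg_cst].
  by apply: cvg_norm; apply: cvgB; [exact: fr|exact: cvg_cst].
have Fcv x : F ^~ x @ \oo --> f x.
  apply: cvg_near_cst; near=> n; rewrite /F; apply/eqP; rewrite eq_minl; near: n.
  exact: nbhs_infty_ger.
have gF0 n x : 0 <= gop (F n) x by apply: gop_ge0 => y; have /andP[] := F0n n y.
have gF x : (gop (F n) x) @[n --> \oo] --> gop f x.
  apply: (proj2 (@dct_Rint _ _ _ nu (fun n y => F n (r * x + Num.sqrt (1 - r ^+ 2) * y))
    (fun y => f (r * x + Num.sqrt (1 - r ^+ 2) * y))
    (fun y => f (r * x + Num.sqrt (1 - r ^+ 2) * y)) _ _ _ _)).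
  - by move=> n; exact: measurable_affine_comp.
  - exact: (l1_shift s_gt0 r_gt0 r_lt1 x lf).
  - by move=> n y; have /andP[h _] := F0n n (r * x + Num.sqrt (1 - r ^+ 2) * y);
      rewrite ger0_norm.
  - by move=> y; exact: Fcv.
have p0 : (0 < p)%N by exact: ltnW.
set W := \int[nu]_x f x ^+ p.
have W0 : 0 <= W by apply: Rint_ge0 => x; exact: exprn_ge0.
(* A bound of the integrals of (Q (F n))^q themselves, as Fatou's lemma requires. *)
pose B := (W ^+ q) `^ p%:R^-1.
have Bp : B ^+ p = W ^+ q.
  rewrite /B (powR_expn (m := 1)) ?expr1 ?exprn_ge0// divff// gt_eqF// ltr0n//.
have lgF n : l1 nu (fun x => gop (F n) x ^+ q).
  apply: (@l1_bounded _ _ _ (n%:R ^+ q)) => [|x].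
    by apply: measurable_funX; exact: (l1_measurable (l1_gop s_gt0 r_gt0 r_lt1 (lF n))).
  have /andP[h1 h2] := gop_bounds s_gt0 r_gt0 r_lt1 x (mF n) (F0n n).
  by rewrite ger0_norm ?exprn_ge0// lerXn2r// nnegrE.
have ZB n : \int[nu]_x gop (F n) x ^+ q <= B.
  rewrite -(ler_pXn2r p0) ?nnegrE ?powR_ge0//; last first.
    by apply: Rint_ge0 => x; exact: exprn_ge0.
  rewrite Bp; apply: le_trans (hypercontractive_bounded (mF n) (F0n n) (Fr n)) _.
  have F0 x : 0 <= F n x by have /andP[] := F0n n x.
  rewrite lerXn2r ?nnegrE//; first by apply: Rint_ge0 => x; exact: exprn_ge0.
  apply: le_Rint => // [|x]; last by rewrite lerXn2r// nnegrE.
  apply: (@l1_le _ _ _ nu _ _ _ lfp) => [|x]; first exact: (measurable_funX p (mF n)).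
  by rewrite ger0_norm ?exprn_ge0// lerXn2r// nnegrE.
have gXcv x : gop (F n) x ^+ q @[n --> \oo] --> gop f x ^+ q.
  exact: (cvg_comp _ _ (gF x) (@exprn_continuous _ q (gop f x))).
have [lZ hZ] := fatou_Rint lgF (fun n x => exprn_ge0 q (gF0 n x)) gXcv ZB.
split=> //; rewrite -Bp lerXn2r ?nnegrE ?powR_ge0//.
by apply: Rint_ge0 => x; rewrite exprn_ge0// gop_ge0.
Unshelve. all: by end_near. Qed.

End exponents.
End hypercontractivity.

(** * The Mehler kernel is Hilbert-Schmidt *)

Section mehler_Hilbert_Schmidt.
Context {R : realType}.
Variables (s r : R).
Hypothesis s_gt0 : 0 < s.
Hypothesis r_gt0 : 0 < r.
Hypothesis r_lt1 : r < 1.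

Let nu : probability (measurableTypeR R) R := normal_prob 0 s.
Local Notation leb := (@lebesgue_measure R).
Local Notation gop := (gop s r).
Local Notation mehler := (mehler s r).
Local Notation c := (Num.sqrt (1 - r ^+ 2)).

(** The decay rate of the squared Mehler kernel against the Gaussian densities,
after bounding its cross term 2 x y by x^2 + y^2. *)
Definition mehler_rate := (1 - r) / (2 * s ^+ 2 * (1 + r)).
Local Notation rate := mehler_rate.

Lemma mehler_rate_gt0 : 0 < rate.
Proof. by rewrite divr_gt0 ?subr_gt0// !mulr_gt0 ?exprn_gt0// addr_gt0. Qed.

Lemma mehler_sqr_pdf x y : mehler x y ^+ 2 * normal_pdf 0 s y <=
  c^-1 ^+ 2 * normal_peak s * expR (x ^+ 2 / (2 * s ^+ 2) - rate * x ^+ 2) *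
  expR (- rate * y ^+ 2).
Proof.
have c0 : 0 < 1 - r ^+ 2 by rewrite subr_gt0 expr_lt1// ltW.
have s20 : 0 < s ^+ 2 by rewrite exprn_gt0.
have pk : 0 <= normal_peak s by rewrite ltW// normal_peak_gt0// gt_eqF.
rewrite normal_pdf0E// /mehler.
set P := _ / (2 * s ^+ 2 * (1 - r ^+ 2)); set Q := - y ^+ 2 / (2 * s ^+ 2).
rewrite (_ : _ * (_ * expR Q) = c^-1 ^+ 2 * normal_peak s * (expR P ^+ 2 * expR Q)); last by ring.
rewrite -[leRHS]mulrA ler_wpM2l//; first by rewrite mulr_ge0 ?sqr_ge0.
rewrite -expRM_natl -!expRD ler_expR /P /Q /mehler_rate -subr_ge0.
rewrite [X in 0 <= X](_ : _ = r / (s ^+ 2 * (1 - r ^+ 2)) * (x - y) ^+ 2).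
  by rewrite mulr_ge0 ?sqr_ge0// divr_ge0 ?(ltW r_gt0)// mulr_ge0 ?ltW.
have r1 : 1 + r != 0 by rewrite gt_eqF// addr_gt0.
have r2 : 1 - r != 0 by rewrite gt_eqF// subr_gt0.
rewrite (_ : 1 - r ^+ 2 = (1 - r) * (1 + r)); last by ring.
by field; rewrite r1 r2 (gt_eqF s_gt0).
Qed.

Lemma l1_mehler_sqr x : l1 nu (fun y => mehler x y ^+ 2).
Proof.
have m2 := measurable_funX 2 (measurable_mehler1 s r x).
apply: l1_normal => //.
have mpdf : measurable_fun [set: R] (normal_pdf 0 s) by exact: measurable_normal_pdf.
apply: (@l1_le _ _ _ leb _ _ (measurable_funM m2 mpdf)
   (l1Z _ (l1_gauss mehler_rate_gt0))) => y.
rewrite ger0_norm; first exact: mehler_sqr_pdf.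
by rewrite mulr_ge0 ?sqr_ge0 ?normal_pdf_ge0.
Qed.

Definition mehler_diag x := ip nu (mehler x) (mehler x).

Lemma mehler_diag_pdf : exists2 C, 0 <= C &
  forall x, mehler_diag x * normal_pdf 0 s x <= C * expR (- rate * x ^+ 2).
Proof.
pose G := \int[leb]_y expR (- rate * y ^+ 2).
have pk : 0 <= normal_peak s by rewrite ltW// normal_peak_gt0// gt_eqF.
have G0 : 0 <= G by apply: Rint_ge0 => y; exact: expR_ge0.
exists (c^-1 ^+ 2 * normal_peak s * G * normal_peak s).
  by rewrite !mulr_ge0 ?sqr_ge0.
move=> x; have lG := l1_gauss mehler_rate_gt0.
have dG : mehler_diag x <= c^-1 ^+ 2 * normal_peak s *
    expR (x ^+ 2 / (2 * s ^+ 2) - rate * x ^+ 2) * G.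
  rewrite /mehler_diag ipE /Rintegral integral_normal; last first.
    exact: (measurable_funX 2 (measurable_mehler1 s r x)).
  rewrite -/(Rintegral _ _ _) -(RintZ _ lG).
  apply: le_Rint (l1Z _ lG) (mehler_sqr_pdf x).
  have m2 := measurable_funX 2 (measurable_mehler1 s r x).
  have mpdf : measurable_fun [set: R] (normal_pdf 0 s) by exact: measurable_normal_pdf.
  apply: (@l1_le _ _ _ leb _ _ (measurable_funM m2 mpdf) (l1Z _ lG)) => y.
  rewrite ger0_norm; first exact: mehler_sqr_pdf.
  by rewrite mulr_ge0 ?sqr_ge0 ?normal_pdf_ge0.
apply: le_trans (ler_wpM2r (normal_pdf_ge0 _ _ _) dG) _.
rewrite normal_pdf0E//.
rewrite (_ : _ * G * _ = c^-1 ^+ 2 * normal_peak s * G * normal_peak s *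
   (expR (x ^+ 2 / (2 * s ^+ 2) - rate * x ^+ 2) * expR (- x ^+ 2 / (2 * s ^+ 2)))); last by ring.
rewrite -expRD le_eqVlt; apply/orP; left; apply/eqP; congr (_ * expR _).
by ring.
Qed.

Lemma measurable_mehler_diag : measurable_fun [set: R] mehler_diag.
Proof.
apply: (@measurable_Rint _ _ _ _ _ nu (fun x y => mehler x y * mehler x y)).
by apply: measurable_funM; exact: measurable_mehler.
Qed.

Lemma l1_mehler_diag : l1 nu mehler_diag.
Proof.
have [C C0 hC] := mehler_diag_pdf; have md := measurable_mehler_diag.
apply: l1_normal => //.
have mpdf : measurable_fun [set: R] (normal_pdf 0 s) by exact: measurable_normal_pdf.
apply: (@l1_le _ _ _ leb _ _ (measurable_funM md mpdf)
   (l1Z _ (l1_gauss mehler_rate_gt0))) => y.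
rewrite ger0_norm; first exact: hC.
by rewrite mulr_ge0 ?ip_ge0 ?normal_pdf_ge0.
Qed.

Lemma mehler_diag_ge0 x : 0 <= mehler_diag x.
Proof. exact: ip_ge0. Qed.

(** Locally in a, the Mehler kernel is bounded uniformly in the other variable,
and dominated convergence applies. *)
Lemma continuous_gop f : l1 nu f -> continuous (gop f).
Proof.
move=> lf; have mf := l1_measurable lf.
rewrite (_ : gop f = (fun a => \int[nu]_y (mehler a y * f y))); last first.
  by apply/funext => a; rewrite gopE.
move=> x; pose B := c^-1 * expR ((`|x| + 1) ^+ 2 / (2 * s ^+ 2)).
have s20 : 0 < 2 * s ^+ 2 by rewrite mulr_gt0// exprn_gt0.
have B0 : 0 <= B by rewrite mulr_ge0 ?expR_ge0// invr_ge0 sqrtr_ge0.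
apply: (@continuity_under_integral _ _ _ nu (fun a y => mehler a y * f y) setT
  measurableT (x - 1) (x + 1) _ _ (fun y => B * `|f y|)).
- by move=> a _; exact: l1_mehlerM.
- apply: aeW => y _ a _; apply: cvgM; last exact: cvg_cst.
  apply: cvgM; first exact: cvg_cst.
  suff h : - (r ^+ 2 * (z ^+ 2 + y ^+ 2) - 2 * r * z * y) /
      (2 * s ^+ 2 * (1 - r ^+ 2)) @[z --> a] -->
      - (r ^+ 2 * (a ^+ 2 + y ^+ 2) - 2 * r * a * y) / (2 * s ^+ 2 * (1 - r ^+ 2)).
    exact: (cvg_comp _ _ h (@continuous_expR R _)).
  apply: cvgM; last exact: cvg_cst.
  apply: cvgN; apply: cvgB.
    apply: cvgM; first exact: cvg_cst.
    by apply: cvgD; [exact: exprn_continuous|exact: cvg_cst].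
  by apply: cvgM; [apply: cvgM; [exact: cvg_cst|exact: cvg_id]|exact: cvg_cst].
- by apply: l1Z; exact: l1_norm.
- move=> a /= /[!in_itv]/=/andP[a1 a2]; apply: aeW => y _.
  rewrite normrM ler_wpM2r// ger0_norm; last exact: mehler_ge0.
  apply: le_trans (mehler_ub s_gt0 r_gt0 r_lt1 a y) _.
  rewrite ler_wpM2l ?invr_ge0 ?sqrtr_ge0// ler_expR ler_wpM2r ?invr_ge0 ?(ltW s20)//.
  rewrite -(real_normK (num_real a)) lerXn2r ?nnegrE ?addr_ge0//.
  have := ler_norm x; have := ler_norm (- x); rewrite normrN => h1 h2.
  by rewrite ler_norml; apply/andP; split; lra.
- by rewrite inE/= in_itv/=; apply/andP; split; lra.
Qed.

(** Jensen's inequality and invariance of the Gaussian law. *)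
Lemma gop_contraction f : l2 nu f -> l2 nu (gop f) /\ ip nu (gop f) (gop f) <= ip nu f f.
Proof.
move=> lf; have [mf lf2] := lf; have lf1 : l1 nu f.
  have lc : l2 nu (fun=> 1) by split => //; under eq_fun do rewrite expr1n; exact: l1_prob_cst.
  by have := l2_l1M lc lf; under eq_fun do rewrite mul1r.
have lg2 := l1_gop s_gt0 r_gt0 r_lt1 lf2.
have mg := l1_measurable (l1_gop s_gt0 r_gt0 r_lt1 lf1).
have gg a : gop f a ^+ 2 <= gop (fun y => f y ^+ 2) a.
  have la := l1_shift s_gt0 r_gt0 r_lt1 a lf2.
  have lc : l2 nu (fun=> 1) by split => //; under eq_fun do rewrite expr1n; exact: l1_prob_cst.
  have lfa : l2 nu (fun y => f (r * a + c * y)).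
    split; last exact: la.
    exact: measurable_affine_comp.
  have ip1 : ip nu (fun=> 1) (fun=> 1) = 1.
    by rewrite -[RHS](Rint_prob_cst s 1); apply: eq_Rint => y; rewrite mulr1.
  have ipf : ip nu (fun=> 1) (fun y => f (r * a + c * y)) = gop f a.
    by apply: eq_Rint => y; rewrite mul1r.
  by have := cauchy_schwarz lc lfa; rewrite ip1 mul1r ipf ipE.
have lgg : l1 nu (fun x => gop f x ^+ 2).
  apply: (@l1_le _ _ _ nu _ _ (measurable_funX 2 mg) lg2) => x.
  by rewrite ger0_norm ?sqr_ge0.
split; first by split.
rewrite !ipE -(Rint_gop s_gt0 r_gt0 r_lt1 lf2); apply: le_Rint => //.
Qed.

End mehler_Hilbert_Schmidt.

(** * Full support of the Gaussian law *)

Section gaussian_support.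
Context {R : realType}.
Variable s : R.
Hypothesis s_gt0 : 0 < s.
Let nu : probability (measurableTypeR R) R := normal_prob 0 s.
Local Notation leb := (@lebesgue_measure R).

Lemma normal_prob_itv_gt0 (a b : R) : a < b -> (0 < nu `]a, b[%classic)%E.
Proof.
move=> ab; pose B := Num.max `|a| `|b|.
have pB : 0 < normal_pdf 0 s B.
  by rewrite normal_pdf0E// mulr_gt0 ?expR_gt0// normal_peak_gt0// gt_eqF.
apply: (@lt_le_trans _ _ (\int[leb]_(x in `]a, b[%classic) (normal_pdf 0 s B)%:E)%E).
  rewrite integral_cst//= lebesgue_measure_itv/= lte_fin ab -EFinD -EFinM lte_fin.
  by rewrite mulr_gt0// subr_gt0.
apply: ge0_le_integral => //.
- by move=> x _; rewrite lee_fin ltW.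
- by apply/measurable_EFinP; apply: measurable_funTS; exact: measurable_normal_pdf.
move=> x /=; rewrite in_itv/= => /andP[ax xb]; rewrite lee_fin !normal_pdf0E//.
have pk : 0 < normal_peak s by rewrite normal_peak_gt0// gt_eqF.
rewrite ler_pM2l// ler_expR !mulNr lerN2 ler_pM2r ?invr_gt0 ?mulr_gt0 ?exprn_gt0//.
rewrite -(real_normK (num_real x)) lerXn2r ?nnegrE// ?le_max ?normr_ge0//.
have [x0|x0] := lerP 0 x.
- by apply/orP; right; rewrite ger0_norm// (le_trans (ltW xb))// ler_norm.
- by apply/orP; left; rewrite ltr0_norm// -(normrN a) (le_trans _ (ler_norm _))// lerN2 ltW.
Qed.

Lemma ae_point (P : R -> Prop) a b : a < b -> {ae nu, forall x, P x} ->
  exists x, [/\ a < x, x < b & P x].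
Proof.
move=> ab [N [mN N0 PN]]; apply: contrapT => /forallNP h.
have : (nu `]a, b[%classic <= nu N)%E.
  have mab : measurable (`]a, b[%classic : set (measurableTypeR R)) by exact: measurable_itv.
  apply: (@le_measure _ _ _ nu); rewrite ?inE//.
  move=> x /=; rewrite in_itv/= => /andP[ax xb]; apply: PN => /= Px.
  by apply: (h x).
by rewrite N0 leNgt normal_prob_itv_gt0.
Qed.

Lemma Rint_gt0 (F : R -> R) a b : l1 nu F -> (forall x, 0 <= F x) -> a < b ->
  (forall x, a < x -> x < b -> 0 < F x) -> 0 < \int[nu]_x F x.
Proof.
move=> lF F0 ab Fab; rewrite lt_neqAle Rint_ge0// andbT; apply/negP => /eqP F00.
have [x [ax xb Fx]] := ae_point ab (Rint_eq0_ae lF F0 (esym F00)).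
by have := Fab x ax xb; rewrite Fx ?ltxx.
Qed.

Lemma l2_bounded (F : R -> R) M : measurable_fun [set: R] F ->
  (forall x, `|F x| <= M) -> l2 nu F.
Proof.
move=> mF FM; split=> //; apply: (@l1_bounded _ _ _ (M ^+ 2)) => [|x].
  exact: (measurable_funX 2 mF).
by rewrite normrX lerXn2r// nnegrE (le_trans _ (FM x)).
Qed.

Lemma l2_l1 (F : R -> R) : l2 nu F -> l1 nu F.
Proof.
move=> lF; have := l2_l1M (@l2_bounded (cst 1) 1 _ _) lF.
under eq_fun do rewrite mul1r; apply => //.
by move=> x; rewrite normr1.
Qed.

End gaussian_support.

(** * Restriction to half lines *)

Section truncated_kernel.
Context {R : realType}.
Variables (s r D : R).
Hypothesis s_gt0 : 0 < s.
Hypothesis r_gt0 : 0 < r.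
Hypothesis r_lt1 : r < 1.
Hypothesis D_gt0 : 0 < D.

Let nu : probability (measurableTypeR R) R := normal_prob 0 s.
Local Notation leb := (@lebesgue_measure R).
Local Notation gop := (gop s r).
Local Notation mehler := (mehler s r).
Local Notation mehler_diag := (mehler_diag s r).
Implicit Types (h x y : R) (f g : R -> R).

Definition half h : R -> R := \1_(`[h, +oo[%classic).

Lemma halfE h x : half h x = (h <= x)%R%:R.
Proof. by rewrite /half indicE mem_setE in_itv/= andbT. Qed.

Lemma measurable_half h : measurable_fun [set: R] (half h).
Proof. exact: measurable_indic. Qed.

Lemma half_ge0 h x : 0 <= half h x.
Proof. by rewrite halfE. Qed.

Lemma half_le1 h x : half h x <= 1.
Proof. by rewrite halfE; case: (h <= x)%R; rewrite ?ler01. Qed.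

Lemma half_in h x : h <= x -> half h x = 1.
Proof. by rewrite halfE => ->. Qed.

Lemma half_out h x : x < h -> half h x = 0.
Proof. by rewrite halfE leNgt => ->. Qed.

Lemma halfM h h' x : h <= h' -> half h x * half h' x = half h' x.
Proof.
move=> hh; have [xh|hx] := ltP x h'; first by rewrite !(half_out xh) mulr0.
by rewrite half_in ?mul1r// (le_trans hh).
Qed.

Lemma half_sqr h x : half h x ^+ 2 = half h x.
Proof. by rewrite expr2 halfM. Qed.

Lemma l2_half h : l2 nu (half h).
Proof.
apply: (@l2_bounded _ s _ 1) => [|x]; first exact: measurable_half.
by rewrite ger0_norm ?half_ge0// half_le1.
Qed.

Lemma l2_halfM h f : l2 nu f -> l2 nu (fun x => half h x * f x).
Proof.
move=> lf; apply: (l2_le _ (l2_norm lf)).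
  by apply: measurable_funM; [exact: measurable_half|exact: l2_measurable lf].
by move=> x; rewrite normrM ger0_norm ?half_ge0// ler_piMl// half_le1.
Qed.

Definition tker h x y := half h x * half h y * (D * mehler x y).
Local Notation top h := (kop nu (tker h)).

Lemma measurable_tker h : measurable_fun [set: R * R] (fun z => tker h z.1 z.2).
Proof.
apply: measurable_funM.
  by apply: measurable_funM; apply: (measurableT_comp (measurable_half h)).
by apply: measurable_funM => //; exact: measurable_mehler.
Qed.

Lemma tker_ge0 h x y : 0 <= tker h x y.
Proof. by rewrite !mulr_ge0 ?half_ge0 ?(ltW D_gt0)// mehler_ge0. Qed.

Lemma tkerC h x y : tker h x y = tker h y x.
Proof. by rewrite /tker mehlerC [half h x * _]mulrC. Qed.

Lemma tker_gt0 h x y : h <= x -> h <= y -> 0 < tker h x y.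
Proof. by move=> hx hy; rewrite /tker !half_in// !mul1r mulr_gt0// mehler_gt0. Qed.

Lemma tker_out h x y : ~ h <= x -> tker h x y = 0.
Proof. by move/negP; rewrite -ltNge => xh; rewrite /tker half_out// !mul0r. Qed.

Lemma tker_le h x y : tker h x y <= half h x * (D * mehler x y).
Proof.
rewrite /tker -mulrA ler_wpM2l ?half_ge0// ler_piMl ?half_le1//.
by rewrite mulr_ge0 ?mehler_ge0// ltW.
Qed.

Let tker_sqr_le h x y : tker h x y ^+ 2 <= half h x * D ^+ 2 * mehler x y ^+ 2.
Proof.
apply: (@le_trans _ _ ((half h x * (D * mehler x y)) ^+ 2)).
  by rewrite lerXn2r ?nnegrE ?tker_ge0 ?tker_le// (le_trans (tker_ge0 h x y) (tker_le h x y)).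
by rewrite !exprMn half_sqr mulrA.
Qed.

Lemma l1_tker_sqr h x : l1 nu (fun y => tker h x y ^+ 2).
Proof.
have l := l1Z (half h x * D ^+ 2) (l1_mehler_sqr s_gt0 r_gt0 r_lt1 x).
apply: (@l1_le _ _ _ nu _ _ _ l) => [|y]; last by rewrite ger0_norm ?sqr_ge0.
exact: (measurable_funX 2 (measurable_section x (measurable_tker h))).
Qed.

Lemma tker_diag_le h x : ip nu (tker h x) (tker h x) <= D ^+ 2 * (half h x * mehler_diag x).
Proof.
have lm := l1_mehler_sqr s_gt0 r_gt0 r_lt1 x.
rewrite mulrCA mulrA -[mehler_diag x]/(ip nu (mehler x) (mehler x)) !ipE -RintZ//; apply: le_Rint.
- exact: l1_tker_sqr.
- exact: l1Z.
- by move=> y; exact: tker_sqr_le.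
Qed.

Lemma l1_half_diag h : l1 nu (fun x => half h x * mehler_diag x).
Proof.
have ld := l1_mehler_diag s_gt0 r_gt0 r_lt1.
apply: (@l1_le _ _ _ nu _ _ _ ld) => [|x].
  by apply: measurable_funM; [exact: measurable_half|exact: l1_measurable ld].
by rewrite ger0_norm ?mulr_ge0 ?half_ge0 ?mehler_diag_ge0// ler_piMl ?half_le1 ?mehler_diag_ge0.
Qed.

Lemma l1_tker_diag h : l1 nu (fun x => ip nu (tker h x) (tker h x)).
Proof.
apply: (@l1_le _ _ _ nu _ _ _ (l1Z (D ^+ 2) (l1_half_diag h))) => [|x].
  apply: (@measurable_Rint _ _ _ _ _ nu (fun x y => tker h x y * tker h x y)).
  by apply: measurable_funM; exact: measurable_tker.
by rewrite ger0_norm ?tker_diag_le// ip_ge0.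
Qed.

Lemma tkopE h f x : l2 nu f ->
  top h f x = half h x * (D * gop (fun y => half h y * f y) x).
Proof.
move=> lf; have lhf := l2_halfM h lf.
have lm := l1_mehlerM s_gt0 r_gt0 r_lt1 x (l2_l1 lhf).
rewrite gopE//; last exact: l2_measurable lhf.
rewrite /kop /ip -(RintZ D lm) -(RintZ _ (l1Z D lm)).
by apply: eq_Rint => y; rewrite /tker; ring.
Qed.

Lemma tkop_out h f x : x < h -> top h f x = 0.
Proof.
move=> xh; rewrite -[RHS](Rint_prob_cst s 0); apply: eq_Rint => y.
by rewrite tker_out ?mul0r//; apply/negP; rewrite -ltNge.
Qed.

(** Compression of the operators to smaller half lines. *)
Lemma tkop_half h h' f x : h <= h' -> l2 nu f ->
  half h' x * top h (fun y => half h' y * f y) x = top h' f x.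
Proof.
move=> hh lf; rewrite !tkopE//; last exact: l2_halfM.
rewrite mulrA [half h' x * _]mulrC halfM//; congr (_ * (_ * _)).
by apply: eq_Rint => y; rewrite mulrA halfM.
Qed.

Lemma l2_tkop h f : l2 nu f -> l2 nu (top h f).
Proof. exact: (@l2_kop _ _ _ nu _ (measurable_tker h) (l1_tker_sqr h) (l1_tker_diag h)). Qed.

Lemma tkop_sym h f g : l2 nu f -> l2 nu g -> ip nu (top h f) g = ip nu f (top h g).
Proof.
exact: (@kop_sym _ _ _ nu _ (measurable_tker h) (tker_ge0 h) (tkerC h) (l1_tker_sqr h)
  (l1_tker_diag h)).
Qed.

Lemma tkop_gt0 h f x a b : l2 nu f -> (forall y, 0 <= f y) -> h <= x -> h <= a ->
  a < b -> (forall y, a < y -> y < b -> 0 < f y) -> 0 < top h f x.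
Proof.
move=> lf f0 hx ha ab fab.
have lk : l2 nu (tker h x).
  split; last exact: l1_tker_sqr.
  exact: (measurable_section x (measurable_tker h)).
apply: (Rint_gt0 s_gt0 (l2_l1M lk lf) _ ab) => [y|y ay yb].
  by rewrite mulr_ge0 ?tker_ge0.
by rewrite mulr_gt0 ?fab// tker_gt0// (le_trans ha)// ltW.
Qed.

Lemma ip_half_gt0 h : 0 < ip nu (half h) (half h).
Proof.
apply: (Rint_gt0 s_gt0 (l2_l1M (l2_half h) (l2_half h)) _ (a := h) (b := h + 1)) => [x||x hx _].
- by rewrite mulr_ge0 ?half_ge0.
- by rewrite ltrDl.
- by rewrite half_in ?mulr1// ltW.
Qed.

Definition tnorm h := fine (L2_opnorm nu (top h)).

Let unit_half h : exists f, [/\ l2 nu f, ip nu f f = 1 &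
  exists2 t, 0 < t & f = (fun x => t * half h x)].
Proof.
pose t := (Num.sqrt (ip nu (half h) (half h)))^-1.
have t0 : 0 < t by rewrite invr_gt0 sqrtr_gt0 ip_half_gt0.
have lh := l2_half h; have lt := l2Z t lh.
exists (fun x => t * half h x); split => //; last by exists t.
rewrite (ipZZ t lh) exprVn.
by rewrite sqr_sqrtr ?ip_ge0// mulVf// gt_eqF// ip_half_gt0.
Qed.

Lemma tnorm_ub h f : l2 nu f -> ip nu (top h f) (top h f) <= tnorm h ^+ 2 * ip nu f f.
Proof.
exact: (@opnorm_ub _ _ _ nu _ (measurable_tker h) (l1_tker_sqr h) (l1_tker_diag h) f).
Qed.

Lemma tnorm_lub h t : t < tnorm h ^+ 2 -> exists f,
  [/\ l2 nu f, ip nu f f = 1 & t <= ip nu (top h f) (top h f)].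
Proof.
have [f [lf f1 _]] := unit_half h.
exact: (@opnorm_lub _ _ _ nu _ (measurable_tker h) (l1_tker_sqr h) (l1_tker_diag h) f t lf f1).
Qed.

Lemma tnorm_ge0 h : 0 <= tnorm h.
Proof.
have [f [lf f1 _]] := unit_half h.
exact: (@opnorm_ge0 _ _ _ nu (tker h) f lf f1).
Qed.

Lemma tnorm_gt0 h : 0 < tnorm h.
Proof.
have [f [lf f1 [t t0 ft]]] := unit_half h.
rewrite lt_neqAle tnorm_ge0 andbT; apply/negP => /eqP l0.
have := tnorm_ub h lf; rewrite -l0 expr0n mul0r leNgt => /negP; apply.
have lA := l2_tkop h lf.
apply: (Rint_gt0 s_gt0 (l2_l1M lA lA) _ (a := h) (b := h + 1)) => [x||x hx _].
- by rewrite -expr2 sqr_ge0.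
- by rewrite ltrDl.
- suff: 0 < top h f x by move=> ?; exact: mulr_gt0.
  apply: (@tkop_gt0 h f x h (h + 1)) => //.
  + by move=> y; rewrite ft mulr_ge0 ?half_ge0// ltW.
  + exact: ltW.
  + by rewrite ltrDl.
  + by move=> y hy _; rewrite ft half_in ?mulr1// ltW.
Qed.

Lemma tnorm_ip h f : l2 nu f -> ip nu f (top h f) <= tnorm h * ip nu f f.
Proof.
move=> lf; have lA := l2_tkop h lf.
apply: le_trans (ler_norm _) _; rewrite -ler_sqr ?nnegrE ?mulr_ge0 ?tnorm_ge0 ?ip_ge0//.
rewrite real_normK ?num_real// exprMn.
apply: le_trans (cauchy_schwarz lf lA) _.
by rewrite mulrC [ip nu f f ^+ 2]expr2 mulrA ler_wpM2r ?ip_ge0// tnorm_ub.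
Qed.

Lemma tnorm_le h l : 0 <= l -> (forall f, l2 nu f -> ip nu f f = 1 ->
  ip nu (top h f) (top h f) <= l ^+ 2) -> tnorm h <= l.
Proof.
move=> l0 hl; rewrite leNgt; apply/negP => ltl.
have ll : l ^+ 2 < tnorm h ^+ 2 by rewrite ltrXn2r// nnegrE tnorm_ge0.
have [f [lf f1 h1]] := @tnorm_lub h ((l ^+ 2 + tnorm h ^+ 2) / 2) (midf_lt ll).2.
have := le_trans h1 (hl f lf f1); rewrite leNgt => /negP; apply.
exact: (midf_lt ll).1.
Qed.

Lemma ground_state h : exists chi, [/\ l2 nu chi, (forall x, 0 <= chi x),
  ip nu chi chi = 1 & forall x, top h chi x = tnorm h * chi x].
Proof.
exact: (@top_eigenfunction _ _ _ nu _ (measurable_tker h) (tker_ge0 h) (tkerC h)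
  (l1_tker_sqr h) (l1_tker_diag h) _ (tnorm_gt0 h) (@tnorm_ub h) (@tnorm_lub h)).
Qed.

Section ground_state.
Variables (h : R) (chi : R -> R).
Hypothesis lchi : l2 nu chi.
Hypothesis chi_ge0 : forall x, 0 <= chi x.
Hypothesis chi1 : ip nu chi chi = 1.
Hypothesis Achi : forall x, top h chi x = tnorm h * chi x.

Lemma ground_gt0 x : h <= x -> 0 < chi x.
Proof.
exact: (@chi_gt0 _ _ _ nu _ (measurable_tker h) (tker_ge0 h) (l1_tker_sqr h)
  [set x | h <= x] _ _ (@tker_gt0 h) (@tker_out h) (tnorm_gt0 h) lchi chi_ge0 chi1 Achi x).
Qed.

Lemma ground_out x : x < h -> chi x = 0.
Proof.
move=> xh; have := Achi x; rewrite tkop_out// => /esym/eqP.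
by rewrite mulf_eq0 gt_eqF ?tnorm_gt0//= => /eqP.
Qed.

Lemma half_ground x : half h x * chi x = chi x.
Proof.
by have [/ground_out->|/half_in->] := ltP x h; rewrite ?mulr0 ?mul1r.
Qed.

Lemma ground_gop x : tnorm h * chi x = half h x * (D * gop chi x).
Proof.
rewrite -Achi tkopE//; congr (_ * (_ * _)).
by apply: eq_Rint => y; rewrite half_ground.
Qed.

Lemma ground_sqr_le x : tnorm h ^+ 2 * chi x ^+ 2 <= D ^+ 2 * (half h x * mehler_diag x).
Proof.
rewrite -exprMn -Achi.
apply: le_trans (@kop_sqr_le _ _ _ nu _ (measurable_tker h) (l1_tker_sqr h) _ x lchi) _.
by rewrite chi1 mulr1 tker_diag_le.
Qed.

Lemma ground_simple f : l2 nu f -> top h f = (fun x => tnorm h * f x) %[ae nu] ->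
  exists c, f = (fun x => c * chi x) %[ae nu].
Proof.
exact: (@eigenvalue_simple _ _ _ nu _ (measurable_tker h) (tker_ge0 h) (tkerC h) (l1_tker_sqr h)
  (l1_tker_diag h) [set x | h <= x] _ _ (@tker_gt0 h) (@tker_out h) (tnorm_gt0 h)
  lchi chi_ge0 chi1 Achi f).
Qed.

End ground_state.

End truncated_kernel.

(** * Dependence of the norm on the half line *)

Lemma increment_bound {R : realType} (l m u w e : R) : 0 <= w ->
  l ^+ 2 * u <= e -> l * (l - 2 * l * u + w) <= l * m -> 0 <= l -> l * (l - m) <= 2 * e.
Proof.
move=> w0 ue lm l0; have lw := mulr_ge0 l0 w0.
rewrite (_ : l * (l - m) = l * (l - 2 * l * u + w) - l * m + 2 * (l ^+ 2 * u) - l * w).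
  by move: (l * _) (l * m) (l ^+ 2 * u) (l * w) lm ue lw => a b c d; lra.
by ring.
Qed.

Section spectral_radius.
Context {R : realType}.
Variables (s r D : R).
Hypothesis s_gt0 : 0 < s.
Hypothesis r_gt0 : 0 < r.
Hypothesis r_lt1 : r < 1.
Hypothesis D_gt0 : 0 < D.

Let nu : probability (measurableTypeR R) R := normal_prob 0 s.
Local Notation leb := (@lebesgue_measure R).
Local Notation gop := (gop s r).
Local Notation mehler_diag := (mehler_diag s r).
Local Notation tker := (tker s r D).
Local Notation top h := (kop nu (tker h)).
Local Notation tnorm := (tnorm s r D).
Implicit Types (h x y : R) (f g : R -> R).

(** The Gaussian average is a contraction, and the kernel is D times the Mehler
kernel. *)
Lemma tnorm_leD h : tnorm h <= D.
Proof.
apply: (tnorm_le s_gt0 r_gt0 r_lt1 D_gt0 (ltW D_gt0)) => f lf f1.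
have lg := l2_halfM h lf; have [lG hG] := gop_contraction s_gt0 r_gt0 r_lt1 lg.
have lA := l2_tkop s_gt0 r_gt0 r_lt1 D_gt0 h lf.
pose G := gop (fun y => half h y * f y).
apply: (@le_trans _ _ (D ^+ 2 * ip nu G G)).
  rewrite !ipE -RintZ; last by case: lG.
  apply: le_Rint => [||x]; [by case: lA|by apply: l1Z; case: lG|].
  rewrite tkopE// exprMn half_sqr exprMn ler_piMl ?half_le1//.
  by rewrite mulr_ge0 ?sqr_ge0.
rewrite -[leRHS]mulr1 ler_wpM2l ?sqr_ge0// -f1; apply: le_trans hG _.
rewrite !ipE; apply: le_Rint => [||x]; [by case: lg|by case: lf|].
by rewrite exprMn half_sqr ler_piMl ?half_le1 ?sqr_ge0.
Qed.

(** The ground state of the smaller half line tests the larger one; its image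
charges the strip between them. *)
Lemma tnorm_decr h1 h2 : h1 < h2 -> tnorm h2 < tnorm h1.
Proof.
move=> h12; have [chi [lchi chi0 chi1 Achi]] := ground_state s_gt0 r_gt0 r_lt1 D_gt0 h2.
have hchi := half_ground s_gt0 r_gt0 r_lt1 D_gt0 Achi.
have l0 := tnorm_ge0 r D s_gt0.
pose u := top h1 chi; have lu : l2 nu u by exact: l2_tkop.
have hu x : half h2 x * u x = tnorm h2 * chi x.
  rewrite -Achi -(tkop_half D s_gt0 r_gt0 r_lt1 _ (ltW h12) lchi).
  by congr (_ * kop _ _ _ _); apply/funext => y; rewrite hchi.
pose w x := u x - half h2 x * u x.
have lw : l2 nu w by apply: l2B => //; exact: l2_halfM.
have uu : ip nu u u = tnorm h2 ^+ 2 + ip nu w w.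
  rewrite -[tnorm h2 ^+ 2]mulr1 -chi1 -ipZZ// !ipE -RintD.
  - apply: eq_Rint => x; rewrite -hu /w.
    have := half_sqr h2 x; move: (half h2 x) (u x) => a b aa.
    rewrite (_ : _ + _ = b ^+ 2 + 2 * (a ^+ 2 - a) * b ^+ 2); last by ring.
    by rewrite aa subrr mulr0 mul0r addr0.
  - by case: (l2Z (tnorm h2) lchi).
  - by case: lw.
have w0 : 0 < ip nu w w.
  apply: (Rint_gt0 s_gt0 (l2_l1M lw lw) _ h12) => [x|x hx xh].
    by rewrite -expr2 sqr_ge0.
  have : 0 < u x.
    apply: (tkop_gt0 s_gt0 r_gt0 r_lt1 D_gt0 (a := h2) (b := h2 + 1)) => //.
    + exact: ltW.
    + exact: ltW.
    + by rewrite ltrDl.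
    + move=> y hy _; apply: (ground_gt0 s_gt0 r_gt0 r_lt1 D_gt0 lchi chi0 chi1 Achi).
      exact: ltW.
  by rewrite /w half_out// mul0r subr0 => ?; exact: mulr_gt0.
rewrite -(ltr_pXn2r (_ : (0 < 2)%N))// ?nnegrE//.
apply: lt_le_trans (_ : ip nu u u <= _); first by rewrite uu ltrDl.
by have := tnorm_ub s_gt0 r_gt0 r_lt1 D_gt0 h1 lchi; rewrite chi1 mulr1.
Qed.

Lemma strip_le : exists2 C, 0 <= C & forall h1 h2, h1 <= h2 ->
  \int[nu]_x ((half h1 x - half h2 x) * mehler_diag x) <= C * (h2 - h1).
Proof.
have [C C0 hC] := mehler_diag_pdf s_gt0 r_gt0 r_lt1.
exists C => // h1 h2 h12.
have stripE x : half h1 x - half h2 x = \1_(`[h1, h2[%classic) x.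
  rewrite !halfE indicE mem_setE in_itv/= ltNge.
  have [h1x|xh1] := leP h1 x; first by case: (h2 <= x)%R; rewrite ?subrr ?subr0.
  by rewrite leNgt (lt_le_trans xh1 h12) subrr.
have md := measurable_mehler_diag s r.
have m1 : measurable_fun [set: R] (\1_(`[h1, h2[%classic) : R -> R).
  exact: measurable_indic.
have mpdf : measurable_fun [set: R] (normal_pdf 0 s) by exact: measurable_normal_pdf.
have h : (\int[nu]_x ((half h1 x - half h2 x) * mehler_diag x)%:E <= (C * (h2 - h1))%:E)%E.
  under eq_integral do rewrite stripE.
  rewrite integral_normal; last exact: measurable_funM.
  apply: (@le_trans _ _ (\int[leb]_x (C * \1_(`[h1, h2[%classic) x)%:E)%E).
    apply: ge0_le_integral => //.
    - move=> x _; rewrite lee_fin !mulr_ge0 ?normal_pdf_ge0 ?mehler_diag_ge0//.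
    - by apply/measurable_EFinP; apply: measurable_funM => //; exact: measurable_funM.
    - by apply/measurable_EFinP; exact: measurable_funM.
    move=> x _; rewrite lee_fin -mulrA mulrC ler_wpM2r//.
    apply: le_trans (hC x) _; rewrite ler_piMr// -expR0 ler_expR mulNr oppr_le0.
    by rewrite mulr_ge0 ?sqr_ge0// ltW// mehler_rate_gt0.
  under eq_integral do rewrite EFinM.
  rewrite ge0_integralZl ?lee_fin//; last first.
    by apply/measurable_EFinP.
  rewrite integral_indic// setIT /= lebesgue_measure_itv/= lte_fin.
  case: ifPn => h; first by rewrite -EFinD -EFinM.
  by rewrite mule0 lee_fin mulr_ge0// subr_ge0.
rewrite -lee_fin -EFin_Rint//.
have ld := l1_mehler_diag s_gt0 r_gt0 r_lt1.
apply: (@l1_le _ _ _ nu _ _ _ ld) => [|x].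
  apply: measurable_funM => //.
  by apply: measurable_funB; exact: measurable_half.
rewrite stripE normrM [X in _ * X]ger0_norm ?mehler_diag_ge0//.
rewrite ler_piMl ?mehler_diag_ge0// indicE.
by case: (_ \in _); rewrite ?normr1 ?normr0 ?ler01.
Qed.

(** Split the ground state chi of the larger half line into f, on the smaller half
line, and u, on the strip. Testing the smaller half line with f instead of chi
costs at most 2 l ||u||^2, and l^2 u(x)^2 is bounded by the diagonal of the
kernel. *)
Lemma tnorm_increment : exists2 C, 0 <= C & forall h1 h2, h1 <= h2 ->
  tnorm h1 * (tnorm h1 - tnorm h2) <= C * (h2 - h1).
Proof.
have [C C0 hC] := strip_le; exists (2 * (D ^+ 2 * C)).
  by apply: mulr_ge0 => //; apply: mulr_ge0 => //; exact: sqr_ge0.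
move=> h1 h2 h12.
have [chi [lchi chi0 chi1 Achi]] := ground_state s_gt0 r_gt0 r_lt1 D_gt0 h1.
have l0 := tnorm_ge0 r D s_gt0.
pose f x := half h2 x * chi x; pose u x := chi x - f x.
have lf : l2 nu f by exact: l2_halfM.
have lu : l2 nu u by exact: l2B.
have fE x : f x = chi x - u x by rewrite /u subKr.
have Af x : top h1 f x = top h1 chi x - top h1 u x.
  rewrite -(@kopB _ _ _ nu _ (@measurable_tker _ s r D h1) (l1_tker_sqr s_gt0 r_gt0 r_lt1 D_gt0 h1) _ _ x lchi lu).
  by apply: eq_Rint => y; rewrite fE.
have lA g : l2 nu g -> l2 nu (top h1 g) by exact: l2_tkop.
have step1 : ip nu f (top h1 f) <= tnorm h2.
  rewrite (_ : ip nu f _ = ip nu f (top h2 f)); last first.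
    apply: eq_Rint => x; rewrite -(tkop_half D s_gt0 r_gt0 r_lt1 _ h12 lf).
    rewrite mulrA {3}/f [_ * half h2 x]mulrC mulrA -expr2 half_sqr; congr (_ * kop _ _ _ _).
    by apply/funext => y; rewrite /f mulrA -expr2 half_sqr.
  apply: le_trans (tnorm_ip s_gt0 r_gt0 r_lt1 D_gt0 h2 lf) _.
  rewrite ler_piMr// -chi1 !ipE; apply: le_Rint => [||x]; [by case: lf|by case: lchi|].
  by rewrite exprMn half_sqr ler_piMl ?half_le1 ?sqr_ge0.
have step2 : ip nu f (top h1 f) = tnorm h1 - 2 * tnorm h1 * ip nu u chi + ip nu u (top h1 u).
  rewrite (_ : ip nu f (top h1 f) = ip nu (fun x => chi x - u x) (fun x => top h1 chi x - top h1 u x)); last first.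
    by apply: eq_Rint => x; rewrite Af fE.
  have lAc := lA _ lchi; have lAu := lA _ lu; have lAB := l2B lAc lAu.
  have AcE : top h1 chi = (fun x => tnorm h1 * chi x) by exact/funext.
  have v1 : ip nu chi (top h1 chi) = tnorm h1.
    by rewrite AcE (@ipC _ _ _ nu chi) (ipZl _ lchi lchi) chi1 mulr1.
  have v2 : ip nu u (top h1 chi) = tnorm h1 * ip nu u chi.
    by rewrite AcE (@ipC _ _ _ nu u) (ipZl _ lchi lu) (@ipC _ _ _ nu chi).
  have v3 : ip nu chi (top h1 u) = tnorm h1 * ip nu u chi.
    rewrite -(tkop_sym s_gt0 r_gt0 r_lt1 D_gt0 h1 lchi lu) AcE (ipZl _ lchi lu).
    by rewrite (@ipC _ _ _ nu chi).
  apply: etrans (ipBl lchi lu lAB) _.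
  rewrite (ipBr lAc lAu lchi) (ipBr lAc lAu lu) v1 v2 v3.
  by ring.
have uc : ip nu u chi = ip nu u u.
  apply: eq_Rint => x; rewrite /u /f; have := half_sqr h2 x.
  move: (half h2 x) (chi x) => a b aa.
  rewrite (_ : (b - a * b) * (b - a * b) = b * (b - a * b) + (a ^+ 2 - a) * b ^+ 2); last by ring.
  by rewrite aa subrr mul0r addr0 mulrC.
have uAu : 0 <= ip nu u (top h1 u).
  have u0 x : 0 <= u x by rewrite /u subr_ge0 ler_piMl ?half_le1.
  apply: Rint_ge0 => x; rewrite mulr_ge0//; apply: Rint_ge0 => y.
  by rewrite mulr_ge0// tker_ge0.
have uu : tnorm h1 ^+ 2 * ip nu u u <= D ^+ 2 * (C * (h2 - h1)).
  apply: (@le_trans _ _ (D ^+ 2 * \int[nu]_x ((half h1 x - half h2 x) * mehler_diag x))); last first.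
    by rewrite ler_wpM2l ?sqr_ge0 ?hC.
  have ls : l1 nu (fun x => (half h1 x - half h2 x) * mehler_diag x).
    under eq_fun do rewrite mulrBl.
    by apply: l1B; exact: l1_half_diag.
  rewrite ipE -RintZ; last by case: lu.
  rewrite -RintZ//; apply: le_Rint; [by apply: l1Z; case: lu|exact: l1Z|move=> x].
  have := ground_sqr_le s_gt0 r_gt0 r_lt1 D_gt0 lchi chi1 Achi x.
  rewrite /u /f; have [xh|hx] := ltP x h2.
    by rewrite (half_out xh) mul0r !subr0.
  by move=> _; rewrite (half_in hx) (half_in (le_trans h12 hx)) mul1r !subrr mul0r expr0n !mulr0.
have := ler_wpM2l (l0 h1) step1; rewrite step2 uc.
move/(increment_bound uAu uu); move=> /(_ (l0 h1)).
by rewrite !mulrA.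
Qed.

Lemma tnorm_noninc h1 h2 : h1 <= h2 -> tnorm h2 <= tnorm h1.
Proof. by rewrite le_eqVlt => /orP[/eqP->//|/tnorm_decr/ltW]. Qed.

Lemma continuous_tnorm : continuous tnorm.
Proof.
move=> h0; have [C C0 hC] := tnorm_increment.
pose l := tnorm (h0 + 1); have l0 : 0 < l by exact: tnorm_gt0.
have loc h : `|h - h0| < 1 -> `|tnorm h0 - tnorm h| <= C / l * `|h0 - h|.
  suff pair a b : a <= b -> b < h0 + 1 -> `|tnorm a - tnorm b| <= C / l * (b - a).
    rewrite ltr_norml => /andP[h1 h2]; have [hh|hh] := leP h0 h.
      have -> : `|h0 - h| = h - h0 by rewrite distrC ger0_norm// subr_ge0.
      by apply: pair => //; lra.
    rewrite distrC (gtr0_norm (_ : 0 < h0 - h)) ?subr_gt0//.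
    by apply: pair; [exact: ltW|rewrite ltrDl].
  move=> ab b1; rewrite ger0_norm ?subr_ge0 ?tnorm_noninc//.
  have la : l <= tnorm a by apply: tnorm_noninc; rewrite (le_trans ab)// ltW.
  rewrite mulrAC (ler_pdivlMr _ _ l0); apply: le_trans (hC a b ab).
  rewrite [leLHS]mulrC.
  by rewrite ler_wpM2r// subr_ge0 tnorm_noninc.
apply/cvgrPdist_le => e e0.
have cv : C / l * `|h0 - h| @[h --> h0] --> 0.
  rewrite -[X in _ --> X](mulr0 (C / l)) -(normr0 R) -(subrr h0).
  by apply: cvgM; [exact: cvg_cst|apply: cvg_norm; apply: cvgB; [exact: cvg_cst|exact: cvg_id]].
have ev : \forall h \near h0, C / l * `|h0 - h| < e by exact: (cvgr_lt _ cv).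
have cv1 : `|h - h0| @[h --> h0] --> 0.
  rewrite -[X in _ --> X](normr0 R) -(subrr h0).
  by apply: cvg_norm; apply: cvgB; [exact: cvg_id|exact: cvg_cst].
have ev1 : \forall h \near h0, `|h - h0| < 1 by exact: (cvgr_lt _ cv1).
near=> h; apply: (le_trans (loc h _)); first by near: h.
by apply: ltW; near: h.
Unshelve. all: by end_near. Qed.

(** The norm is at most the Hilbert-Schmidt norm of the truncated kernel, which
tends to 0 by dominated convergence. *)
Lemma tnorm_small e : 0 < e -> exists h, tnorm h < e.
Proof.
move=> e0; have ld := l1_mehler_diag s_gt0 r_gt0 r_lt1.
pose F (n : nat) x := half (n%:R) x * mehler_diag x.
have lF n : l1 nu (F n) by exact: l1_half_diag.
have [||x|_ cv] := @dct_Rint _ _ _ nu F (fun=> 0) mehler_diag _ ld.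
- by move=> n; exact: l1_measurable (lF n).
- move=> n x; rewrite normrM !ger0_norm ?half_ge0 ?mehler_diag_ge0//.
  by rewrite ler_piMl ?half_le1 ?mehler_diag_ge0.
- apply: cvg_near_cst; near=> n; apply/eqP; rewrite /F half_out ?mul0r//.
  by near: n; exact: nbhs_infty_gtr.
rewrite Rint_prob_cst in cv.
have e2 : 0 < e ^+ 2 / D ^+ 2 by rewrite divr_gt0// exprn_gt0.
have [n _ /(_ n (leqnn n)) hn] : \forall n \near \oo, \int[nu]_x F n x < e ^+ 2 / D ^+ 2.
  exact: (cvgr_lt _ cv).
exists n%:R.
have I0 : 0 <= D ^+ 2 * \int[nu]_x F n x.
  apply: mulr_ge0; first exact: sqr_ge0.
  by apply: Rint_ge0 => x; rewrite mulr_ge0 ?half_ge0 ?mehler_diag_ge0.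
apply: (@le_lt_trans _ _ (Num.sqrt (D ^+ 2 * \int[nu]_x F n x))).
  apply: (tnorm_le s_gt0 r_gt0 r_lt1 D_gt0) => [|f lf f1]; first exact: sqrtr_ge0.
  have lt := l1_tker_diag s_gt0 r_gt0 r_lt1 D_gt0 n%:R.
  rewrite sqr_sqrtr//; apply: le_trans (_ : \int[nu]_x ip nu (tker n%:R x) (tker n%:R x) <= _).
    have := @ip_kop_le _ _ _ nu _ (@measurable_tker _ s r D n%:R)
      (l1_tker_sqr s_gt0 r_gt0 r_lt1 D_gt0 n%:R) lt f lf.
    by rewrite f1 mulr1.
  rewrite -RintZ//; apply: le_Rint => //; first exact: l1Z.
  by move=> x; exact: tker_diag_le.
rewrite -[ltRHS](ger0_norm (ltW e0)) -sqrtr_sqr ltr_sqrt ?exprn_gt0//.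
by rewrite mulrC -ltr_pdivlMr// exprn_gt0.
Unshelve. all: by end_near. Qed.

(** The quadratic form at the indicator of the half line is bounded below by
a b >= a + b - 1 for a and b in [0, 1]. *)
Lemma tnorm_ge_half h : D * (2 * (\int[nu]_x half h x) - 1) <= tnorm h.
Proof.
have lh := l2_half s h; have l1h := l2_l1 lh.
have m01 x : 0 <= half h x <= 1 by rewrite half_ge0 half_le1.
have g01 x : 0 <= gop (half h) x <= 1.
  by apply: gop_bounds => //; exact: measurable_half.
have lg := l1_gop s_gt0 r_gt0 r_lt1 l1h.
have I0 : 0 <= \int[nu]_x half h x by apply: Rint_ge0 => x; exact: half_ge0.
have ipE' : ip nu (half h) (half h) = \int[nu]_x half h x.
  by rewrite ipE; apply: eq_Rint => x; exact: half_sqr.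
have I1 : \int[nu]_x half h x <= 1.
  by rewrite -[leRHS](Rint_prob_cst s 1); apply: le_Rint => // [|x]; [exact: l1_prob_cst|exact: half_le1].
apply: le_trans (_ : tnorm h * ip nu (half h) (half h) <= _); last first.
  by rewrite ipE' ler_piMr// tnorm_ge0.
apply: le_trans (tnorm_ip s_gt0 r_gt0 r_lt1 D_gt0 h lh).
have lc : l1 nu (fun=> 1) by exact: l1_prob_cst.
have lsum := l1B (l1D l1h lg) lc.
have -> : 2 * (\int[nu]_x half h x) - 1 = \int[nu]_x (half h x + gop (half h) x - 1).
  rewrite (RintB (l1D l1h lg) lc) (RintD l1h lg) Rint_prob_cst.
  by rewrite (Rint_gop s_gt0 r_gt0 r_lt1 l1h) mulr_natl mulr2n.
rewrite -RintZ//; apply: le_Rint => [||x].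
- exact: l1Z.
- by apply: l2_l1M => //; exact: l2_tkop.
- rewrite tkopE// mulrA -expr2 half_sqr mulrCA ler_wpM2l ?(ltW D_gt0)//.
  rewrite (_ : (fun y => half h y * half h y) = half h); last first.
    by apply/funext => y; rewrite -expr2 half_sqr.
  have := m01 x; have := g01 x; move: (half h x) (gop _ x) => a b /andP[a0 a1] /andP[b0 b1].
  by nra.
Qed.

Lemma tnorm_large e : 0 < e -> exists h, D - e < tnorm h.
Proof.
move=> e0; pose F (n : nat) : R -> R := half (- n%:R).
have [|n x|x|_ cv] := @dct_Rint _ _ _ nu F (fun=> 1) (fun=> 1) _ (l1_prob_cst s 1).
- by move=> n; exact: measurable_half.
- by rewrite ger0_norm ?half_ge0// half_le1.
- apply: cvg_near_cst; near=> n; apply/eqP; rewrite /F half_in// lerNl.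
  by near: n; exact: nbhs_infty_ger.
rewrite Rint_prob_cst in cv.
have e2 : 1 - e / (2 * D) < 1 by rewrite ltrBlDr ltrDl divr_gt0// mulr_gt0.
have [n _ /(_ n (leqnn n)) hn] : \forall n \near \oo, 1 - e / (2 * D) < \int[nu]_x F n x.
  exact: (cvgr_gt _ cv).
exists (- n%:R); apply: lt_le_trans (tnorm_ge_half _).
rewrite (_ : D - e = D * (2 * (1 - e / (2 * D)) - 1)); last by field; rewrite gt_eqF.
by rewrite ltr_pM2l// ltrD2r ltr_pM2l.
Unshelve. all: by end_near. Qed.

Lemma tnorm_ltD h : tnorm h < D.
Proof. by apply: lt_le_trans (tnorm_leD (h - 1)); apply: tnorm_decr; rewrite ltrBlDr ltrDl. Qed.

End spectral_radius.

(** * Decreasing bijections of the line *)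

(** A point of an open interval is framed by the images of the points at
distance e from its preimage, and f reverses the order: this is the continuity
of the inverse. *)
Lemma decreasing_homeomorphism {R : realType} (f : R -> R) (D : R) :
  (forall x y, x < y -> f y < f x) -> continuous f -> (forall x, 0 < f x < D) ->
  (forall e, 0 < e -> exists x, f x < e) -> (forall e, 0 < e -> exists x, D - e < f x) ->
  homeomorphism_onto f `]0, D[%classic.
Proof.
move=> fdecr cf f0D fsmall flarge.
have lt_f x y : (f y < f x) = (x < y).
  apply/idP/idP => [|/fdecr//]; apply: contraTT; rewrite -!leNgt le_eqVlt.
  by move=> /orP[/eqP->//|/fdecr/ltW].
have finj : injective f.
  move=> x y fxy; have := lt_f x y; have := lt_f y x; rewrite fxy ltxx => h1 h2.
  by apply/eqP; rewrite eq_le !leNgt -h1 -h2.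
have fsurj y : 0 < y < D -> exists x, f x = y.
  move=> /andP[y0 yD]; have [b fb] := fsmall y y0.
  have [a fa] : exists a, y < f a.
    have Dy : 0 < D - y by rewrite subr_gt0.
    by have [a] := flarge _ Dy; rewrite subKr => fa; exists a.
  have ab : a <= b by rewrite ltW// -lt_f (lt_trans fb).
  have [||c _ <-] := @IVT R f a b y ab; last by exists c.
    by apply: continuous_subspaceT.
  by rewrite ge_min le_max (ltW fb) orbT (ltW fa).
pose g y := if pselect (exists x, f x = y) is left h then projT1 (cid h) else 0.
have gK : cancel f g.
  move=> x; rewrite /g; case: pselect => [h|[]]; last by exists x.
  by apply: finj; exact: projT2 (cid h).
have fK y : 0 < y < D -> f (g y) = y.
  by move=> /fsurj[x <-]; rewrite gK.
split=> //.
- split.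
  + by move=> x _ /=; rewrite in_itv/=.
  + by move=> x y _ _; exact: finj.
  + by move=> y /=; rewrite in_itv/= => /fsurj[x <-]; exists x.
- exists g => //; rewrite continuous_open_subspace; last exact: interval_open.
  move=> y; rewrite inE/= in_itv/= => y0D; apply/cvgrPdist_lt => e e0.
  have fy := fK y y0D; set x := g y in fy *.
  have h1 : f (x + e) < y by rewrite -fy lt_f ltrDl.
  have h2 : y < f (x - e) by rewrite -fy lt_f ltrBlDr ltrDl.
  have e1 : \forall z \near y, f (x + e) < z by exact: (cvgr_gt _ cvg_id _ h1).
  have e2 : \forall z \near y, z < f (x - e) by exact: (cvgr_lt _ cvg_id _ h2).
  near=> z.
  have z1 : f (x + e) < z by near: z.
  have z2 : z < f (x - e) by near: z.
  have z0D : 0 < z < D.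
    have /andP[a0 _] := f0D (x + e); have /andP[_ bD] := f0D (x - e).
    by rewrite (lt_trans a0)//= (lt_trans z2).
  move: z1 z2; rewrite -{1 2}(fK z z0D) !lt_f => z1 z2.
  by rewrite ltr_norml; apply/andP; split; lra.
Unshelve. all: by end_near. Qed.

(** * Regularity and uniqueness of the ground state *)

Section ground_state_regularity.
Context {R : realType}.
Variables (s r D h : R) (chi : R -> R).
Hypothesis s_gt0 : 0 < s.
Hypothesis r_gt0 : 0 < r.
Hypothesis r_lt1 : r < 1.
Hypothesis D_gt0 : 0 < D.

Let nu : probability (measurableTypeR R) R := normal_prob 0 s.
Local Notation gop := (gop s r).
Local Notation top h := (kop nu (tker s r D h)).
Local Notation l := (tnorm s r D h).

Hypothesis lchi : l2 nu chi.
Hypothesis chi_ge0 : forall x, 0 <= chi x.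
Hypothesis chi1 : ip nu chi chi = 1.
Hypothesis Achi : forall x, top h chi x = l * chi x.

Let l_gt0 : 0 < l. Proof. exact: tnorm_gt0. Qed.

Let chiE x : h <= x -> chi x = D / l * gop chi x.
Proof.
move=> hx; have := ground_gop s_gt0 r_gt0 r_lt1 D_gt0 lchi Achi x.
rewrite half_in// mul1r => e; rewrite mulrAC -e mulrAC divff ?mul1r//.
by rewrite gt_eqF.
Qed.

Let continuous_extension : continuous (fun x => D / l * gop chi x).
Proof.
move=> x; apply: (@cvgM _ _ (nbhs x)); first exact: cvg_cst.
exact: (continuous_gop s_gt0 r_gt0 r_lt1 (l2_l1 lchi)).
Qed.

Let chi_out x : x < h -> chi x = 0.
Proof. exact: (ground_out s_gt0 r_gt0 r_lt1 D_gt0 Achi). Qed.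

Lemma ground_continuous : {within `[h, +oo[%classic, continuous chi}.
Proof.
apply: (@subspace_eq_continuous _ _ _ (fun x => D / l * gop chi x)).
  by move=> x; rewrite inE/= in_itv/= andbT => /chiE.
exact: continuous_subspaceT.
Qed.

Lemma ground_right_continuous : right_continuous chi.
Proof.
move=> x; have [xh|hx] := ltP x h.
  rewrite (chi_out xh); apply: cvg_near_cst; near=> y.
  apply: chi_out; near: y.
  exact: nbhs_right_lt.
have near_eq : {near x^'+, (fun y => D / l * gop chi y) =1 chi}.
  near=> y; rewrite -chiE//; apply: (le_trans hx); apply: ltW.
  by near: y; exact: nbhs_right_gt.
rewrite (chiE hx); apply: cvg_trans (near_eq_cvg near_eq) _.
by apply: cvg_at_right_filter; exact: continuous_extension.
Unshelve. all: by end_near. Qed.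

Lemma ground_moment_step p q : (1 < p)%N -> (1 < q)%N ->
  r ^+ 2 * (q%:R - 1) <= p%:R - 1 -> l1 nu (fun x => chi x ^+ p) ->
  l1 nu (fun x => chi x ^+ q) /\
  (\int[nu]_x chi x ^+ q) ^+ p <= ((D / l) ^+ q) ^+ p * (\int[nu]_x chi x ^+ p) ^+ q.
Proof.
move=> p1 q1 pqr lp.
have [lg hg] := hypercontractive s_gt0 r_gt0 r_lt1 p1 q1 pqr (l2_l1 lchi)
  chi_ge0 ground_right_continuous lp.
have le_chi x : chi x ^+ q <= (D / l) ^+ q * gop chi x ^+ q.
  have g0 : 0 <= D / l * gop chi x by rewrite mulr_ge0 ?gop_ge0// divr_ge0// ltW.
  rewrite -exprMn; apply: lerXn2r; rewrite ?nnegrE//.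
  have [xh|/chiE<-//] := ltP x h.
  by rewrite chi_out.
have lq : l1 nu (fun x => chi x ^+ q).
  apply: (@l1_le _ _ _ nu _ _ _ (l1Z ((D / l) ^+ q) lg)) => [|x].
    exact: (measurable_funX q (l2_measurable lchi)).
  by rewrite ger0_norm ?exprn_ge0.
split=> //.
have I0 : 0 <= \int[nu]_x chi x ^+ q by apply: Rint_ge0 => x; exact: exprn_ge0.
have Dl0 : 0 <= (D / l) ^+ q by apply: exprn_ge0; rewrite divr_ge0// ltW.
have J0 : 0 <= \int[nu]_x gop chi x ^+ q.
  by apply: Rint_ge0 => x; apply: exprn_ge0; exact: gop_ge0.
apply: (@le_trans _ _ (((D / l) ^+ q * \int[nu]_x gop chi x ^+ q) ^+ p)).
  apply: lerXn2r; rewrite ?nnegrE ?mulr_ge0//.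
  by rewrite -RintZ//; apply: le_Rint => //; exact: l1Z.
by rewrite exprMn ler_wpM2l// exprn_ge0.
Qed.

(** Each application of the operator raises the exponent from 1 + n^(2k) to
1 + n^(2k+2), the optimal one for the correlation 1 / n, at the price of a factor
D / l. *)
Lemma ground_moments n k : (1 < n)%N -> r = n%:R^-1 ->
  l1 nu (fun x => chi x ^+ (1 + n ^ (2 * k))) /\
  \int[nu]_x chi x ^+ (1 + n ^ (2 * k)) <= ((D / l) ^+ k) ^+ (1 + n ^ (2 * k)).
Proof.
move=> n1 rn; have Dl0 : 0 <= D / l by rewrite divr_ge0// ltW.
elim: k => [|k [lp IH]].
  by rewrite muln0 expn0 expr0 expr1n -ipE chi1 lexx; split => //; case: lchi.
have n0 : 0 < n%:R :> R by rewrite ltr0n ltnW.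
have [||||lq hq] := @ground_moment_step (1 + n ^ (2 * k)) (1 + n ^ (2 * k.+1)).
- by rewrite -[ltnLHS]addn0 ltn_add2l expn_gt0 ltnW.
- by rewrite -[ltnLHS]addn0 ltn_add2l expn_gt0 ltnW.
- rewrite !natrD ![1 + _]addrC !addrK mulnS expnD natrM natrX rn mulrA.
  by rewrite -exprMn mulVf ?gt_eqF// expr1n mul1r.
- exact: lp.
split => //.
have p0 : (0 < 1 + n ^ (2 * k))%N by [].
have I0 m : 0 <= \int[nu]_x chi x ^+ m by apply: Rint_ge0 => x; exact: exprn_ge0.
rewrite -(ler_pXn2r p0) ?nnegrE//; last by rewrite !exprn_ge0.
apply: le_trans hq _; move: (1 + n ^ (2 * k.+1))%N (1 + n ^ (2 * k))%N IH => q p IH.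
rewrite [leRHS](_ : _ = ((D / l) ^+ q) ^+ p * (((D / l) ^+ k) ^+ p) ^+ q); last first.
  by move: (D / l) => z; rewrite exprS !exprMn; congr (_ * _); exact: exprAC.
rewrite ler_wpM2l ?exprn_ge0//; apply: lerXn2r => //; rewrite nnegrE//.
by rewrite !exprn_ge0.
Qed.

Lemma ground_Lnorm n k : (1 < n)%N -> r = n%:R^-1 ->
  ('N[nu]_((1 + n%:R ^+ (2 * k))%:E)[EFin \o chi] <= ((D / l) ^+ k)%:E)%E.
Proof.
move=> n1 rn; have [lq hq] := ground_moments k n1 rn.
have Dl0 : 0 <= (D / l) ^+ k by rewrite exprn_ge0// divr_ge0// ltW.
have q0 : 0 < (1 + n ^ (2 * k))%:R :> R by rewrite ltr0n.
rewrite (_ : 1 + n%:R ^+ (2 * k) = (1 + n ^ (2 * k))%:R); last by rewrite natrD natrX.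
rewrite (@Lnorm_nat _ _ _ nu chi _ chi_ge0 lq) lee_fin.
have root : (((D / l) ^+ k) ^+ (1 + n ^ (2 * k))) `^ (1 + n ^ (2 * k))%:R^-1 = (D / l) ^+ k.
  by rewrite (expn_powR (m := 1)) ?expr1// divff// gt_eqF.
rewrite -root; apply: ge0_ler_powR => //; rewrite ?nnegrE ?invr_ge0 ?(ltW q0)//.
  by apply: Rint_ge0 => x; exact: exprn_ge0.
exact: exprn_ge0.
Qed.

(** Simplicity makes f and chi proportional, with a factor 1 because both are
nonnegative of norm 1. Almost everywhere equal functions that are continuous from
the right on the half line are equal there, nu having full support. *)
Lemma ground_unique f : l2 nu f -> (forall x, 0 <= f x) -> ip nu f f = 1 ->
  {within `[h, +oo[%classic, continuous f} -> (forall x, x < h -> f x = 0) ->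
  top h f = (fun x => l * f x) %[ae nu] -> chi = f.
Proof.
move=> lf f0 f1 cf fout Af.
have [k fk] := ground_simple s_gt0 r_gt0 r_lt1 D_gt0 lchi chi_ge0 chi1 Achi lf Af.
have chi_pos := ground_gt0 s_gt0 r_gt0 r_lt1 D_gt0 lchi chi_ge0 chi1 Achi.
have k0 : 0 <= k.
  have hh : h < h + 1 by rewrite ltrDl.
  have [x [hx _ fx]] := ae_point s_gt0 hh fk.
  by have := f0 x; rewrite fx// pmulr_lge0// chi_pos// ltW.
have k1 : k = 1.
  have lk := l2Z k lchi.
  have := ae_eq_ip lf lk lf fk; rewrite f1 (@ipC _ _ _ nu _ f) (ae_eq_ip lf lk lk fk).
  rewrite (ipZZ k lchi) chi1 mulr1 => /esym/eqP; rewrite sqrf_eq1 => /orP[/eqP//|/eqP k1].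
  by move: k0; rewrite k1 lerNr oppr0 leNgt ltr01.
have fchi : {ae nu, forall x, f x = chi x}.
  have [N [mN N0 fN]] := fk; exists N; split=> // x /= fx.
  by apply: fN => /= fx'; apply: fx; rewrite fx'// k1 mul1r.
have fr x : h <= x -> f @ x^'+ --> f x.
  have /continuous_within_itvcyP[cfo cfh] := cf.
  rewrite le_eqVlt => /orP[/eqP<-//|hx].
  by apply/cvg_at_right_filter/cfo; rewrite in_itv/= hx.
apply/funext => x; have [xh|hx] := ltP x h; first by rewrite fout// chi_out.
apply/eqP; apply: contrapT => /negP neq.
have cv : f y - chi y @[y --> x^'+] --> f x - chi x.
  by apply: cvgB; [exact: fr|exact: ground_right_continuous].
have nz : f x - chi x != 0 by rewrite subr_eq0 eq_sym.
have [e /= e0 he] := cvgr_neq0 _ cv nz.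
have xe : x < x + e by rewrite ltrDl.
have [y [xy ye fy]] := ae_point s_gt0 xe fchi.
have := he y; rewrite /ball_/= fy subrr eqxx => /(_ _ xy) H.
suff: false by [].
by apply: H; rewrite ltr0_norm ?subr_lt0//; lra.
Qed.

End ground_state_regularity.

(** * The operators L_h *)

Theorem proposition3p1 (R : realType) (d : nat) (d2 : (2 <= d)%N) :
  (forall h : R,
     L2_simple_eigenvalue (nu d) (Lh d h) (lambda d h) /\
     exists chi : R -> R,
       unique
         (fun f : R -> R =>
           [/\ (forall x, 0 <= f x),
               f \in Lfun (nu d) 2%:E /\
                 ('N[nu d]_2%:E[EFin \o f])%E = 1%E,
               {within `[h, +oo[, continuous f} /\
                 (forall x, h <= x -> 0 < f x),
               (forall x, x < h -> f x = 0) &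
               Lh d h f = lambda d h \*o f %[ae nu d]]) chi /\
       forall k : nat,
         ('N[nu d]_((1 + d%:R ^+ (2 * k))%:E)[EFin \o chi]
            <= ((d%:R / lambda d h) ^+ k)%:E)%E) /\
  (forall h1 h2 : R, h1 < h2 -> lambda d h2 < lambda d h1) /\
  homeomorphism_onto (lambda d : R -> R) `]0, d%:R[%classic.
Proof.
pose D : R := d%:R; pose r := D^-1; pose s := Num.sqrt (D / (D ^+ 2 - 1)).
have D1 : 1 < D by rewrite ltr1n.
have D0 : 0 < D by exact: lt_trans D1.
have r0 : 0 < r by rewrite invr_gt0.
have r1 : r < 1 by rewrite invf_lt1.
have s0 : 0 < s by rewrite sqrtr_gt0 divr_gt0// subr_gt0 exprn_egt1.
have LhE h (f : R -> R) : l2 (nu d) f -> Lh d h f = kop (nu d) (tker s r D h) f.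
  move=> lf; apply/funext => x; rewrite (tkopE D s0 r0 r1 h x lf).
  rewrite /Lh /Lop /pih /gop /half -/D exprVn; congr (_ * (_ * _)).
  by apply: eq_Rint => y; rewrite [x / D]mulrC.
have lamE : lambda d = tnorm s r D.
  by apply/funext => h; rewrite /lambda /tnorm (@eq_L2_opnorm _ _ _ (nu d) (tker s r D h) _ (LhE h)).
split; last first.
  rewrite lamE; split; first exact: tnorm_decr.
  apply: decreasing_homeomorphism.
  - exact: tnorm_decr.
  - exact: continuous_tnorm.
  - by move=> h; rewrite tnorm_gt0// tnorm_ltD.
  - exact: tnorm_small.
  - exact: tnorm_large.
move=> h; rewrite lamE.
have [chi [lchi chi0 chi1 Achi]] := ground_state s0 r0 r1 D0 h.
have chi_pos := ground_gt0 s0 r0 r1 D0 lchi chi0 chi1 Achi.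
have Lchi : Lh d h chi = tnorm s r D h \*o chi.
  by rewrite LhE//; apply/funext => x; exact: Achi.
split.
  exists chi; split.
  - by split; [exact/l2P|rewrite Lchi; exact: ae_eq_refl].
  - move=> chi00; have hh : h < h + 1 by rewrite ltrDl.
    have [x [hx _ /(_ I)]] := ae_point s0 hh chi00.
    by move/eqP; rewrite gt_eqF// chi_pos// ltW.
  - move=> g [/l2P lg]; rewrite LhE// => Lg.
    exact: (ground_simple s0 r0 r1 D0 lchi chi0 chi1 Achi lg Lg).
exists chi; split; last first.
  move=> k; exact: (ground_Lnorm s0 r0 r1 D0 lchi chi0 chi1 Achi).
split.
  split=> //.
  - by split; [exact/l2P|exact/Lnorm2_eq1].
  - by split=> //; exact: (ground_continuous s0 r0 r1 D0 lchi Achi).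
  - exact: (ground_out s0 r0 r1 D0 Achi).
  - by rewrite Lchi; exact: ae_eq_refl.
move=> f [f0 [/l2P lf /(Lnorm2_eq1 lf) f1] [cf _] fout]; rewrite LhE// => Lf.
exact: (ground_unique s0 r0 r1 D0 lchi chi0 chi1 Achi lf).
Qed.
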